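(* For $t\in\mathbb{R}$ let $S_tg(\omega)=g(e^{t}\omega)$ on $B_{\infty,\circ}(\mathbb{U},i)$, and let $\Gamma$ be the infinitesimal generator of $(S_{t})_{t\in\mathbb{R}}$. Then, for $\lambda\in\rho(\Gamma)$, the following hold: 1. For $h\in B_{\infty,\circ}(\mathbb{U},i)$, (i) $R(\lambda,\Gamma)h(\omega)=\omega^{\lambda}\int_{\omega}^{\infty}\frac{1}{z^{\lambda+1}}h(z)\,dz$ if $\Re(\lambda)>0$; (ii) $R(\lambda,\Gamma)h(\omega)=-\omega^{\lambda}\int_{0}^{\omega}\frac{1}{z^{\lambda+1}}h(z)\,dz$ if $\Re(\lambda)<0$. 2. $\sigma(R(\lambda,\Gamma))=\left\{w\in\mathbb{C}:\left|w-\frac{1}{2\Re(\lambda)}\right|=\frac{1}{2|\Re(\lambda)|}\right\}$. 3. $r(R(\lambda,\Gamma))=\|R(\lambda,\Gamma)\|=\frac{1}{|\Re(\lambda)|}$.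
   Context: $\mathbb{U}=\{\omega\in\mathbb{C}:\Im(\omega)>0\}$ is the upper half plane and $\mathcal{H}(\mathbb{U})$ is the space of analytic functions on $\mathbb{U}$. The little Bloch space is $B_{\infty,\circ}(\mathbb{U})=\{f\in\mathcal{H}(\mathbb{U}):\lim_{\Im(\omega)\to0}\Im(\omega)|f'(\omega)|=0\}$, with the norm of the Bloch space $B_\infty(\mathbb{U})=\{f\in\mathcal H(\mathbb{U}):\sup_{\omega\in\mathbb{U}}\Im(\omega)|f'(\omega)|<\infty\}$, namely $\|f\|_{B_\infty(\mathbb{U})}=|f(i)|+\sup_{\omega\in\mathbb{U}}\Im(\omega)|f'(\omega)|$. Its subspace $B_{\infty,\circ}(\mathbb{U},i)=\{f\in B_{\infty,\circ}(\mathbb{U}):f(i)=0\}$ is equipped with the norm $\|f\|=\sup_{\omega\in\mathbb{U}}\Im(\omega)|f'(\omega)|$. The infinitesimal generator is $\Gamma g=\lim_{t\to0^+}\frac{S_tg-g}{t}$ (norm limit), with domain $\mathcal{D}(\Gamma)$ the set of $g$ for which the limit exists. For a closed operator $T$, $\rho(T)=\{\lambda\in\mathbb{C}:\lambda I-T\text{ is bijective}\}$, $\sigma(T)=\mathbb{C}\setminus\rho(T)$, $R(\lambda,T)=(\lambda I-T)^{-1}$ for $\lambda\in\rho(T)$, and $r(T)=\sup\{|\lambda|:\lambda\in\sigma(T)\}$ is the spectral radius. Powers are taken with the principal branch on $\mathbb{U}$. The integrals are along the ray through $\omega$ from the origin: $\int_\omega^\infty$ is along $z=e^{s}\omega$,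 $s\in[0,\infty)$, and $\int_0^\omega$ is along $z=e^{-s}\omega$ from $0$ to $\omega$.
   Formalization: Γ is taken modulo constants, since S_t does not preserve f(i)=0; in item 1 the resolvent is the displayed expression minus its value at i. The little Bloch limit is also taken at the boundary including infinity, as the literal limit (also covered) makes ρ(Γ) empty. *)

(* Defs.v *)
From Stdlib Require Import Reals.
From Coquelicot Require Import Coquelicot.
Open Scope R_scope.

Definition U (w : C) : Prop := 0 < Im w.

(* Functions on U are total functions C -> C whose values off U are irrelevant;
   equality of such functions is agreement on U. *)
Definition eqU (f g : C -> C) : Prop := forall w : C, U w -> f w = g w.

Definition holomorphic_U (f : C -> C) : Prop :=
  forall w : C, U w -> @ex_derive C_AbsRing C_NormedModule f w.

(* For holomorphic f, [C_derive f] is the complex derivative on U.  Extended-real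
   valued, so that nothing is lost when the supremum is infinite. *)
Definition bloch_norm (f : C -> C) : Rbar :=
  Lub_Rbar (fun x : R => exists w : C, U w /\ x = Im w * Cmod (C_derive f w)).

Definition bloch (f : C -> C) : Prop :=
  holomorphic_U f /\ Rbar_lt (bloch_norm f) p_infty.

(* Two readings of "Im w -> 0" in the definition of the little Bloch space.
   [im_to_zero]: Im w tends to 0, uniformly in Re w.
   [to_boundary]: w tends to the boundary of U in the Riemann sphere, that is,
   to the real line or to infinity.  This gives the image of the little Bloch
   space of the disc under the Cayley transform. *)
Definition im_to_zero : (C -> Prop) -> Prop :=
  fun P => exists delta : posreal, forall w : C, U w -> Im w < delta -> P w.

Definition to_boundary : (C -> Prop) -> Prop :=
  fun P => exists delta : posreal,
    forall w : C, U w -> (Im w < delta \/ / delta < Cmod w) -> P w.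

Definition little_bloch (F : (C -> Prop) -> Prop) (f : C -> C) : Prop :=
  bloch f /\
  filterlim (fun w : C => Im w * Cmod (C_derive f w)) F (locally 0).

(* The representatives, normalized at i, of little Bloch functions modulo
   constants; [bloch_norm] is a norm on them. *)
Definition little_bloch_i (F : (C -> Prop) -> Prop) (f : C -> C) : Prop :=
  little_bloch F f /\ f Ci = 0%C.

(* Partially defined operators, given by their graphs. *)
Definition operator : Type := (C -> C) -> (C -> C) -> Prop.

Definition scalar_minus (lam : C) (T : operator) : operator :=
  fun f h => exists g, T f g /\ eqU h (fun w => lam * f w - g w)%C.

Definition bijective_onto (X : (C -> C) -> Prop) (T : operator) : Prop :=
  (forall h, X h -> exists f, T f h) /\
  (forall f1 f2 h, T f1 h -> T f2 h -> eqU f1 f2).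

Definition resolvent_set (X : (C -> C) -> Prop) (T : operator) (lam : C) : Prop :=
  bijective_onto X (scalar_minus lam T).

Definition spectrum (X : (C -> C) -> Prop) (T : operator) (lam : C) : Prop :=
  ~ resolvent_set X T lam.

Definition resolvent (lam : C) (T : operator) : operator :=
  fun h f => scalar_minus lam T f h.

Definition spectral_radius (X : (C -> C) -> Prop) (T : operator) : Rbar :=
  Lub_Rbar (fun x : R => exists lam : C, spectrum X T lam /\ x = Cmod lam).

Definition op_norm (T : operator) : Rbar :=
  Lub_Rbar (fun x : R => exists f g : C -> C,
    T f g /\ Rbar_le (bloch_norm f) 1 /\ bloch_norm g = Finite x).

Definition dilation (t : R) (g : C -> C) : C -> C := fun w => g (exp t * w)%C.

(* [dilation t g] need not vanish at i when g does, so the difference quotients lie in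
   the normalized space only up to an additive constant, which [bloch_norm]
   ignores; the limit k is the normalized one. *)
Definition generator (F : (C -> Prop) -> Prop) : operator :=
  fun g k => little_bloch_i F g /\ little_bloch_i F k /\
    forall eps : posreal, at_right 0 (fun t : R =>
      Rbar_lt (bloch_norm (fun w => (dilation t g w - g w) / t - k w)%C) eps).

Definition cexp (z : C) : C := (exp (Re z) * cos (Im z), exp (Re z) * sin (Im z)).

(* Principal branch: [acos (Re z / Cmod z)] is the principal argument when z
   is in U. *)
Definition clog_U (z : C) : C := (ln (Cmod z), acos (Re z / Cmod z)).

Definition cpow (z lam : C) : C := cexp (lam * clog_U z)%C.

(* The (possibly improper) integral of f dz along z = e^s w, with the parameter
   s running from Fa to Fb; dz = e^s w ds. *)
Definition is_ray_integral (f : C -> C) (w : C)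
    (Fa Fb : (R -> Prop) -> Prop) (v : C) : Prop :=
  @is_RInt_gen C_R_NormedModule (fun s : R => f (exp s * w) * (exp s * w))%C Fa Fb v.

Definition is_int_to_infty (f : C -> C) (w v : C) : Prop :=
  is_ray_integral f w (at_point 0) (Rbar_locally p_infty) v.

Definition is_int_from_0 (f : C -> C) (w v : C) : Prop :=
  is_ray_integral f w (Rbar_locally m_infty) (at_point 0) v.

(* f is the element of the normalized space represented by g modulo constants. *)
Definition normalization_of (g f : C -> C) : Prop :=
  eqU f (fun w => g w - g Ci)%C.

(* Main.v *)
Require Import Defs.
From Stdlib Require Import Reals Lra Lia Classical IndefiniteDescription.
From Coquelicot Require Import Coquelicot.
Open Scope R_scope.

(** Dilations are isometries for the Bloch seminorm, and an element of the domain of the generator,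
    as well as its image, is a strongly continuous vector of the group; moreover
    Gamma f = w f'(w) - i f'(i).  When Im w -> 0 is read uniformly in Re w, e^{iw} - e^{-1} lies in
    the space but is not strongly continuous, so it is never of the form lam f - Gamma f and the
    resolvent set is empty.

    When w tends to the boundary in the Riemann sphere, dissipativity gives
    |Re lam| ||f|| <= ||lam f - Gamma f||.  Since the resolvent set is not empty, the Neumann series
    and completeness carry solvability over a whole half plane, and the inversion w -> -1/w, which
    conjugates S_t to S_{-t}, carries it to the other one; an explicit right-hand side shows that no
    point of the imaginary axis belongs to the resolvent set.  The spectrum of R(lam, Gamma) is then
    the image of the imaginary axis under mu -> 1/(lam - mu), together with 0 because the domain is
    not the whole space.  Neumann's series also shows that the norm of the resolvent is at least its
    spectral radius, and dissipativity that it is at most 1/|Re lam|.  For the integral formulas,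
    -e^{-lam s} (f(e^s w) + i f'(i)/lam) is a primitive of e^{-lam s} h(e^s w).

    Complex differentiability is enough throughout: no second derivative, nor the continuity of the
    first one, is needed for a general f, so Cauchy's theorem plays no role. *)

(** * Complex differentiability and the exponential *)

(** A dilation does not preserve vanishing at i, so [generator] works modulo constants. The price is
    the term i f'(i) in Gamma f, which shifts f by i f'(i)/lam in the integral formulas and is why
    these are read after normalization. Showing directly that the integrals define a resolvent would
    require seminorm estimates and convergence of difference quotients for them; instead the one
    solvable lam given by the hypothesis is propagated, through discs of radius |Re lam| that touch
    the imaginary axis. The limit defining the generator is one-sided, t -> 0+, so the dissipative
    estimate sees only Re lam > 0 and the inversion must reach the other side; there S_{-t} f - f =
    - S_{-t} (S_t f - f), and the limit is Gamma f only because Gamma f is itself a strongly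
    continuous vector. On the imaginary axis the obstruction sits at 0 and at infinity: for f in the
    space w f'(w) tends to 0 at both ends of the axis, whereas 1/(w+i), on which the right-hand
    sides are built, has the distinct limits -i and 0 there. *)

Notation is_Cderive := (@is_derive C_AbsRing C_NormedModule).

Lemma is_Cderive_eps (f : C -> C) (w l : C) :
  is_Cderive f w l <->
  forall eps : R, 0 < eps -> exists delta : R, 0 < delta /\
    forall z : C, Cmod (z - w) < delta ->
      Cmod (f z - f w - l * (z - w)) <= eps * Cmod (z - w).
Proof.
split.
- intros [_ H] eps He.
  specialize (H w (fun P HP => HP) (mkposreal eps He)).
  destruct H as [d Hd].
  exists d; split; [apply cond_pos|].
  intros z Hz; specialize (Hd z Hz); simpl in Hd.
  replace (f z - f w - l * (z - w))%C with
    (minus (minus (f z) (f w)) (@scal C_AbsRing C_NormedModule (minus z w) l)).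
  + exact Hd.
  + change ((f z + - f w) + - ((z + - w) * l) = f z - f w - l * (z - w))%C; ring.
- intros H; split.
  + apply is_linear_scal_l.
  + intros x Hx.
    assert (x = w) as ->.
    { symmetry; apply is_filter_lim_locally_unique; exact Hx. }
    intros eps.
    destruct (H eps (cond_pos eps)) as [d [Hd H']].
    exists (mkposreal d Hd); intros z Hz.
    specialize (H' z Hz).
    replace (f z - f w - l * (z - w))%C with
      (minus (minus (f z) (f w)) (@scal C_AbsRing C_NormedModule (minus z w) l)) in H'.
    * exact H'.
    * change ((f z + - f w) + - ((z + - w) * l) = f z - f w - l * (z - w))%C; ring.
Qed.

Lemma is_Cderive_const (c w : C) : is_Cderive (fun _ => c) w (RtoC 0).
Proof. exact (@is_derive_const C_AbsRing C_NormedModule c w). Qed.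

Lemma is_Cderive_id (w : C) : is_Cderive (fun z => z) w (RtoC 1).
Proof.
apply is_Cderive_eps; intros eps He; exists 1; split; [lra|]; intros z _.
replace (z - w - 1 * (z - w))%C with (RtoC 0) by ring.
rewrite Cmod_0; apply Rmult_le_pos; [lra|apply Cmod_ge_0].
Qed.

Lemma is_Cderive_plus (f g : C -> C) (w a b : C) :
  is_Cderive f w a -> is_Cderive g w b ->
  is_Cderive (fun z => f z + g z)%C w (a + b)%C.
Proof. exact (@is_derive_plus C_AbsRing C_NormedModule f g w a b). Qed.

Lemma is_Cderive_minus (f g : C -> C) (w a b : C) :
  is_Cderive f w a -> is_Cderive g w b ->
  is_Cderive (fun z => f z - g z)%C w (a - b)%C.
Proof. exact (@is_derive_minus C_AbsRing C_NormedModule f g w a b). Qed.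

Lemma is_Cderive_opp (f : C -> C) (w a : C) :
  is_Cderive f w a -> is_Cderive (fun z => - f z)%C w (- a)%C.
Proof. exact (@is_derive_opp C_AbsRing C_NormedModule f w a). Qed.

Lemma is_Cderive_scal (f : C -> C) (c w a : C) :
  is_Cderive f w a -> is_Cderive (fun z => c * f z)%C w (c * a)%C.
Proof.
intros H; apply is_Cderive_eps; intros eps He.
pose proof (Cmod_ge_0 c) as Hc.
destruct (proj1 (is_Cderive_eps f w a) H (eps / (1 + Cmod c))) as [d [Hd H1]].
{ apply Rdiv_lt_0_compat; lra. }
exists d; split; [exact Hd|]; intros z Hz.
replace (c * f z - c * f w - c * a * (z - w))%C
  with (c * (f z - f w - a * (z - w)))%C by ring.
rewrite Cmod_mult.
apply Rle_trans with (Cmod c * (eps / (1 + Cmod c) * Cmod (z - w))).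
{ apply Rmult_le_compat_l; auto. }
replace (Cmod c * (eps / (1 + Cmod c) * Cmod (z - w)))
  with (Cmod c / (1 + Cmod c) * (eps * Cmod (z - w))) by (field; lra).
rewrite <- (Rmult_1_l (eps * Cmod (z - w))) at 2.
apply Rmult_le_compat_r.
{ apply Rmult_le_pos; [lra|apply Cmod_ge_0]. }
apply Rmult_le_reg_r with (1 + Cmod c); [lra|].
unfold Rdiv; rewrite Rmult_assoc, Rinv_l; lra.
Qed.

Lemma is_Cderive_locally_bounded (f : C -> C) (w a : C) :
  is_Cderive f w a -> exists delta : R, 0 < delta /\
    forall z : C, Cmod (z - w) < delta ->
      Cmod (f z - f w) <= (1 + Cmod a) * Cmod (z - w).
Proof.
intros H; destruct (proj1 (is_Cderive_eps f w a) H 1 Rlt_0_1) as [d [Hd H1]].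
exists d; split; [exact Hd|]; intros z Hz.
replace (f z - f w)%C with ((f z - f w - a * (z - w)) + a * (z - w))%C by ring.
eapply Rle_trans; [apply Cmod_triangle|].
rewrite Cmod_mult; specialize (H1 z Hz); lra.
Qed.

Lemma is_Cderive_mult (f g : C -> C) (w a b : C) :
  is_Cderive f w a -> is_Cderive g w b ->
  is_Cderive (fun z => f z * g z)%C w (a * g w + f w * b)%C.
Proof.
intros Hf Hg; apply is_Cderive_eps; intros eps He.
destruct (is_Cderive_locally_bounded f w a Hf) as [d1 [Hd1 B1]].
destruct (is_Cderive_locally_bounded g w b Hg) as [d2 [Hd2 B2]].
pose proof (Cmod_ge_0 (g w)) as Pg; pose proof (Cmod_ge_0 (f w)) as Pf.
pose proof (Cmod_ge_0 a) as Pa; pose proof (Cmod_ge_0 b) as Pb.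
destruct (proj1 (is_Cderive_eps f w a) Hf (eps / 3 / (1 + Cmod (g w)))) as [d3 [Hd3 B3]].
{ apply Rdiv_lt_0_compat; lra. }
destruct (proj1 (is_Cderive_eps g w b) Hg (eps / 3 / (1 + Cmod (f w)))) as [d4 [Hd4 B4]].
{ apply Rdiv_lt_0_compat; lra. }
set (K := (1 + Cmod a) * (1 + Cmod b)).
assert (HK : 0 < K) by (apply Rmult_lt_0_compat; lra).
assert (Hd5 : 0 < eps / 3 / K) by (apply Rdiv_lt_0_compat; lra).
exists (Rmin (Rmin d1 d2) (Rmin (Rmin d3 d4) (eps / 3 / K))); split.
{ repeat apply Rmin_glb_lt; auto. }
intros z Hz.
assert (Z1 := Rlt_le_trans _ _ _ Hz (Rmin_l _ _)).
assert (Z2 := Rlt_le_trans _ _ _ Hz (Rmin_r _ _)).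
assert (Z3 := Rlt_le_trans _ _ _ Z2 (Rmin_l _ _)).
assert (Z4 := Rlt_le_trans _ _ _ Z2 (Rmin_r _ _)).
specialize (B1 z (Rlt_le_trans _ _ _ Z1 (Rmin_l _ _))).
specialize (B2 z (Rlt_le_trans _ _ _ Z1 (Rmin_r _ _))).
specialize (B3 z (Rlt_le_trans _ _ _ Z3 (Rmin_l _ _))).
specialize (B4 z (Rlt_le_trans _ _ _ Z3 (Rmin_r _ _))).
replace (f z * g z - f w * g w - (a * g w + f w * b) * (z - w))%C with
  ((f z - f w - a * (z - w)) * g w + f w * (g z - g w - b * (z - w))
   + (f z - f w) * (g z - g w))%C by ring.
pose proof (Cmod_ge_0 (z - w)) as Pz.
eapply Rle_trans; [apply Cmod_triangle|].
eapply Rle_trans; [apply Rplus_le_compat_r, Cmod_triangle|].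
rewrite !Cmod_mult.
replace (eps * Cmod (z - w)) with
  (eps / 3 * Cmod (z - w) + eps / 3 * Cmod (z - w) + eps / 3 * Cmod (z - w)) by field.
assert (aux : forall x e r, 0 <= x -> 0 <= r -> 0 < e -> e / (1 + x) * r * x <= e * r).
{ intros x e r Hx Hr He'.
  replace (e / (1 + x) * r * x) with (e * r * (x / (1 + x))) by (field; lra).
  rewrite <- (Rmult_1_r (e * r)) at 2.
  apply Rmult_le_compat_l; [apply Rmult_le_pos; lra|].
  apply Rmult_le_reg_r with (1 + x); [lra|].
  unfold Rdiv; rewrite Rmult_assoc, Rinv_l; lra. }
apply Rplus_le_compat; [apply Rplus_le_compat|].
- eapply Rle_trans; [apply Rmult_le_compat_r; [exact Pg|exact B3]|].
  apply aux; lra.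
- rewrite Rmult_comm.
  eapply Rle_trans; [apply Rmult_le_compat_r; [exact Pf|exact B4]|].
  apply aux; lra.
- eapply Rle_trans; [apply Rmult_le_compat; [apply Cmod_ge_0|apply Cmod_ge_0|exact B1|exact B2]|].
  replace ((1 + Cmod a) * Cmod (z - w) * ((1 + Cmod b) * Cmod (z - w)))
    with (K * Cmod (z - w) * Cmod (z - w)) by (unfold K; ring).
  apply Rmult_le_compat_r; [exact Pz|].
  apply Rmult_le_reg_l with (/ K); [apply Rinv_0_lt_compat; lra|].
  rewrite <- Rmult_assoc, Rinv_l; [|lra].
  unfold Rdiv in Z4 |- *; lra.
Qed.

Lemma is_Cderive_comp (f g : C -> C) (w a b : C) :
  is_Cderive f (g w) a -> is_Cderive g w b ->
  is_Cderive (fun z => f (g z)) w (a * b)%C.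
Proof.
intros Hf Hg; apply is_Cderive_eps; intros eps He.
pose proof (Cmod_ge_0 a) as Pa; pose proof (Cmod_ge_0 b) as Pb.
destruct (is_Cderive_locally_bounded g w b Hg) as [d1 [Hd1 B1]].
destruct (proj1 (is_Cderive_eps f (g w) a) Hf (eps / 2 / (1 + Cmod b))) as [d2 [Hd2 B2]].
{ apply Rdiv_lt_0_compat; lra. }
destruct (proj1 (is_Cderive_eps g w b) Hg (eps / 2 / (1 + Cmod a))) as [d3 [Hd3 B3]].
{ apply Rdiv_lt_0_compat; lra. }
assert (Hd4 : 0 < d2 / (1 + Cmod b)) by (apply Rdiv_lt_0_compat; lra).
exists (Rmin d1 (Rmin d3 (d2 / (1 + Cmod b)))); split.
{ repeat apply Rmin_glb_lt; auto. }
intros z Hz.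
assert (Z1 := Rlt_le_trans _ _ _ Hz (Rmin_l _ _)).
assert (Z2 := Rlt_le_trans _ _ _ Hz (Rmin_r _ _)).
assert (Z3 := Rlt_le_trans _ _ _ Z2 (Rmin_l _ _)).
assert (Z4 := Rlt_le_trans _ _ _ Z2 (Rmin_r _ _)).
specialize (B1 z Z1); specialize (B3 z Z3).
assert (Hgz : Cmod (g z - g w) < d2).
{ eapply Rle_lt_trans; [exact B1|].
  apply Rmult_lt_reg_l with (/ (1 + Cmod b)); [apply Rinv_0_lt_compat; lra|].
  rewrite <- Rmult_assoc, Rinv_l; [|lra]. unfold Rdiv in Z4; lra. }
specialize (B2 _ Hgz).
replace (f (g z) - f (g w) - a * b * (z - w))%C with
  ((f (g z) - f (g w) - a * (g z - g w)) + a * (g z - g w - b * (z - w)))%C by ring.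
eapply Rle_trans; [apply Cmod_triangle|].
rewrite Cmod_mult.
pose proof (Cmod_ge_0 (z - w)) as Pz.
replace (eps * Cmod (z - w)) with (eps / 2 * Cmod (z - w) + eps / 2 * Cmod (z - w)) by field.
apply Rplus_le_compat.
- eapply Rle_trans; [exact B2|].
  eapply Rle_trans; [apply Rmult_le_compat_l; [|exact B1]|].
  { apply Rlt_le, Rdiv_lt_0_compat; lra. }
  right; field; lra.
- eapply Rle_trans; [apply Rmult_le_compat_l; [exact Pa|exact B3]|].
  replace (Cmod a * (eps / 2 / (1 + Cmod a) * Cmod (z - w)))
    with (eps / 2 * Cmod (z - w) * (Cmod a / (1 + Cmod a))) by (field; lra).
  rewrite <- (Rmult_1_r (eps / 2 * Cmod (z - w))) at 2.
  apply Rmult_le_compat_l; [apply Rmult_le_pos; lra|].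
  apply Rmult_le_reg_r with (1 + Cmod a); [lra|].
  unfold Rdiv; rewrite Rmult_assoc, Rinv_l; lra.
Qed.

Lemma Cmod_minus_sym (a b : C) : Cmod (a - b) = Cmod (b - a).
Proof. replace (a - b)%C with (- (b - a))%C by ring; apply Cmod_opp. Qed.

Lemma Cmod_sub_le (a b : C) : Cmod a - Cmod b <= Cmod (a - b).
Proof.
replace a with ((a - b) + b)%C at 1 by ring.
pose proof (Cmod_triangle (a - b) b); lra.
Qed.

Lemma is_Cderive_inv (w : C) : w <> 0%C -> is_Cderive Cinv w (- / (w * w))%C.
Proof.
intros Hw; apply is_Cderive_eps; intros eps He.
assert (Pw := proj1 (Cmod_gt_0 w) Hw).
set (r := Cmod w) in *.
(* The remainder is (z - w)^2 / (z w^2). For |z - w| < r/2 its denominator exceeds (r/2) r^2, whence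
   the second bound eps r^3 / 2 on |z - w|. *)
assert (Hd : 0 < eps * (r * r * r) / 2).
{ apply Rdiv_lt_0_compat; [|lra]; repeat apply Rmult_lt_0_compat; auto. }
exists (Rmin (r / 2) (eps * (r * r * r) / 2)); split.
{ apply Rmin_glb_lt; lra. }
intros z Hz.
assert (Z1 := Rlt_le_trans _ _ _ Hz (Rmin_l _ _)).
assert (Z2 := Rlt_le_trans _ _ _ Hz (Rmin_r _ _)).
assert (Pz : r / 2 < Cmod z).
{ pose proof (Cmod_sub_le w (w - z)) as T.
  replace (w - (w - z))%C with z in T by ring.
  rewrite (Cmod_minus_sym w z) in T; fold r in T; lra. }
assert (Hz0 : z <> 0%C) by (apply Cmod_gt_0; lra).
replace (/ z - / w - - / (w * w) * (z - w))%C
  with ((z - w) * (z - w) / (z * (w * w)))%C by (field; auto).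
rewrite Cmod_div, !Cmod_mult; [|repeat apply Cmult_neq_0; auto].
fold r.
apply Rmult_le_reg_r with (Cmod z * (r * r)).
{ repeat apply Rmult_lt_0_compat; lra. }
unfold Rdiv; rewrite Rmult_assoc, Rinv_l.
2: { apply Rgt_not_eq; repeat apply Rmult_lt_0_compat; lra. }
rewrite Rmult_1_r.
rewrite (Rmult_comm eps), Rmult_assoc.
apply Rmult_le_compat_l; [apply Cmod_ge_0|].
apply Rlt_le, Rlt_le_trans with (1 := Z2).
replace (eps * (r * r * r) / 2) with (eps * (r / 2 * (r * r))) by field.
apply Rmult_le_compat_l; [lra|].
apply Rmult_le_compat_r; [apply Rlt_le, Rmult_lt_0_compat; lra|lra].
Qed.

Lemma is_Cderive_eq (f : C -> C) (w a b : C) :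
  is_Cderive f w a -> a = b -> is_Cderive f w b.
Proof. intros H <-; exact H. Qed.

(** * The complex exponential *)

Lemma cexp_plus (a b : C) : cexp (a + b) = (cexp a * cexp b)%C.
Proof.
unfold cexp; destruct a as [a1 a2], b as [b1 b2]; simpl.
rewrite exp_plus, cos_plus, sin_plus.
apply injective_projections; simpl; ring.
Qed.

Lemma cexp_0 : cexp 0 = 1%C.
Proof.
unfold cexp; simpl; rewrite exp_0, cos_0, sin_0.
apply injective_projections; simpl; ring.
Qed.

Lemma Cmod_cexp (z : C) : Cmod (cexp z) = exp (Re z).
Proof.
unfold Cmod, cexp; simpl.
replace (_ + _) with (Rsqr (exp (Re z)) * (Rsqr (sin (Im z)) + Rsqr (cos (Im z))))
  by (unfold Rsqr; ring).
rewrite sin2_cos2, Rmult_1_r.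
apply sqrt_Rsqr, Rlt_le, exp_pos.
Qed.

Lemma cexp_RtoC (x : R) : cexp x = RtoC (exp x).
Proof.
unfold cexp; simpl; rewrite cos_0, sin_0; apply injective_projections; simpl; ring.
Qed.

Lemma cexp_neq_0 (z : C) : cexp z <> 0%C.
Proof. apply Cmod_gt_0; rewrite Cmod_cexp; apply exp_pos. Qed.

Lemma cexp_opp (z : C) : cexp (- z) = (/ cexp z)%C.
Proof.
assert (H : (cexp (- z) * cexp z = 1)%C).
{ rewrite <- cexp_plus; replace (- z + z)%C with (RtoC 0) by ring; apply cexp_0. }
assert (N := cexp_neq_0 z).
replace (cexp (- z)) with (cexp (- z) * cexp z * / cexp z)%C by (field; exact N).
rewrite H; ring.
Qed.

Lemma Cmod_le_Rabs (x y : R) : Cmod (x, y) <= Rabs x + Rabs y.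
Proof.
replace (x, y) with (RtoC x + Ci * RtoC y)%C
  by (apply injective_projections; simpl; ring).
eapply Rle_trans; [apply Cmod_triangle|].
rewrite Cmod_mult, Cmod_Ci, !Cmod_R; lra.
Qed.

Lemma Rabs_Im_le_Cmod (z : C) : Rabs (Im z) <= Cmod z.
Proof.
eapply Rle_trans; [apply Rmax_r|apply Rmax_Cmod].
Qed.

Lemma is_derive_eps_0 (f : R -> R) (l eps : R) : 0 < eps -> is_derive f 0 l ->
  exists delta, 0 < delta /\
    forall x, Rabs x < delta -> Rabs (f x - f 0 - l * x) <= eps * Rabs x.
Proof.
intros He [_ H].
destruct (H 0 (fun P HP => HP) (mkposreal eps He)) as [d Hd].
exists d; split; [apply cond_pos|]; intros x Hx.
assert (B : ball 0 d x).
{ change (Rabs (x + - 0) < d); replace (x + - 0) with x by ring; exact Hx. }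
specialize (Hd x B).
change (Rabs ((f x + - f 0) + - ((x + - 0) * l)) <= eps * Rabs (x + - 0)) in Hd.
replace (f x - f 0 - l * x) with ((f x + - f 0) + - ((x + - 0) * l)) by ring.
replace (x + - 0) with x in Hd by ring.
replace (x + - 0) with x by ring; exact Hd.
Qed.

(** The addition formula reduces everything to the point 0, where the remainder splits into
    first-order remainders of the real functions exp, cos and sin. *)
Lemma is_Cderive_cexp (w : C) : is_Cderive cexp w (cexp w).
Proof.
assert (H0 : is_Cderive cexp (RtoC 0) (RtoC 1)).
{ apply is_Cderive_eps; intros eps He.
  (* Six shares: one for exp x - 1 - x, two for cos y - 1 and sin y - y, and three for the product
     of x with (cos y - 1, sin y), where |y| < eps/6 bounds the linear part of sin y. *)
  assert (He6 : 0 < eps / 6) by lra.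
  destruct (is_derive_eps_0 exp 1 (eps / 6) He6) as [d1 [Hd1 B1]].
  { replace 1 with (exp 0) by apply exp_0; apply is_derive_exp. }
  destruct (is_derive_eps_0 cos 0 (eps / 6) He6) as [d2 [Hd2 B2]].
  { replace 0 with (- sin 0) at 2 by (rewrite sin_0; ring); apply is_derive_cos. }
  destruct (is_derive_eps_0 sin 1 (eps / 6) He6) as [d3 [Hd3 B3]].
  { replace 1 with (cos 0) by apply cos_0; apply is_derive_sin. }
  exists (Rmin (Rmin d1 (eps / 6)) (Rmin (Rmin d2 d3) 1)); split.
  { repeat apply Rmin_glb_lt; lra. }
  intros z Hz.
  replace (z - 0)%C with z in * by ring.
  destruct z as [x y].
  assert (Hx : Rabs x <= Cmod (x, y)) by apply (re_le_Cmod (x, y)).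
  assert (Hy : Rabs y <= Cmod (x, y)) by apply (Rabs_Im_le_Cmod (x, y)).
  set (r := Cmod (x, y)) in *.
  assert (Z1 := Rlt_le_trans _ _ _ Hz (Rmin_l _ _)).
  assert (Z2 := Rlt_le_trans _ _ _ Hz (Rmin_r _ _)).
  assert (Z3 := Rlt_le_trans _ _ _ Z1 (Rmin_l _ _)).
  assert (Z4 := Rlt_le_trans _ _ _ Z1 (Rmin_r _ _)).
  assert (Z5 := Rlt_le_trans _ _ _ Z2 (Rmin_l _ _)).
  assert (Z6 := Rlt_le_trans _ _ _ Z2 (Rmin_r _ _)).
  assert (Z7 := Rlt_le_trans _ _ _ Z5 (Rmin_l _ _)).
  assert (Z8 := Rlt_le_trans _ _ _ Z5 (Rmin_r _ _)).
  specialize (B1 x ltac:(lra)); specialize (B2 y ltac:(lra)); specialize (B3 y ltac:(lra)).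
  rewrite exp_0, Rmult_1_l in B1; rewrite cos_0, Rmult_0_l in B2.
  rewrite sin_0, Rmult_1_l in B3.
  rewrite cexp_0.
  unfold cexp; simpl.
  replace (((exp x * cos y)%R, (exp x * sin y)%R) - 1 - 1 * (x, y))%C with
    (RtoC (exp x - 1 - x)%R * (cos y, sin y) + RtoC x * ((cos y - 1)%R, sin y)
       + ((cos y - 1)%R, (sin y - y)%R))%C by (apply injective_projections; simpl; ring).
  assert (U1 : Cmod (cos y, sin y) = 1).
  { unfold Cmod; simpl; rewrite !Rmult_1_r.
    replace (_ + _) with (Rsqr (sin y) + Rsqr (cos y)) by (unfold Rsqr; ring).
    rewrite sin2_cos2; apply sqrt_1. }
  eapply Rle_trans; [apply Cmod_triangle|].
  eapply Rle_trans; [apply Rplus_le_compat_r, Cmod_triangle|].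
  rewrite !Cmod_mult, U1, !Cmod_R, Rmult_1_r.
  pose proof (Cmod_le_Rabs (cos y - 1) (sin y)) as C1.
  pose proof (Cmod_le_Rabs (cos y - 1) (sin y - y)) as C2.
  pose proof (Rabs_pos x); pose proof (Rabs_pos y).
  pose proof (Rabs_triang (sin y - y) y) as C4.
  replace (sin y - y + y) with (sin y) in C4 by ring.
  replace (sin y - 0 - y) with (sin y - y) in B3 by ring.
  replace (cos y - 1 - 0) with (cos y - 1) in B2 by ring.
  replace (exp x - 1 - x) with (exp x - 1 - x) in B1 by ring.
  assert (K1 : Rabs x * Cmod ((cos y - 1)%R, sin y) <= r * (3 * (eps / 6))).
  { apply Rmult_le_compat; [apply Rabs_pos|apply Cmod_ge_0|lra|].
    assert (eps / 6 * Rabs y <= eps / 6 * 1) by (apply Rmult_le_compat_l; lra).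
    lra. }
  assert (eps / 6 * Rabs y <= eps / 6 * r) by (apply Rmult_le_compat_l; lra).
  assert (eps / 6 * Rabs x <= eps / 6 * r) by (apply Rmult_le_compat_l; lra).
  lra. }
assert (H1 : is_Cderive (fun z => z - w)%C w (RtoC 1)).
{ eapply is_Cderive_eq; [apply is_Cderive_minus; [apply is_Cderive_id|apply is_Cderive_const]|].
  ring. }
assert (H2 : is_Cderive (fun z => cexp (z - w)) w (RtoC 1)).
{ eapply is_Cderive_eq; [apply (is_Cderive_comp cexp (fun z => z - w)%C); [|exact H1]|].
  - replace (w - w)%C with (RtoC 0) by ring; exact H0.
  - ring. }
apply (@is_derive_ext C_AbsRing C_NormedModule (fun z => cexp w * cexp (z - w))%C).
{ intros z; rewrite <- cexp_plus; f_equal; ring. }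
eapply is_Cderive_eq; [apply is_Cderive_scal, H2|ring].
Qed.

(** * Restriction to the real line, and powers on the upper half plane *)

Lemma is_derive_Cderive_real (f : C -> C) (s : R) (l : C) :
  is_Cderive f (RtoC s) l ->
  @is_derive R_AbsRing C_R_NormedModule (fun t : R => f (RtoC t)) s l.
Proof.
intros H; split.
- apply (@is_linear_scal_l R_AbsRing C_R_NormedModule).
- intros x Hx.
  assert (x = s) as ->.
  { symmetry; apply (@is_filter_lim_locally_unique R_AbsRing R_NormedModule); exact Hx. }
  intros eps.
  destruct (proj1 (is_Cderive_eps f s l) H eps (cond_pos eps)) as [d [Hd H']].
  exists (mkposreal d Hd); intros t Ht.
  change (Rabs (t - s) < d) in Ht.
  assert (E : Cmod (RtoC t - RtoC s) = Rabs (t - s)) by (rewrite <- RtoC_minus; apply Cmod_R).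
  specialize (H' t ltac:(rewrite E; exact Ht)); rewrite E in H'.
  rewrite <- Cmod_norm.
  change (norm (minus t s)) with (Rabs (t - s)).
  eapply Rle_trans; [right|exact H'].
  f_equal; apply injective_projections; simpl; unfold minus, plus, opp, scal; simpl;
    unfold mult; simpl; ring.
Qed.

Lemma is_derive_Re_Cderive (f : C -> C) (s : R) (l : C) :
  is_Cderive f (RtoC s) l -> is_derive (fun t : R => Re (f (RtoC t))) s (Re l).
Proof.
intros H; split.
- apply is_linear_scal_l.
- intros x Hx.
  assert (x = s) as ->.
  { symmetry; apply (@is_filter_lim_locally_unique R_AbsRing R_NormedModule); exact Hx. }
  intros eps.
  destruct (proj1 (is_Cderive_eps f s l) H eps (cond_pos eps)) as [d [Hd H']].
  exists (mkposreal d Hd); intros t Ht.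
  change (Rabs (t - s) < d) in Ht.
  assert (E : Cmod (RtoC t - RtoC s) = Rabs (t - s)) by (rewrite <- RtoC_minus; apply Cmod_R).
  specialize (H' t ltac:(rewrite E; exact Ht)); rewrite E in H'.
  change (Rabs (Re (f t) - Re (f s) - (t - s) * Re l) <= eps * Rabs (t - s)).
  eapply Rle_trans; [|exact H'].
  eapply Rle_trans; [|apply re_le_Cmod].
  right; f_equal; unfold Re; simpl; ring.
Qed.

(** The real mean value theorem is applied to Re (conj d * f) with d = f b - f a, whose increment is
    exactly |d|^2; dividing by |d| gives the inequality. *)
Lemma Cderive_real_mean_value (f df : C -> C) (D a b : R) :
  a <= b ->
  (forall t : R, a <= t <= b -> is_Cderive f (RtoC t) (df t) /\ Cmod (df t) <= D) ->
  Cmod (f b - f a) <= D * (b - a).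
Proof.
intros Hab H.
set (d := (f b - f a)%C).
assert (Hder : forall t, a <= t <= b ->
  is_derive (fun t : R => Re (Cconj d * f t)%C) t (Re (Cconj d * df t)%C)).
{ intros t Ht; apply (is_derive_Re_Cderive (fun z => Cconj d * f z)%C).
  apply is_Cderive_scal, H, Ht. }
destruct (MVT_gen (fun t : R => Re (Cconj d * f t)%C) a b (fun t : R => Re (Cconj d * df t)%C))
  as [c [Hc E]].
- rewrite Rmin_left, Rmax_right by exact Hab.
  intros t Ht; apply Hder; lra.
- rewrite Rmin_left, Rmax_right by exact Hab.
  intros t Ht; apply continuity_pt_filterlim.
  apply (@ex_derive_continuous R_AbsRing R_NormedModule (fun t : R => Re (Cconj d * f t)%C)).
  eexists; apply Hder, Ht.
- rewrite Rmin_left, Rmax_right in Hc by exact Hab.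
  replace (Re (Cconj d * f b)%C - Re (Cconj d * f a)%C) with (Cmod d ^ 2) in E.
  2: { rewrite Cmod2_alt; unfold d; simpl; ring. }
  assert (B : Re (Cconj d * df c)%C <= Cmod d * D).
  { eapply Rle_trans; [apply Rle_abs|].
    eapply Rle_trans; [apply re_le_Cmod|].
    rewrite Cmod_mult, Cmod_conj.
    apply Rmult_le_compat_l; [apply Cmod_ge_0|apply H, Hc]. }
  assert (B2 : Cmod d ^ 2 <= Cmod d * (D * (b - a))).
  { rewrite E, <- Rmult_assoc; apply Rmult_le_compat_r; lra. }
  destruct (Req_dec (Cmod d) 0) as [Z|Z].
  + rewrite Z; destruct (H a ltac:(lra)) as [_ HD].
    pose proof (Cmod_ge_0 (df a)); apply Rmult_le_pos; lra.
  + pose proof (Cmod_ge_0 d).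
    apply Rmult_le_reg_l with (Cmod d); [lra|]; simpl in B2; lra.
Qed.

(** * The principal logarithm and powers on the upper half plane *)

Lemma U_neq_0 (w : C) : U w -> w <> 0%C.
Proof. intros H E; rewrite E in H; unfold U in H; simpl in H; lra. Qed.

Lemma U_Ci : U Ci.
Proof. unfold U; simpl; lra. Qed.

Lemma U_dilation (s : R) (w : C) : U w -> U (exp s * w)%C.
Proof.
unfold U; intros H; simpl.
pose proof (Rmult_lt_0_compat _ _ (exp_pos s) H); unfold Im in *; lra.
Qed.

Lemma Im_le_Cmod (w : C) : Im w <= Cmod w.
Proof. eapply Rle_trans; [apply Rle_abs|apply Rabs_Im_le_Cmod]. Qed.

Lemma U_open (w z : C) : U w -> Cmod (z - w) < Im w -> U z.
Proof.
unfold U; intros Hw Hz.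
pose proof (Rabs_Im_le_Cmod (z - w)) as H.
pose proof (Rabs_def2 _ _ (Rle_lt_trans _ _ _ H Hz)) as [_ H2].
simpl in H2; unfold Im in *; lra.
Qed.

Lemma is_Cderive_ext_U (f g : C -> C) (w l : C) :
  U w -> eqU f g -> is_Cderive f w l -> is_Cderive g w l.
Proof.
intros Hw E; apply (@is_derive_ext_loc C_AbsRing C_NormedModule).
exists (mkposreal (Im w) Hw); intros z Hz; apply E, (U_open w); [exact Hw|exact Hz].
Qed.

(** The strict bounds on Re z / |z| keep the argument of acos inside the open interval where acos is
    differentiable. *)
Lemma cos_sin_acos_U (z : C) : U z ->
  Re z = Cmod z * cos (acos (Re z / Cmod z)) /\
  Im z = Cmod z * sin (acos (Re z / Cmod z)) /\ -1 < Re z / Cmod z < 1.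
Proof.
intros Hz.
assert (P := proj1 (Cmod_gt_0 z) (U_neq_0 z Hz)).
assert (S : Cmod z ^ 2 = Re z ^ 2 + Im z ^ 2) by apply Cmod2_alt.
unfold U in Hz.
assert (B : -1 < Re z / Cmod z < 1).
{ assert (-1 * Cmod z < Re z < 1 * Cmod z) by (split; nra).
  split; apply Rmult_lt_reg_r with (Cmod z); auto;
  unfold Rdiv; rewrite Rmult_assoc, Rinv_l; lra. }
split; [|split; [|exact B]].
- rewrite cos_acos by lra; field; lra.
- rewrite sin_acos by lra.
  replace (1 - (Re z / Cmod z)²) with ((Im z / Cmod z)²).
  2: { unfold Rsqr; apply Rmult_eq_reg_r with (Cmod z ^ 2); [|nra].
       field_simplify; [|lra|lra]. nra. }
  rewrite sqrt_Rsqr; [field; lra|].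
  apply Rlt_le, Rdiv_lt_0_compat; assumption.
Qed.

Lemma cexp_clog_U (z : C) : U z -> cexp (clog_U z) = z.
Proof.
intros Hz; destruct (cos_sin_acos_U z Hz) as [E1 [E2 _]].
unfold cexp, clog_U; simpl.
rewrite exp_ln by (apply Cmod_gt_0, U_neq_0, Hz).
destruct z as [x y]; simpl in *; rewrite <- E1, <- E2; reflexivity.
Qed.

Lemma Cmod_dilation (s : R) (w : C) : Cmod (exp s * w) = exp s * Cmod w.
Proof.
rewrite Cmod_mult, Cmod_R, Rabs_pos_eq by apply Rlt_le, exp_pos; reflexivity.
Qed.

Lemma clog_U_dilation (s : R) (w : C) : U w -> clog_U (exp s * w) = (s + clog_U w)%C.
Proof.
intros Hw; assert (P := proj1 (Cmod_gt_0 w) (U_neq_0 w Hw)).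
unfold clog_U; rewrite Cmod_dilation.
rewrite ln_mult, ln_exp by (auto; apply exp_pos).
pose proof (exp_pos s).
replace (Re (exp s * w) / (exp s * Cmod w)) with (Re w / Cmod w).
- apply injective_projections; simpl; ring.
- simpl; unfold Re; field; lra.
Qed.

Lemma continuous_Cmod (w : C) : continuous Cmod w.
Proof.
intros P [eps HP].
assert (He : 0 < eps / 2) by (pose proof (cond_pos eps); lra).
exists (mkposreal _ He); intros z [Z1 Z2]; apply HP.
change (Rabs (fst z - fst w) < eps / 2) in Z1.
change (Rabs (snd z - snd w) < eps / 2) in Z2.
change (Rabs (Cmod z - Cmod w) < eps).
pose proof (Cmod_le_Rabs (fst z - fst w) (snd z - snd w)) as B.
change (fst z - fst w, snd z - snd w) with (z - w)%C in B.
pose proof (Cmod_sub_le z w) as B1; pose proof (Cmod_sub_le w z) as B2.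
rewrite (Cmod_minus_sym w z) in B2.
apply Rabs_def1; lra.
Qed.

Lemma continuous_clog_U (w : C) : U w ->
  @continuous C_UniformSpace C_UniformSpace clog_U w.
Proof.
intros Hw.
destruct (cos_sin_acos_U w Hw) as [_ [_ B]].
assert (P := proj1 (Cmod_gt_0 w) (U_neq_0 w Hw)).
unfold clog_U.
assert (C1 : continuous (fun z : C => ln (Cmod z)) w).
{ apply (continuous_comp Cmod ln); [apply continuous_Cmod|].
  apply continuity_pt_filterlim, derivable_continuous_pt.
  exists (/ Cmod w); apply derivable_pt_lim_ln, P. }
assert (C2 : continuous (fun z : C => acos (Re z / Cmod z)) w).
{ apply (continuous_comp (fun z : C => Re z / Cmod z) acos).
  - apply (continuous_mult (fun z : C => Re z) (fun z : C => / Cmod z)).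
    + apply continuous_fst.
    + apply (continuous_comp Cmod Rinv); [apply continuous_Cmod|].
      apply continuous_Rinv; lra.
  - apply continuity_pt_filterlim, derivable_continuous_pt, derivable_pt_acos, B. }
apply (filterlim_filter_le_2 _ (G := filter_prod (locally (ln (Cmod w))) (locally (acos (Re w / Cmod w))))).
2: apply filterlim_pair; assumption.
intros Q [d Hd].
exists (ball (ln (Cmod w)) d) (ball (acos (Re w / Cmod w)) d); try apply locally_ball.
intros x y Hx Hy; apply Hd; split; assumption.
Qed.

(** Inverse function argument: [clog_U] is a continuous right inverse of [cexp], whose derivative at
    [clog_U w] is w. With u the increment of the logarithm, z - w = w u + o(u) is solved for u. *)
Lemma is_Cderive_clog_U (w : C) : U w -> is_Cderive clog_U w (/ w)%C.
Proof.
intros Hw; apply is_Cderive_eps; intros eps He.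
assert (Hw0 := U_neq_0 w Hw).
assert (P := proj1 (Cmod_gt_0 w) Hw0).
set (r := Cmod w) in *.
(* The entry r/2 gives r |u| <= 2 |z - w| for the increment u of the logarithm; the other one then
   makes e |u| r at most eps r^2 |z - w|. *)
set (e := Rmin (r / 2) (eps * (r * r) / 2)).
assert (He' : 0 < e).
{ apply Rmin_glb_lt; [lra|]; apply Rdiv_lt_0_compat; [|lra].
  repeat apply Rmult_lt_0_compat; auto. }
destruct (proj1 (is_Cderive_eps cexp _ _) (is_Cderive_cexp (clog_U w)) e He') as [d1 [Hd1 B1]].
assert (Hd2 : 0 < d1 / 2) by lra.
destruct (continuous_clog_U w Hw _ (locally_ball _ (mkposreal _ Hd2))) as [d3 B3].
exists (Rmin (Im w) d3); split; [apply Rmin_glb_lt; [exact Hw|apply cond_pos]|].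
intros z Hz.
assert (Uz : U z) by (apply (U_open w); [exact Hw|apply Rlt_le_trans with (1 := Hz), Rmin_l]).
assert (N : Cmod (clog_U z - clog_U w) < d1).
{ specialize (B3 z (C_NormedModule_mixin_compat1 w z d3 (Rlt_le_trans _ _ _ Hz (Rmin_r _ _)))).
  destruct B3 as [X Y].
  change (Rabs (fst (clog_U z) - fst (clog_U w)) < d1 / 2) in X.
  change (Rabs (snd (clog_U z) - snd (clog_U w)) < d1 / 2) in Y.
  eapply Rle_lt_trans; [apply Cmod_le_Rabs|].
  unfold Rminus in X, Y; simpl in X, Y |- *; lra. }
specialize (B1 _ N).
rewrite !cexp_clog_U in B1 by assumption.
set (u := (clog_U z - clog_U w)%C) in *.
pose proof (Cmod_ge_0 u) as Pu; pose proof (Cmod_ge_0 (z - w)) as Pz.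
assert (B4 : r * Cmod u <= 2 * Cmod (z - w)).
{ pose proof (Cmod_sub_le (w * u) (z - w)) as T.
  rewrite (Cmod_minus_sym (w * u)), Cmod_mult in T; fold r in T.
  assert (e * Cmod u <= r / 2 * Cmod u) by (apply Rmult_le_compat_r; [exact Pu|apply Rmin_l]).
  lra. }
replace (u - / w * (z - w))%C with (- (z - w - w * u) / w)%C by (field; exact Hw0).
rewrite Cmod_div, Cmod_opp by exact Hw0; fold r.
apply Rmult_le_reg_r with (r * r); [apply Rmult_lt_0_compat; exact P|].
replace (Cmod (z - w - w * u) / r * (r * r)) with (Cmod (z - w - w * u) * r) by (field; lra).
apply Rle_trans with (e * Cmod u * r); [apply Rmult_le_compat_r; lra|].
apply Rle_trans with (e * (2 * Cmod (z - w))).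
{ rewrite Rmult_assoc, (Rmult_comm (Cmod u)); apply Rmult_le_compat_l; lra. }
apply Rle_trans with (eps * (r * r) / 2 * (2 * Cmod (z - w))).
- apply Rmult_le_compat_r; [lra|apply Rmin_r].
- right; field.
Qed.

Lemma is_Cderive_cpow (lam w : C) : U w ->
  is_Cderive (fun z => cpow z lam) w (lam * cpow w lam / w)%C.
Proof.
intros Hw; unfold cpow.
eapply is_Cderive_eq.
- apply (is_Cderive_comp cexp (fun z => lam * clog_U z)%C).
  + apply is_Cderive_cexp.
  + apply is_Cderive_scal, is_Cderive_clog_U, Hw.
- unfold Cdiv; ring.
Qed.

Lemma cpow_plus (z a b : C) : cpow z (a + b) = (cpow z a * cpow z b)%C.
Proof. unfold cpow; rewrite <- cexp_plus; f_equal; ring. Qed.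

Lemma cpow_1 (z : C) : U z -> cpow z 1 = z.
Proof.
intros Hz; unfold cpow; rewrite Cmult_1_l; apply cexp_clog_U, Hz.
Qed.

Lemma cpow_dilation (s : R) (w lam : C) : U w ->
  cpow (exp s * w) lam = (cexp (lam * s) * cpow w lam)%C.
Proof.
intros Hw; unfold cpow; rewrite clog_U_dilation, <- cexp_plus by exact Hw.
f_equal; ring.
Qed.

Lemma cpow_neq_0 (z a : C) : cpow z a <> 0%C.
Proof. apply cexp_neq_0. Qed.

(** * The Bloch seminorm *)

(** A pointwise real form of a bound on [bloch_norm], which keeps extended reals out of the
    estimates. *)
Definition bloch_le (f : C -> C) (M : R) : Prop :=
  forall w : C, U w -> Im w * Cmod (C_derive f w) <= M.

Lemma bloch_norm_le (f : C -> C) (M : R) :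
  Rbar_le (bloch_norm f) M <-> bloch_le f M.
Proof.
destruct (Lub_Rbar_correct (fun x : R => exists w : C, U w /\ x = Im w * Cmod (C_derive f w)))
  as [H1 H2].
split.
- intros H w Hw.
  apply (Rbar_le_trans _ _ _ (H1 _ (ex_intro _ w (conj Hw eq_refl))) H).
- intros H; apply H2; intros x [w [Hw ->]]; apply H, Hw.
Qed.

Lemma bloch_le_weaken (f : C -> C) (M N : R) : bloch_le f M -> M <= N -> bloch_le f N.
Proof. intros H HMN w Hw; specialize (H w Hw); lra. Qed.

Lemma bloch_le_pos (f : C -> C) (M : R) : bloch_le f M -> 0 <= M.
Proof.
intros H; apply Rle_trans with (2 := H Ci U_Ci).
apply Rmult_le_pos; [simpl; lra|apply Cmod_ge_0].
Qed.

Lemma bloch_norm_lt (f : C -> C) (M N : R) : bloch_le f M -> M < N -> Rbar_lt (bloch_norm f) N.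
Proof.
intros H HMN; apply Rbar_le_lt_trans with (Finite M); [apply bloch_norm_le, H|exact HMN].
Qed.

Lemma bloch_norm_finite (f : C -> C) (M : R) :
  bloch_le f M -> exists x : R, bloch_norm f = Finite x.
Proof.
intros H.
assert (H1 := proj2 (bloch_norm_le f M) H).
destruct (bloch_norm f) as [x| |] eqn:E.
- exists x; reflexivity.
- destruct H1.
- assert (H2 : Rbar_le (bloch_norm f) (Finite (-1))) by (rewrite E; exact I).
  apply bloch_norm_le, bloch_le_pos in H2; lra.
Qed.

Lemma C_derive_U (f : C -> C) (w : C) : holomorphic_U f -> U w -> is_Cderive f w (C_derive f w).
Proof. intros H Hw; apply C_derive_correct; [exact w|apply H, Hw]. Qed.

Lemma holomorphic_U_intro (f df : C -> C) :
  (forall w, U w -> is_Cderive f w (df w)) -> holomorphic_U f.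
Proof. intros H w Hw; exists (df w); apply H, Hw. Qed.

Lemma C_derive_eqU (f g : C -> C) (w : C) :
  holomorphic_U f -> eqU f g -> U w -> C_derive g w = C_derive f w.
Proof.
intros Hf E Hw; apply is_C_derive_unique.
apply (is_Cderive_ext_U f g w _ Hw E), C_derive_U; assumption.
Qed.

Lemma is_Cderive_segment (f : C -> C) (a b : C) (t : C) (l : C) :
  is_Cderive f (a + t * (b - a))%C l ->
  is_Cderive (fun z => f (a + z * (b - a))%C) t (l * (b - a))%C.
Proof.
intros H; apply (is_Cderive_comp f (fun z => a + z * (b - a))%C); [exact H|].
eapply is_Cderive_eq.
- apply is_Cderive_plus; [apply is_Cderive_const|].
  apply (is_Cderive_mult (fun z => z) (fun _ => b - a)%C);
    [apply is_Cderive_id|apply is_Cderive_const].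
- ring.
Qed.

(** A Bloch bound controls the derivative by N/m only at height at least m; the segment from a to b
    stays there by convexity. *)
Lemma bloch_mean_value (q : C -> C) (N m : R) (a b : C) :
  holomorphic_U q -> bloch_le q N -> 0 < m -> m <= Im a -> m <= Im b ->
  Cmod (q b - q a) <= N / m * Cmod (b - a).
Proof.
intros Hq HN Hm Ha Hb.
pose proof (bloch_le_pos q N HN) as N0.
pose proof (Cderive_real_mean_value (fun z => q (a + z * (b - a))%C)
  (fun z => C_derive q (a + z * (b - a)) * (b - a))%C (N / m * Cmod (b - a)) 0 1 ltac:(lra)) as H.
simpl in H.
replace (a + 1 * (b - a))%C with b in H by ring.
replace (a + 0 * (b - a))%C with a in H by ring.
rewrite Rminus_0_r, Rmult_1_r in H; apply H.
intros t Ht.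
assert (HI : m <= Im (a + t * (b - a))%C).
{ replace (Im (a + t * (b - a))%C) with ((1 - t) * Im a + t * Im b)
    by (unfold Im; simpl; ring).
  nra. }
assert (HU : U (a + t * (b - a))%C) by (unfold U; lra).
split.
- apply is_Cderive_segment, C_derive_U; assumption.
- rewrite Cmod_mult; apply Rmult_le_compat_r; [apply Cmod_ge_0|].
  specialize (HN _ HU).
  apply Rmult_le_reg_l with m; [exact Hm|].
  replace (m * (N / m)) with N by (field; lra).
  eapply Rle_trans; [|exact HN].
  apply Rmult_le_compat_r; [apply Cmod_ge_0|exact HI].
Qed.

(** This is how an equality in the seminorm becomes an equality of functions, the constant being
    fixed by the value at i. *)
Lemma bloch_le_0_constant (q : C -> C) :
  holomorphic_U q -> bloch_le q 0 -> forall a b, U a -> U b -> q a = q b.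
Proof.
intros Hq H a b Ha Hb.
assert (Hm : 0 < Rmin (Im a) (Im b)) by (apply Rmin_glb_lt; assumption).
pose proof (bloch_mean_value q 0 _ a b Hq H Hm (Rmin_l _ _) (Rmin_r _ _)) as B.
unfold Rdiv in B; rewrite !Rmult_0_l in B.
pose proof (Cmod_ge_0 (q b - q a)).
assert (E : Cmod (q b - q a) = 0) by lra.
apply Cmod_eq_0 in E.
replace (q a) with (q b - (q b - q a))%C by ring; rewrite E; ring.
Qed.

(** The properties shared by [im_to_zero] and [to_boundary] on which the general theory rests.
    Monotonicity compares predicates on U alone, since both readings quantify over points of U. *)
Record boundary_filter (F : (C -> Prop) -> Prop) : Prop := {
  boundary_filter_mono : forall P Q : C -> Prop,
    (forall w, U w -> P w -> Q w) -> F P -> F Q;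
  boundary_filter_and : forall P Q : C -> Prop, F P -> F Q -> F (fun w => P w /\ Q w)
}.

Lemma im_to_zero_boundary_filter : boundary_filter im_to_zero.
Proof.
split.
- intros P Q H [d Hd]; exists d; intros w Hw H1; apply H, Hd; assumption.
- intros P Q [d Hd] [e He].
  exists (mkposreal _ (Rmin_glb_lt _ _ _ (cond_pos d) (cond_pos e))); simpl.
  intros w Hw H1; split; [apply Hd|apply He]; auto;
    eapply Rlt_le_trans; [exact H1|apply Rmin_l|exact H1|apply Rmin_r].
Qed.

Lemma to_boundary_boundary_filter : boundary_filter to_boundary.
Proof.
split.
- intros P Q H [d Hd]; exists d; intros w Hw H1; apply H, Hd; assumption.
- intros P Q [d Hd] [e He].
  pose proof (cond_pos d); pose proof (cond_pos e).
  assert (Hm : 0 < Rmin d e) by (apply Rmin_glb_lt; assumption).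
  exists (mkposreal _ Hm); simpl.
  assert (I1 : / d <= / Rmin d e) by (apply Rinv_le_contravar; [exact Hm|apply Rmin_l]).
  assert (I2 : / e <= / Rmin d e) by (apply Rinv_le_contravar; [exact Hm|apply Rmin_r]).
  pose proof (Rmin_l d e); pose proof (Rmin_r d e).
  intros w Hw Hc; split; [apply Hd|apply He]; auto; destruct Hc; [left|right|left|right]; lra.
Qed.

(** Membership becomes a set of inequalities on the derivative; the limit 0 is a mere upper bound
    because Im w |f'(w)| is nonnegative. *)
Lemma little_bloch_i_iff (F : (C -> Prop) -> Prop) (HF : boundary_filter F) (f : C -> C) :
  little_bloch_i F f <->
  holomorphic_U f /\ (exists M : R, bloch_le f M) /\
  (forall eps : R, 0 < eps -> F (fun w => Im w * Cmod (C_derive f w) <= eps)) /\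
  f Ci = 0%C.
Proof.
split.
- intros [[[Hf Hb] Hl] H0]; split; [exact Hf|split; [|split; [|exact H0]]].
  + destruct (bloch_norm f) as [x| |] eqn:E.
    * exists x; apply bloch_norm_le; rewrite E; apply Rle_refl.
    * destruct Hb.
    * exists 0; apply bloch_norm_le; rewrite E; exact I.
  + intros eps He.
    specialize (Hl (fun x => x <= eps)).
    apply (boundary_filter_mono F HF) with (P := fun w => Im w * Cmod (C_derive f w) <= eps);
      [auto|apply Hl].
    exists (mkposreal eps He); intros x Hx.
    change (Rabs (x - 0) < eps) in Hx; apply Rabs_def2 in Hx; lra.
- intros [Hf [[M HM] [Hl H0]]]; split; [split; [split; [exact Hf|]|]|exact H0].
  + apply (bloch_norm_lt f M (M + 1)) in HM; [|lra].
    destruct (bloch_norm f); simpl in *; auto.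
  + intros P [e He].
    assert (He2 : 0 < e / 2) by (pose proof (cond_pos e); lra).
    apply (boundary_filter_mono F HF) with (2 := Hl _ He2).
    intros w Hw B; apply He.
    change (Rabs (Im w * Cmod (C_derive f w) - 0) < e).
    pose proof (Cmod_ge_0 (C_derive f w)).
    rewrite Rminus_0_r, Rabs_pos_eq; [lra|].
    apply Rmult_le_pos; [apply Rlt_le, Hw|assumption].
Qed.

Lemma little_bloch_i_holomorphic (F : (C -> Prop) -> Prop) (f : C -> C) :
  little_bloch_i F f -> holomorphic_U f.
Proof. intros [[[H _] _] _]; exact H. Qed.

Lemma little_bloch_i_bounded (F : (C -> Prop) -> Prop) (HF : boundary_filter F) (f : C -> C) :
  little_bloch_i F f -> exists M, bloch_le f M.
Proof. intros H; apply little_bloch_i_iff in H; tauto. Qed.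

Lemma little_bloch_i_ext (F : (C -> Prop) -> Prop) (HF : boundary_filter F) (f g : C -> C) :
  eqU f g -> little_bloch_i F f -> little_bloch_i F g.
Proof.
intros E H; apply little_bloch_i_iff in H; [|exact HF].
destruct H as [Hf [[M HM] [Hl H0]]].
apply little_bloch_i_iff; [exact HF|].
split; [|split; [|split]].
- apply (holomorphic_U_intro g (C_derive f)); intros w Hw.
  apply (is_Cderive_ext_U f g w _ Hw E), C_derive_U; assumption.
- exists M; intros w Hw; rewrite (C_derive_eqU f g) by assumption; apply HM, Hw.
- intros eps He; apply (boundary_filter_mono F HF) with (2 := Hl eps He).
  intros w Hw; rewrite (C_derive_eqU f g) by assumption; auto.
- rewrite <- E by apply U_Ci; exact H0.
Qed.

Lemma is_Cderive_lin (a b : C) (f g : C -> C) (w : C) :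
  holomorphic_U f -> holomorphic_U g -> U w ->
  is_Cderive (fun z => a * f z + b * g z)%C w (a * C_derive f w + b * C_derive g w)%C.
Proof.
intros Hf Hg Hw; apply is_Cderive_plus; apply is_Cderive_scal, C_derive_U; assumption.
Qed.

Lemma C_derive_lin (a b : C) (f g : C -> C) (w : C) :
  holomorphic_U f -> holomorphic_U g -> U w ->
  C_derive (fun z => a * f z + b * g z)%C w = (a * C_derive f w + b * C_derive g w)%C.
Proof. intros Hf Hg Hw; apply is_C_derive_unique, is_Cderive_lin; assumption. Qed.

Lemma bloch_le_lin (a b : C) (f g : C -> C) (M N : R) :
  holomorphic_U f -> holomorphic_U g -> bloch_le f M -> bloch_le g N ->
  bloch_le (fun z => a * f z + b * g z)%C (Cmod a * M + Cmod b * N).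
Proof.
intros Hf Hg HM HN w Hw.
rewrite C_derive_lin by assumption.
specialize (HM w Hw); specialize (HN w Hw).
pose proof (Cmod_ge_0 a); pose proof (Cmod_ge_0 b).
eapply Rle_trans; [apply Rmult_le_compat_l; [apply Rlt_le, Hw|apply Cmod_triangle]|].
rewrite !Cmod_mult.
apply (Rmult_le_compat_l _ _ _ H) in HM; apply (Rmult_le_compat_l _ _ _ H0) in HN; lra.
Qed.

Lemma little_bloch_i_lin (F : (C -> Prop) -> Prop) (HF : boundary_filter F)
  (a b : C) (f g : C -> C) :
  little_bloch_i F f -> little_bloch_i F g ->
  little_bloch_i F (fun z => a * f z + b * g z)%C.
Proof.
intros Hf Hg; apply little_bloch_i_iff in Hf; [|exact HF].
apply little_bloch_i_iff in Hg; [|exact HF].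
destruct Hf as [Hf [[M HM] [Lf F0]]]; destruct Hg as [Hg [[N HN] [Lg G0]]].
apply little_bloch_i_iff; [exact HF|].
split; [|split; [|split]].
- eapply holomorphic_U_intro; intros w Hw; apply is_Cderive_lin; assumption.
- eexists; apply bloch_le_lin; eassumption.
- intros eps He.
  pose proof (Cmod_ge_0 a) as Pa; pose proof (Cmod_ge_0 b) as Pb.
  assert (E1 : 0 < eps / (1 + Cmod a + Cmod b)) by (apply Rdiv_lt_0_compat; lra).
  apply (boundary_filter_mono F HF) with (2 := boundary_filter_and F HF _ _ (Lf _ E1) (Lg _ E1)).
  intros w Hw [H1 H2].
  rewrite C_derive_lin by assumption.
  eapply Rle_trans; [apply Rmult_le_compat_l; [apply Rlt_le, Hw|apply Cmod_triangle]|].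
  rewrite !Cmod_mult.
  apply (Rmult_le_compat_l _ _ _ Pa) in H1; apply (Rmult_le_compat_l _ _ _ Pb) in H2.
  apply Rle_trans with ((Cmod a + Cmod b) * (eps / (1 + Cmod a + Cmod b))); [lra|].
  apply Rle_trans with ((1 + Cmod a + Cmod b) * (eps / (1 + Cmod a + Cmod b)));
    [apply Rmult_le_compat_r; lra|].
  right; field; lra.
- rewrite F0, G0; ring.
Qed.

(** * The generator *)

Lemma is_Cderive_dilation (t : R) (g : C -> C) (w : C) :
  holomorphic_U g -> U w ->
  is_Cderive (dilation t g) w (exp t * C_derive g (exp t * w))%C.
Proof.
intros Hg Hw; unfold dilation.
eapply is_Cderive_eq; [apply (is_Cderive_comp g (fun z => exp t * z)%C)|].
- apply C_derive_U; [exact Hg|apply U_dilation, Hw].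
- apply is_Cderive_scal, is_Cderive_id.
- ring.
Qed.

Lemma Im_dilation (t : R) (w : C) : Im (exp t * w)%C = exp t * Im w.
Proof. unfold Im; simpl; ring. Qed.

Lemma bloch_dilation_bound (g : C -> C) (M t : R) (w : C) :
  bloch_le g M -> U w -> Im w * Cmod (exp t * C_derive g (exp t * w)) <= M.
Proof.
intros H Hw; specialize (H _ (U_dilation t w Hw)).
rewrite Im_dilation in H; rewrite Cmod_dilation; lra.
Qed.

Lemma is_Cderive_quotient (t : R) (g k : C -> C) (w : C) :
  holomorphic_U g -> holomorphic_U k -> U w ->
  is_Cderive (fun w => (dilation t g w - g w) / t - k w)%C w
    ((exp t * C_derive g (exp t * w) - C_derive g w) / t - C_derive k w)%C.
Proof.
intros Hg Hk Hw.
apply is_Cderive_minus; [|apply C_derive_U; assumption].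
unfold Cdiv.
eapply is_Cderive_eq.
- apply (is_Cderive_mult (fun w => dilation t g w - g w)%C (fun _ => / t)%C);
    [|apply is_Cderive_const].
  apply is_Cderive_minus; [apply is_Cderive_dilation|apply C_derive_U]; assumption.
- ring.
Qed.

Lemma C_derive_quotient (t : R) (g k : C -> C) (w : C) :
  holomorphic_U g -> holomorphic_U k -> U w ->
  C_derive (fun w => (dilation t g w - g w) / t - k w)%C w =
    ((exp t * C_derive g (exp t * w) - C_derive g w) / t - C_derive k w)%C.
Proof. intros; apply is_C_derive_unique, is_Cderive_quotient; assumption. Qed.

(** Differentiation kills the additive constant by which a difference quotient misses the normalized
    space. *)
Lemma generator_iff (F : (C -> Prop) -> Prop) (g k : C -> C) :
  generator F g k <->
  little_bloch_i F g /\ little_bloch_i F k /\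
  forall eps : R, 0 < eps -> exists delta : R, 0 < delta /\
    forall t, 0 < t < delta -> forall w, U w ->
      Im w * Cmod ((exp t * C_derive g (exp t * w) - C_derive g w) / t - C_derive k w) <= eps.
Proof.
split; intros [Hg [Hk H]]; split; auto; split; auto;
  pose proof (little_bloch_i_holomorphic F g Hg) as Og;
  pose proof (little_bloch_i_holomorphic F k Hk) as Ok.
- intros eps He; destruct (H (mkposreal eps He)) as [d Hd].
  exists d; split; [apply cond_pos|].
  intros t Ht w Hw.
  assert (B : ball 0 d t).
  { change (Rabs (t - 0) < d); rewrite Rminus_0_r, Rabs_pos_eq; lra. }
  specialize (Hd t B (proj1 Ht)).
  apply Rbar_lt_le in Hd.
  apply bloch_norm_le in Hd; specialize (Hd w Hw).
  rewrite C_derive_quotient in Hd by assumption; exact Hd.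
- intros eps.
  assert (He : 0 < eps / 2) by (pose proof (cond_pos eps); lra).
  destruct (H _ He) as [d [Hd H1]].
  exists (mkposreal d Hd); intros t Ht Ht0.
  change (Rabs (t - 0) < d) in Ht; rewrite Rminus_0_r, Rabs_pos_eq in Ht by lra.
  apply bloch_norm_lt with (eps / 2); [|lra].
  intros w Hw; rewrite C_derive_quotient by assumption.
  apply H1; [lra|exact Hw].
Qed.

Lemma generator_ext (F : (C -> Prop) -> Prop) (HF : boundary_filter F) (g k g' k' : C -> C) :
  eqU g g' -> eqU k k' -> generator F g k -> generator F g' k'.
Proof.
intros Eg Ek H; apply generator_iff in H; destruct H as [Hg [Hk H]].
pose proof (little_bloch_i_holomorphic F g Hg) as Og.
pose proof (little_bloch_i_holomorphic F k Hk) as Ok.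
apply generator_iff; split; [apply (little_bloch_i_ext F HF g); assumption|].
split; [apply (little_bloch_i_ext F HF k); assumption|].
intros eps He; destruct (H eps He) as [d [Hd H1]]; exists d; split; [exact Hd|].
intros t Ht w Hw.
rewrite !(C_derive_eqU g g'), (C_derive_eqU k k') by (auto; apply U_dilation, Hw).
apply H1; assumption.
Qed.

Lemma generator_lin (F : (C -> Prop) -> Prop) (HF : boundary_filter F)
  (a b : C) (g1 k1 g2 k2 : C -> C) :
  generator F g1 k1 -> generator F g2 k2 ->
  generator F (fun w => a * g1 w + b * g2 w)%C (fun w => a * k1 w + b * k2 w)%C.
Proof.
intros H1 H2; apply generator_iff in H1; apply generator_iff in H2.
destruct H1 as [G1 [K1 H1]]; destruct H2 as [G2 [K2 H2]].
pose proof (little_bloch_i_holomorphic F _ G1) as O1.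
pose proof (little_bloch_i_holomorphic F _ K1) as O2.
pose proof (little_bloch_i_holomorphic F _ G2) as O3.
pose proof (little_bloch_i_holomorphic F _ K2) as O4.
apply generator_iff; split; [apply little_bloch_i_lin; assumption|].
split; [apply little_bloch_i_lin; assumption|].
intros eps He.
pose proof (Cmod_ge_0 a) as Pa; pose proof (Cmod_ge_0 b) as Pb.
assert (E1 : 0 < eps / (1 + Cmod a + Cmod b)) by (apply Rdiv_lt_0_compat; lra).
destruct (H1 _ E1) as [d1 [D1 B1]]; destruct (H2 _ E1) as [d2 [D2 B2]].
exists (Rmin d1 d2); split; [apply Rmin_glb_lt; assumption|].
intros t Ht w Hw.
assert (T1 := Rlt_le_trans _ _ _ (proj2 Ht) (Rmin_l _ _)).
assert (T2 := Rlt_le_trans _ _ _ (proj2 Ht) (Rmin_r _ _)).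
specialize (B1 t (conj (proj1 Ht) T1) w Hw); specialize (B2 t (conj (proj1 Ht) T2) w Hw).
rewrite !C_derive_lin by (auto; apply U_dilation, Hw).
set (q1 := ((exp t * C_derive g1 (exp t * w) - C_derive g1 w) / t - C_derive k1 w)%C) in *.
set (q2 := ((exp t * C_derive g2 (exp t * w) - C_derive g2 w) / t - C_derive k2 w)%C) in *.
replace (_ - _)%C with (a * q1 + b * q2)%C by (unfold q1, q2, Cdiv; ring).
eapply Rle_trans; [apply Rmult_le_compat_l; [apply Rlt_le, Hw|apply Cmod_triangle]|].
rewrite !Cmod_mult.
apply (Rmult_le_compat_l _ _ _ Pa) in B1; apply (Rmult_le_compat_l _ _ _ Pb) in B2.
apply Rle_trans with ((1 + Cmod a + Cmod b) * (eps / (1 + Cmod a + Cmod b))).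
- lra.
- right; field; lra.
Qed.

Lemma RtoC_neq_0 (t : R) : t <> 0 -> RtoC t <> 0%C.
Proof. intros H E; apply H, RtoC_inj, E. Qed.

Lemma Im_Cmod_triangle (y : R) (a b : C) (A B : R) :
  0 <= y -> y * Cmod a <= A -> y * Cmod b <= B -> y * Cmod (a + b) <= A + B.
Proof.
intros Hy HA HB; pose proof (Cmod_triangle a b) as T.
apply (Rmult_le_compat_l _ _ _ Hy) in T; lra.
Qed.

Definition strongly_continuous (g : C -> C) : Prop :=
  forall eps : R, 0 < eps -> exists delta : R, 0 < delta /\
    forall t, 0 < t < delta -> forall w, U w ->
      Im w * Cmod (exp t * C_derive g (exp t * w) - C_derive g w) <= eps.

(** S_t g - g = t (q + k) with q the error of the difference quotient; once q has seminorm at most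
    1, the right side is O(t). *)
Lemma generator_domain_continuous (F : (C -> Prop) -> Prop) (HF : boundary_filter F)
  (g k : C -> C) : generator F g k -> strongly_continuous g.
Proof.
intros H; apply generator_iff in H; destruct H as [Hg [Hk H]].
destruct (little_bloch_i_bounded F HF k Hk) as [M HM].
pose proof (bloch_le_pos k M HM) as HM0.
destruct (H 1 Rlt_0_1) as [d [Hd H1]].
intros eps He.
assert (He' : 0 < eps / (1 + M)) by (apply Rdiv_lt_0_compat; lra).
exists (Rmin d (eps / (1 + M))); split; [apply Rmin_glb_lt; assumption|].
intros t Ht w Hw.
assert (T1 := Rlt_le_trans _ _ _ (proj2 Ht) (Rmin_l _ _)).
assert (T2 := Rlt_le_trans _ _ _ (proj2 Ht) (Rmin_r _ _)).
specialize (H1 t (conj (proj1 Ht) T1) w Hw); specialize (HM w Hw).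
set (q := ((exp t * C_derive g (exp t * w) - C_derive g w) / t - C_derive k w)%C) in *.
replace (exp t * C_derive g (exp t * w) - C_derive g w)%C
  with (t * (q + C_derive k w))%C.
2: { unfold q; field; apply RtoC_neq_0; lra. }
rewrite Cmod_mult, Cmod_R, Rabs_pos_eq by lra.
pose proof (Im_Cmod_triangle (Im w) q (C_derive k w) 1 M (Rlt_le _ _ Hw) H1 HM) as B.
replace (Im w * (t * Cmod (q + C_derive k w))) with (t * (Im w * Cmod (q + C_derive k w))) by ring.
apply Rle_trans with (t * (1 + M)); [apply Rmult_le_compat_l; lra|].
apply Rle_trans with (eps / (1 + M) * (1 + M)); [apply Rmult_le_compat_r; lra|].
right; field; lra.
Qed.

(** For a fixed small s, k is uniformly close to (S_s g - g)/s, which is strongly continuous because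
    g is and S_s is an isometry; the vectors of strong continuity are closed under seminorm
    limits. *)
Lemma generator_range_continuous (F : (C -> Prop) -> Prop) (HF : boundary_filter F)
  (g k : C -> C) : generator F g k -> strongly_continuous k.
Proof.
intros H; pose proof (generator_domain_continuous F HF g k H) as Hc.
apply generator_iff in H; destruct H as [Hg [Hk H]].
intros eps He.
destruct (H (eps / 4) ltac:(lra)) as [d [Hd H1]].
set (s := d / 2).
assert (Hs : 0 < s < d) by (unfold s; lra).
specialize (H1 s Hs).
(* The factor s pays for the division by s in the difference quotient; the four errors B1 to B4 get
   eps/4 each. *)
destruct (Hc (eps * s / 4)) as [d2 [Hd2 H2]].
{ apply Rdiv_lt_0_compat; [apply Rmult_lt_0_compat; lra|lra]. }
exists d2; split; [exact Hd2|]; intros t Ht w Hw.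
pose proof (H1 w Hw) as A1.
pose proof (H1 _ (U_dilation t w Hw)) as A2.
pose proof (H2 t Ht w Hw) as A3.
pose proof (H2 t Ht _ (U_dilation s w Hw)) as A4.
rewrite Im_dilation in A2, A4.
set (q := fun w => ((exp s * C_derive g (exp s * w) - C_derive g w) / s - C_derive k w)%C).
set (p := fun w => (exp t * C_derive g (exp t * w) - C_derive g w)%C).
assert (B1 : Im w * Cmod (- (exp t * q (exp t * w)%C)) <= eps / 4).
{ rewrite Cmod_opp, Cmod_dilation; unfold q; lra. }
assert (B2 : Im w * Cmod (q w) <= eps / 4) by exact A1.
assert (Ns : RtoC s <> 0%C) by (apply RtoC_neq_0; lra).
assert (B3 : Im w * Cmod (exp s * p (exp s * w)%C / s) <= eps / 4).
{ rewrite Cmod_div by exact Ns; rewrite Cmod_dilation, Cmod_R, (Rabs_pos_eq s) by lra.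
  apply Rmult_le_reg_r with s; [lra|].
  replace (Im w * (exp s * Cmod (p (exp s * w)%C) / s) * s)
    with (exp s * Im w * Cmod (p (exp s * w)%C)) by (field; lra).
  unfold p; lra. }
assert (B4 : Im w * Cmod (- (p w / s)) <= eps / 4).
{ rewrite Cmod_opp, Cmod_div by exact Ns; rewrite Cmod_R, (Rabs_pos_eq s) by lra.
  apply Rmult_le_reg_r with s; [lra|].
  replace (Im w * (Cmod (p w) / s) * s) with (Im w * Cmod (p w)) by (field; lra).
  unfold p; lra. }
replace (exp t * C_derive k (exp t * w) - C_derive k w)%C
  with ((- (exp t * q (exp t * w)%C) + q w) + (exp s * p (exp s * w)%C / s + - (p w / s)))%C.
- replace eps with ((eps / 4 + eps / 4) + (eps / 4 + eps / 4)) by field.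
  pose proof (Rlt_le _ _ Hw).
  repeat apply Im_Cmod_triangle; assumption.
- unfold p, q.
  replace (exp t * (exp s * w))%C with (exp s * (exp t * w))%C by ring.
  field; exact Ns.
Qed.

(** This is the derivative at zeta = 0 of zeta -> g(e^zeta w), restricted to real zeta. *)
Lemma dilation_quotient_limit (g : C -> C) (w : C) (l : C) (eps : R) :
  is_Cderive g w l -> 0 < eps -> exists delta, 0 < delta /\
    forall t, 0 < t < delta ->
      Cmod ((dilation t g w - g w) / t - w * l) <= eps.
Proof.
intros H He.
assert (H1 : is_Cderive (fun z => g (cexp z * w)%C) (RtoC 0) (l * w)%C).
{ apply (is_Cderive_comp g (fun z => cexp z * w)%C).
  - rewrite cexp_0, Cmult_1_l; exact H.
  - eapply is_Cderive_eq.
    + apply (is_Cderive_mult cexp (fun _ => w)); [apply is_Cderive_cexp|apply is_Cderive_const].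
    + rewrite cexp_0; ring. }
destruct (proj1 (is_Cderive_eps _ _ _) H1 eps He) as [d [Hd B]].
exists d; split; [exact Hd|]; intros t Ht.
assert (E : Cmod (t - 0) = t).
{ replace (t - 0)%C with (RtoC t) by ring; rewrite Cmod_R; apply Rabs_pos_eq; lra. }
specialize (B t ltac:(rewrite E; lra)); rewrite E in B.
rewrite cexp_0, Cmult_1_l, cexp_RtoC in B.
assert (Nt : RtoC t <> 0%C) by (apply RtoC_neq_0; lra).
replace ((dilation t g w - g w) / t - w * l)%C
  with ((g (exp t * w) - g w - l * w * (t - 0)) / t)%C
  by (unfold dilation; field; exact Nt).
rewrite Cmod_div, Cmod_R, (Rabs_pos_eq t) by (auto; lra).
apply Rmult_le_reg_r with t; [lra|].
unfold Rdiv; rewrite Rmult_assoc, Rinv_l; lra.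
Qed.

(** Pointwise, the difference quotients at w and at i tend to w g'(w) and i g'(i). Seminorm
    convergence controls only the difference of the errors at w and i, through the mean value
    inequality, and k i = 0 fixes the constant. *)
Lemma generator_value (F : (C -> Prop) -> Prop) (g k : C -> C) (w : C) :
  generator F g k -> U w -> k w = (w * C_derive g w - Ci * C_derive g Ci)%C.
Proof.
intros H Hw; pose proof H as [[_ _] [[_ k0] _]].
apply generator_iff in H; destruct H as [Hg [Hk H]].
pose proof (little_bloch_i_holomorphic F _ Hg) as Og.
pose proof (little_bloch_i_holomorphic F _ Hk) as Ok.
set (d := (w * C_derive g w - Ci * C_derive g Ci - k w)%C).
assert (Hm : 0 < Rmin 1 (Im w)) by (apply Rmin_glb_lt; [lra|exact Hw]).
set (m := Rmin 1 (Im w)) in *.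
(* One unit for each of the two pointwise limits, and |w - i|/m for the mean value inequality at
   height m. *)
set (K := 2 + Cmod (w - Ci) / m).
assert (HK : 0 < K).
{ unfold K; assert (0 <= Cmod (w - Ci) / m); [|lra].
  apply Rmult_le_pos; [apply Cmod_ge_0|apply Rlt_le, Rinv_0_lt_compat, Hm]. }
assert (B : forall eps, 0 < eps -> Cmod d <= K * eps).
{ intros eps He.
  destruct (H eps He) as [d1 [D1 H1]].
  destruct (dilation_quotient_limit g w _ eps (C_derive_U g w Og Hw) He) as [d2 [D2 H2]].
  destruct (dilation_quotient_limit g Ci _ eps (C_derive_U g Ci Og U_Ci) He) as [d3 [D3 H3]].
  set (t := Rmin d1 (Rmin d2 d3) / 2).
  assert (Ht : 0 < Rmin d1 (Rmin d2 d3)) by (repeat apply Rmin_glb_lt; assumption).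
  pose proof (Rmin_l d1 (Rmin d2 d3)); pose proof (Rmin_r d1 (Rmin d2 d3)).
  pose proof (Rmin_l d2 d3); pose proof (Rmin_r d2 d3).
  specialize (H1 t ltac:(unfold t; lra)).
  specialize (H2 t ltac:(unfold t; lra)).
  specialize (H3 t ltac:(unfold t; lra)).
  pose proof (bloch_mean_value (fun w => (dilation t g w - g w) / t - k w)%C eps m Ci w) as M.
  assert (M' := M (holomorphic_U_intro _ _ (fun z Hz => is_Cderive_quotient t g k z Og Ok Hz))
    ltac:(intros z Hz; rewrite C_derive_quotient by assumption; apply H1, Hz) Hm
    (Rmin_l _ _) (Rmin_r _ _)).
  clear M; simpl in M'; rewrite k0 in M'.
  set (a := ((dilation t g w - g w) / t)%C) in *.
  set (b := ((dilation t g Ci - g Ci) / t)%C) in *.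
  replace d with ((a - k w - (b - 0)) + (- (a - w * C_derive g w) + (b - Ci * C_derive g Ci)))%C
    by (unfold d; ring).
  eapply Rle_trans; [apply Cmod_triangle|].
  eapply Rle_trans; [apply Rplus_le_compat_l, Cmod_triangle|].
  rewrite Cmod_opp.
  replace (K * eps) with (eps / m * Cmod (w - Ci) + (eps + eps)); [lra|].
  unfold K; field; lra. }
assert (Z : Cmod d = 0).
{ destruct (Req_dec (Cmod d) 0) as [E|E]; [exact E|].
  pose proof (Cmod_ge_0 d).
  assert (He : 0 < Cmod d / (2 * K)) by (apply Rdiv_lt_0_compat; lra).
  specialize (B _ He).
  replace (K * (Cmod d / (2 * K))) with (Cmod d / 2) in B by (field; lra); lra. }
apply Cmod_eq_0 in Z.
replace (k w) with (w * C_derive g w - Ci * C_derive g Ci - d)%C by (unfold d; ring).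
rewrite Z; ring.
Qed.

(** * Dissipativity and inversion *)

Lemma strongly_continuous_resolvent_equation (F : (C -> Prop) -> Prop)
  (HF : boundary_filter F) (lam : C) (f k : C -> C) :
  generator F f k -> strongly_continuous (fun w => lam * f w - k w)%C.
Proof.
intros H eps He.
pose proof (little_bloch_i_holomorphic F _ (proj1 H)) as Of.
pose proof (little_bloch_i_holomorphic F _ (proj1 (proj2 H))) as Ok.
pose proof (Cmod_ge_0 lam) as Pl.
assert (He1 : 0 < eps / 2 / (1 + Cmod lam)) by (apply Rdiv_lt_0_compat; lra).
destruct (generator_domain_continuous F HF f k H _ He1) as [d1 [D1 H1]].
destruct (generator_range_continuous F HF f k H (eps / 2) ltac:(lra)) as [d2 [D2 H2]].
exists (Rmin d1 d2); split; [apply Rmin_glb_lt; assumption|].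
intros t Ht w Hw.
pose proof (Rmin_l d1 d2); pose proof (Rmin_r d1 d2).
specialize (H1 t ltac:(lra) w Hw); specialize (H2 t ltac:(lra) w Hw).
assert (E : forall z, U z -> C_derive (fun w => lam * f w - k w)%C z
  = (lam * C_derive f z - C_derive k z)%C).
{ intros z Hz; apply is_C_derive_unique, is_Cderive_minus;
    [apply is_Cderive_scal|]; apply C_derive_U; assumption. }
rewrite !E by (auto; apply U_dilation, Hw).
set (a := (exp t * C_derive f (exp t * w) - C_derive f w)%C) in *.
set (b := (exp t * C_derive k (exp t * w) - C_derive k w)%C) in *.
replace (_ - _)%C with (lam * a + - b)%C by (unfold a, b; ring).
replace eps with (eps / 2 + eps / 2) by field.
apply Im_Cmod_triangle; [apply Rlt_le, Hw| |rewrite Cmod_opp; exact H2].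
rewrite Cmod_mult.
apply (Rmult_le_compat_l _ _ _ Pl) in H1.
apply Rle_trans with ((1 + Cmod lam) * (eps / 2 / (1 + Cmod lam))); [|right; field; lra].
assert (0 < eps / 2 / (1 + Cmod lam)) by exact He1.
lra.
Qed.

(** * A vector that is not strongly continuous, for the uniform reading *)

Lemma Cmod_cexp_Ci (w : C) : Cmod (cexp (Ci * w)) = exp (- Im w).
Proof. rewrite Cmod_cexp; f_equal; unfold Re, Im; simpl; ring. Qed.

Lemma mul_exp_opp_le_1 (y : R) : y * exp (- y) <= 1.
Proof.
pose proof (exp_ineq1_le y); pose proof (exp_pos (- y)).
apply Rle_trans with (exp y * exp (- y)); [apply Rmult_le_compat_r; lra|].
rewrite <- exp_plus, Rplus_opp_r, exp_0; lra.
Qed.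

Lemma exp_opp_lt_1 (y : R) : 0 < y -> exp (- y) < 1.
Proof. intros Hy; rewrite <- exp_0; apply exp_increasing; lra. Qed.

Lemma is_Cderive_cexp_Ci (w : C) :
  is_Cderive (fun z => cexp (Ci * z)) w (Ci * cexp (Ci * w))%C.
Proof.
eapply is_Cderive_eq; [apply (is_Cderive_comp cexp (fun z => Ci * z)%C)|].
- apply is_Cderive_cexp.
- apply is_Cderive_scal, is_Cderive_id.
- ring.
Qed.

Definition wave (w : C) : C := (cexp (Ci * w) - cexp (Ci * Ci))%C.

Lemma is_Cderive_wave (w : C) : is_Cderive wave w (Ci * cexp (Ci * w))%C.
Proof.
eapply is_Cderive_eq; [apply is_Cderive_minus|].
- apply is_Cderive_cexp_Ci.
- apply is_Cderive_const.
- ring.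
Qed.

Lemma C_derive_wave (w : C) : C_derive wave w = (Ci * cexp (Ci * w))%C.
Proof. apply is_C_derive_unique, is_Cderive_wave. Qed.

(** With y = Im w, the quantity Im w |f'(w)| is y e^{-y}: at most 1 and at most y, but constant
    along horizontal lines. *)
Lemma wave_little_bloch : little_bloch_i im_to_zero wave.
Proof.
apply little_bloch_i_iff; [apply im_to_zero_boundary_filter|].
assert (E : forall w, U w -> Im w * Cmod (C_derive wave w) = Im w * exp (- Im w)).
{ intros w Hw; rewrite C_derive_wave, Cmod_mult, Cmod_Ci, Cmod_cexp_Ci; ring. }
split; [|split; [|split]].
- eapply holomorphic_U_intro; intros w _; apply is_Cderive_wave.
- exists 1; intros w Hw; rewrite E by exact Hw; apply mul_exp_opp_le_1.
- intros eps He; exists (mkposreal eps He); intros w Hw H; simpl in H.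
  rewrite E by exact Hw.
  pose proof (exp_opp_lt_1 _ Hw); pose proof (exp_pos (- Im w)).
  unfold U in Hw; nra.
- unfold wave; ring.
Qed.

(* At w = pi/(e^t-1) + i, passing from w to e^t w turns the phase of [wave] by pi. *)
Lemma wave_not_strongly_continuous : ~ strongly_continuous wave.
Proof.
intros H.
destruct (H (exp (- (1)) / 2)) as [d [Hd H1]]; [pose proof (exp_pos (- (1))); lra|].
set (t := d / 2); set (e := exp t - 1).
assert (Ht : 0 < t) by (unfold t; lra).
assert (He : 0 < e) by (pose proof (exp_ineq1 t); unfold e; lra).
set (w := (PI / e, 1) : C).
assert (Hw : U w) by (unfold U; simpl; lra).
specialize (H1 t ltac:(unfold t; lra) w Hw).
rewrite !C_derive_wave in H1.
assert (E : cexp (Ci * (exp t * w)) = (- RtoC (exp (- e)) * cexp (Ci * w))%C).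
{ replace (Ci * (exp t * w))%C with (((- e)%R, PI) + Ci * w)%C.
  - rewrite cexp_plus; f_equal; unfold cexp; simpl.
    rewrite cos_PI, sin_PI; apply injective_projections; simpl; ring.
  - replace (exp t) with (1 + e) by (unfold e; ring).
    unfold w; apply injective_projections; simpl; field; lra. }
rewrite E in H1.
replace (exp t * (Ci * (- exp (- e) * cexp (Ci * w))) - Ci * cexp (Ci * w))%C
  with (RtoC (exp t * exp (- e) + 1) * (- (Ci * cexp (Ci * w))))%C in H1
  by (rewrite RtoC_plus, RtoC_mult; ring).
rewrite Cmod_mult, Cmod_opp, Cmod_mult, Cmod_Ci, Cmod_cexp_Ci, Cmod_R in H1.
pose proof (exp_pos t); pose proof (exp_pos (- e)); pose proof (exp_pos (- (1))).
assert (P : 0 < exp t * exp (- e)) by (apply Rmult_lt_0_compat; assumption).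
rewrite Rabs_pos_eq in H1 by lra.
change (Im w) with 1 in H1; nra.
Qed.

Lemma strongly_continuous_ext (g h : C -> C) :
  holomorphic_U g -> eqU g h -> strongly_continuous g -> strongly_continuous h.
Proof.
intros Og E H eps He; destruct (H eps He) as [d [Hd H1]].
exists d; split; [exact Hd|]; intros t Ht w Hw.
rewrite !(C_derive_eqU g h) by (auto; apply U_dilation, Hw); apply H1; assumption.
Qed.

Lemma im_to_zero_resolvent_set_empty (lam : C) :
  ~ resolvent_set (little_bloch_i im_to_zero) (generator im_to_zero) lam.
Proof.
intros [H _]; destruct (H _ wave_little_bloch) as [f [k [G E]]].
pose proof im_to_zero_boundary_filter as HF.
apply wave_not_strongly_continuous.
apply strongly_continuous_ext with (fun w => lam * f w - k w)%C.
- apply (holomorphic_U_intro _ (fun z => lam * C_derive f z - C_derive k z)%C).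
  intros w Hw; apply is_Cderive_minus; [apply is_Cderive_scal|]; apply C_derive_U; auto;
    eapply little_bloch_i_holomorphic; apply G.
- intros w Hw; symmetry; apply E, Hw.
- apply (strongly_continuous_resolvent_equation im_to_zero HF _ _ _ G).
Qed.

(* (1 + t lam) f' = e^t f'(e^t w) + t (h' - q'), where h = lam f - k and q is the error of the
   difference quotient; dilation being isometric, this forces the bound as t -> 0. *)
Lemma generator_dissipative (F : (C -> Prop) -> Prop) (HF : boundary_filter F)
  (lam : C) (f k h : C -> C) (M : R) :
  generator F f k -> 0 < Re lam -> eqU h (fun w => lam * f w - k w)%C ->
  bloch_le h M -> bloch_le f (M / Re lam).
Proof.
intros G Hl Eh HM.
pose proof (little_bloch_i_holomorphic F _ (proj1 G)) as Of.
pose proof (little_bloch_i_holomorphic F _ (proj1 (proj2 G))) as Ok.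
destruct (little_bloch_i_bounded F HF f (proj1 G)) as [N1 HN1].
(* N is the exact supremum, so that any bound derived for f from N is in turn an inequality on N
   itself. *)
destruct (bloch_norm_finite f N1 HN1) as [N EN].
assert (HN : bloch_le f N) by (apply bloch_norm_le; rewrite EN; apply Rle_refl).
assert (Eh' : forall z, U z -> C_derive h z = (lam * C_derive f z - C_derive k z)%C).
{ intros z Hz; apply is_C_derive_unique.
  apply (is_Cderive_ext_U (fun w => lam * f w - k w)%C); [exact Hz| |].
  - intros w Hw; symmetry; apply Eh, Hw.
  - apply is_Cderive_minus; [apply is_Cderive_scal|]; apply C_derive_U; assumption. }
apply generator_iff in G; destruct G as [_ [_ G]].
assert (B : forall eps, 0 < eps -> N * Re lam <= M + eps).
{ intros eps He; destruct (G eps He) as [d [Hd H1]].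
  set (t := d / 2); assert (Ht : 0 < t < d) by (unfold t; lra).
  specialize (H1 t Ht).
  assert (P : 1 + t * Re lam <= Cmod (1 + t * lam)).
  { eapply Rle_trans; [|apply re_le_Cmod].
    eapply Rle_trans; [|apply Rle_abs].
    unfold Re; simpl; lra. }
  assert (P0 : 0 < 1 + t * Re lam) by (pose proof (Rmult_lt_0_compat _ _ (proj1 Ht) Hl); lra).
  assert (B : bloch_le f ((N + t * (M + eps)) / (1 + t * Re lam))).
  { intros w Hw; specialize (H1 w Hw).
    pose proof (bloch_dilation_bound f N t w HN Hw) as B1.
    specialize (HM w Hw); rewrite Eh' in HM by exact Hw.
    set (q := ((exp t * C_derive f (exp t * w) - C_derive f w) / t - C_derive k w)%C) in *.
    set (h' := (lam * C_derive f w - C_derive k w)%C) in *.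
    apply Rmult_le_reg_r with (1 + t * Re lam); [exact P0|].
    unfold Rdiv; rewrite (Rmult_assoc (N + _)), Rinv_l, Rmult_1_r by lra.
    apply Rle_trans with (Im w * Cmod ((1 + t * lam) * C_derive f w)).
    - rewrite Cmod_mult, Rmult_assoc, (Rmult_comm (Cmod (C_derive f w))).
      apply Rmult_le_compat_l; [apply Rlt_le, Hw|].
      apply Rmult_le_compat_r; [apply Cmod_ge_0|exact P].
    - replace ((1 + t * lam) * C_derive f w)%C
        with (exp t * C_derive f (exp t * w) + t * (h' + - q))%C.
      2: { unfold h', q; field; apply RtoC_neq_0; lra. }
      apply Im_Cmod_triangle; [apply Rlt_le, Hw|exact B1|].
      rewrite Cmod_mult, Cmod_R, Rabs_pos_eq by lra.
      replace (Im w * (t * Cmod (h' + - q))) with (t * (Im w * Cmod (h' + - q))) by ring.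
      apply Rmult_le_compat_l; [lra|].
      apply Im_Cmod_triangle; [apply Rlt_le, Hw|exact HM|rewrite Cmod_opp; exact H1]. }
  apply bloch_norm_le in B; rewrite EN in B; simpl in B.
  apply Rmult_le_reg_l with t; [lra|].
  apply (Rmult_le_compat_r (1 + t * Re lam)) in B; [|lra].
  unfold Rdiv in B; rewrite Rmult_assoc, Rinv_l in B by lra; lra. }
apply bloch_le_weaken with N; [exact HN|].
apply Rmult_le_reg_r with (Re lam); [exact Hl|].
unfold Rdiv; rewrite Rmult_assoc, Rinv_l, Rmult_1_r by lra.
apply le_epsilon; exact B.
Qed.

(** * The inversion w -> -1/w *)

Lemma U_inversion (w : C) : U w -> U (- / w)%C.
Proof.
intros Hw; unfold U, Cinv, Im in *; simpl.
replace (- (- snd w / _)) with (snd w / (fst w * (fst w * 1) + snd w * (snd w * 1)))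
  by (unfold Rdiv; ring).
apply Rdiv_lt_0_compat; [exact Hw|nra].
Qed.

Lemma Im_inversion (w : C) : U w -> Im (- / w)%C = Im w / Cmod w ^ 2.
Proof.
intros Hw; rewrite Cmod2_alt; unfold Cinv, Im, Re; simpl; unfold Rdiv; ring.
Qed.

(** Composition with the automorphism of U that fixes i, hence respects the normalization, and
    exchanges 0 and infinity. *)
Definition inversion (f : C -> C) (w : C) : C := f (- / w)%C.

Lemma is_Cderive_inversion (f : C -> C) (w : C) : holomorphic_U f -> U w ->
  is_Cderive (inversion f) w (C_derive f (- / w) * / (w * w))%C.
Proof.
intros Of Hw; unfold inversion.
eapply is_Cderive_eq; [apply (is_Cderive_comp f (fun z => - / z)%C)|].
- apply C_derive_U; [exact Of|apply U_inversion, Hw].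
- apply is_Cderive_opp, is_Cderive_inv, U_neq_0, Hw.
- ring.
Qed.

Lemma C_derive_inversion (f : C -> C) (w : C) : holomorphic_U f -> U w ->
  C_derive (inversion f) w = (C_derive f (- / w) * / (w * w))%C.
Proof. intros; apply is_C_derive_unique, is_Cderive_inversion; assumption. Qed.

(** Hyperbolic invariance: Im (-1/w) = Im w / |w|^2 compensates the factor 1/w^2 of the chain
    rule. *)
Lemma inversion_invariant (w c : C) : U w ->
  Im w * Cmod (c * / (w * w)) = Im (- / w)%C * Cmod c.
Proof.
intros Hw; rewrite Im_inversion by exact Hw.
pose proof (U_neq_0 w Hw) as N; pose proof (proj1 (Cmod_gt_0 w) N).
rewrite Cmod_mult, Cmod_inv, Cmod_mult by (apply Cmult_neq_0; exact N).
field; lra.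
Qed.

Lemma bloch_le_inversion (f : C -> C) (M : R) :
  holomorphic_U f -> bloch_le f M -> bloch_le (inversion f) M.
Proof.
intros Of H w Hw; rewrite C_derive_inversion, inversion_invariant by assumption.
apply H, U_inversion, Hw.
Qed.

Lemma inversion_involutive (f : C -> C) : eqU (inversion (inversion f)) f.
Proof.
intros w Hw; unfold inversion; f_equal; field; apply U_neq_0, Hw.
Qed.

(** The real line and infinity form one circle of the Riemann sphere, which the inversion maps to
    itself. *)
Lemma to_boundary_inversion (P : C -> Prop) :
  to_boundary P -> to_boundary (fun w => P (- / w)%C).
Proof.
intros [d Hd].
assert (Pd := cond_pos d).
(* If |w| < d then |1/w| > 1/d. Otherwise Im w < d^3 <= d |w|^2 gives Im (-1/w) < d, and |w| > 1/e
   gives Im (-1/w) <= 1/|w| < e <= d. *)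
set (e := Rmin d (d * d * d)).
assert (He : 0 < e).
{ apply Rmin_glb_lt; [exact Pd|]; repeat apply Rmult_lt_0_compat; exact Pd. }
exists (mkposreal e He); simpl; intros w Hw H; apply Hd; [apply U_inversion, Hw|].
pose proof (proj1 (Cmod_gt_0 w) (U_neq_0 w Hw)) as Pw.
rewrite Im_inversion, Cmod_opp, Cmod_inv by (auto; apply U_neq_0, Hw).
pose proof (Rmin_l d (d * d * d)) as E1; pose proof (Rmin_r d (d * d * d)) as E2.
fold e in E1, E2.
destruct (Rlt_dec (Cmod w) d) as [L|L].
{ right; apply Rinv_0_lt_contravar; assumption. }
left; apply Rmult_lt_reg_r with (Cmod w ^ 2); [apply pow_lt, Pw|].
unfold Rdiv; rewrite Rmult_assoc, Rinv_l by (apply Rgt_not_eq, pow_lt, Pw).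
rewrite Rmult_1_r; pose proof (Im_le_Cmod w).
destruct H as [H|H].
- assert (d * d <= Cmod w ^ 2) by nra.
  assert (d * (d * d) <= d * Cmod w ^ 2) by (apply Rmult_le_compat_l; lra); lra.
- assert (1 < e * Cmod w).
  { apply (Rmult_lt_compat_l e) in H; [|exact He]; rewrite Rinv_r in H; lra. }
  assert (e * Cmod w <= d * Cmod w) by (apply Rmult_le_compat_r; lra).
  simpl; nra.
Qed.

Lemma little_bloch_i_inversion (f : C -> C) :
  little_bloch_i to_boundary f -> little_bloch_i to_boundary (inversion f).
Proof.
pose proof to_boundary_boundary_filter as HF.
intros H; apply little_bloch_i_iff in H; [|exact HF].
destruct H as [Of [[M HM] [Hl H0]]].
apply little_bloch_i_iff; [exact HF|].
split; [|split; [|split]].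
- eapply holomorphic_U_intro; intros w Hw; apply is_Cderive_inversion; assumption.
- exists M; apply bloch_le_inversion; assumption.
- intros eps He.
  apply (boundary_filter_mono _ HF) with (2 := to_boundary_inversion _ (Hl eps He)).
  intros w Hw H; rewrite C_derive_inversion, inversion_invariant by assumption; exact H.
- unfold inversion; rewrite <- H0; f_equal.
  apply injective_projections; simpl; field.
Qed.

(* The inversion conjugates S_t to S_{-t}. *)
Lemma generator_inversion (f k : C -> C) :
  generator to_boundary f k ->
  generator to_boundary (inversion f) (fun w => - inversion k w)%C.
Proof.
pose proof to_boundary_boundary_filter as HF.
intros G.
pose proof (generator_range_continuous _ HF f k G) as Kc.
apply generator_iff in G; destruct G as [Xf [Xk G]].
pose proof (little_bloch_i_holomorphic _ _ Xf) as Of.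
pose proof (little_bloch_i_holomorphic _ _ Xk) as Ok.
apply generator_iff; split; [apply little_bloch_i_inversion, Xf|].
split.
{ apply (little_bloch_i_ext _ HF (fun w => (-1) * inversion k w + 0 * inversion k w)%C).
  - intros w _; ring.
  - apply little_bloch_i_lin; try apply little_bloch_i_inversion; assumption. }
intros eps He.
destruct (G (eps / 2) ltac:(lra)) as [d1 [D1 H1]].
destruct (Kc (eps / 2) ltac:(lra)) as [d2 [D2 H2]].
exists (Rmin d1 d2); split; [apply Rmin_glb_lt; assumption|]; intros t Ht w Hw.
pose proof (Rmin_l d1 d2); pose proof (Rmin_r d1 d2).
assert (E : forall z, U z -> C_derive (fun w => - inversion k w)%C z
  = (- (C_derive k (- / z) * / (z * z)))%C).
{ intros z Hz; apply is_C_derive_unique, is_Cderive_opp, is_Cderive_inversion; assumption. }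
rewrite E, !C_derive_inversion by (auto; apply U_dilation, Hw).
pose proof (U_neq_0 w Hw) as Nw.
(* With this point -1/w = e^t v, so a dilation after the inversion is the opposite dilation before
   it. The quotient is compared with k at e^t v rather than at v, and p, the variation of k under
   S_t, accounts for the difference. *)
set (v := (- / (exp t * w))%C).
assert (Uv : U v) by (apply U_inversion, U_dilation, Hw).
assert (Net : RtoC (exp t) <> 0%C) by (apply RtoC_neq_0, Rgt_not_eq, exp_pos).
assert (Ev : (- / w = exp t * v)%C) by (unfold v; field; split; assumption).
specialize (H1 t ltac:(lra) v Uv); specialize (H2 t ltac:(lra) v Uv).
set (q := ((exp t * C_derive f (exp t * v) - C_derive f v) / t - C_derive k v)%C) in *.
set (p := (exp t * C_derive k (exp t * v) - C_derive k v)%C) in *.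
rewrite Ev.
assert (Nt : RtoC t <> 0%C) by (apply RtoC_neq_0; lra).
replace (_ - _)%C with ((/ exp t * (p + - q)) * / (w * w))%C.
- rewrite inversion_invariant by exact Hw.
  rewrite Ev, Im_dilation, Cmod_mult, Cmod_inv, Cmod_R by exact Net.
  pose proof (exp_pos t).
  rewrite Rabs_pos_eq by lra.
  replace (exp t * Im v * (/ exp t * Cmod (p + - q))) with (Im v * Cmod (p + - q)) by (field; lra).
  replace eps with (eps / 2 + eps / 2) by field.
  apply Im_Cmod_triangle; [apply Rlt_le, Uv|exact H2|rewrite Cmod_opp; exact H1].
- unfold p, q; field; auto.
Qed.

(** * Completeness and the Neumann series *)

Lemma pow_small (r B eps : R) : 0 <= r < 1 -> 0 < eps ->
  exists n0 : nat, forall n : nat, (n0 <= n)%nat -> B * r ^ n <= eps.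
Proof.
intros Hr He.
assert (HB : 0 < eps / (1 + Rabs B)).
{ apply Rdiv_lt_0_compat; [exact He|]; pose proof (Rabs_pos B); lra. }
destruct (pow_lt_1_zero r ltac:(rewrite Rabs_pos_eq; lra) _ HB) as [n0 H].
exists n0; intros n Hn; specialize (H n Hn).
assert (P : 0 <= r ^ n) by (apply pow_le; lra).
rewrite Rabs_pos_eq in H by exact P.
pose proof (Rle_abs B); pose proof (Rabs_pos B).
apply Rle_trans with ((1 + Rabs B) * r ^ n); [apply Rmult_le_compat_r; lra|].
apply Rle_trans with ((1 + Rabs B) * (eps / (1 + Rabs B))).
- apply Rmult_le_compat_l; lra.
- right; field; lra.
Qed.

Lemma geometric_cauchy (u : nat -> C) (A r : R) : 0 <= r < 1 ->
  (forall n, Cmod (u (S n) - u n) <= A * r ^ n) ->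
  forall n m, (n <= m)%nat -> Cmod (u m - u n) <= A / (1 - r) * r ^ n.
Proof.
intros Hr H.
assert (HA : 0 <= A).
{ specialize (H 0%nat); pose proof (Cmod_ge_0 (u 1%nat - u 0%nat)); simpl in H; lra. }
(* The exact value of the geometric sum, with its factor 1 - r^k, is what the induction can
   carry. *)
assert (S : forall n k, Cmod (u (k + n)%nat - u n) <= A / (1 - r) * (r ^ n * (1 - r ^ k))).
{ intros n; induction k as [|k IH].
  - simpl; replace (u n - u n)%C with (RtoC 0) by ring; rewrite Cmod_0; right; ring.
  - replace (u (S k + n)%nat - u n)%C
      with ((u (S (k + n)) - u (k + n)%nat) + (u (k + n)%nat - u n))%C by (simpl; ring).
    eapply Rle_trans; [apply Cmod_triangle|].
    specialize (H (k + n)%nat); rewrite pow_add in H.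
    eapply Rle_trans; [apply Rplus_le_compat; [exact H|exact IH]|].
    right; simpl; field; lra. }
intros n m Hnm.
replace m with ((m - n) + n)%nat by lia.
eapply Rle_trans; [apply S|].
apply Rmult_le_compat_l.
- apply Rmult_le_pos; [exact HA|apply Rlt_le, Rinv_0_lt_compat; lra].
- assert (0 <= r ^ n) by (apply pow_le; lra).
  assert (0 <= r ^ (m - n)) by (apply pow_le; lra).
  nra.
Qed.

(** A total function, so that the limit of a sequence of functions can be written down before
    convergence is known; it is a limit only where the coordinates converge. *)
Definition Clim_seq (u : nat -> C) : C :=
  (real (Lim_seq (fun n => Re (u n))), real (Lim_seq (fun n => Im (u n)))).

Lemma Clim_seq_geometric (u : nat -> C) (A r : R) : 0 <= r < 1 ->
  (forall n, Cmod (u (S n) - u n) <= A * r ^ n) ->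
  forall n, Cmod (Clim_seq u - u n) <= A / (1 - r) * r ^ n.
Proof.
intros Hr H.
pose proof (geometric_cauchy u A r Hr H) as G.
assert (K : forall p : C -> R, (forall a b : C, Rabs (p a - p b) <= Cmod (a - b)) ->
  is_lim_seq (fun n => p (u n)) (real (Lim_seq (fun n => p (u n))))).
{ intros p Hp; apply Lim_seq_correct', ex_lim_seq_cauchy_corr.
  intros eps.
  assert (He : 0 < eps / 2 / 2) by (pose proof (cond_pos eps); lra).
  destruct (pow_small r (A / (1 - r)) _ Hr He) as [n0 Hn0].
  exists n0; intros n m Hn Hm.
  eapply Rle_lt_trans; [apply Hp|].
  pose proof (G n0 n Hn) as G1; pose proof (G n0 m Hm) as G2.
  specialize (Hn0 n0 (le_n _)).
  replace (u n - u m)%C with ((u n - u n0) + - (u m - u n0))%C by ring.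
  eapply Rle_lt_trans; [apply Cmod_triangle|rewrite Cmod_opp].
  pose proof (cond_pos eps); lra. }
assert (K1 := K Re ltac:(intros a b; apply (re_le_Cmod (a - b)))).
assert (K2 := K Im ltac:(intros a b; apply (Rabs_Im_le_Cmod (a - b)))).
intros n; apply le_epsilon; intros eps He.
apply is_lim_seq_spec in K1; apply is_lim_seq_spec in K2.
assert (He2 : 0 < eps / 2) by lra.
destruct (K1 (mkposreal _ He2)) as [n1 B1]; destruct (K2 (mkposreal _ He2)) as [n2 B2].
set (m := (n + n1 + n2)%nat).
specialize (B1 m ltac:(unfold m; lia)); specialize (B2 m ltac:(unfold m; lia)).
specialize (G n m ltac:(unfold m; lia)); simpl in B1, B2.
replace (Clim_seq u - u n)%C with ((u m - u n) + - (u m - Clim_seq u))%C by ring.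
eapply Rle_trans; [apply Cmod_triangle|rewrite Cmod_opp].
apply Rplus_le_compat; [exact G|].
assert (T := Cmod_le_Rabs (Re (u m) - Lim_seq (fun n => Re (u n)))
  (Im (u m) - Lim_seq (fun n => Im (u n)))).
change (Re (u m) - Lim_seq (fun n => Re (u n)), Im (u m) - Lim_seq (fun n => Im (u n)))
  with (u m - Clim_seq u)%C in T; lra.
Qed.

Lemma geometric_limit_unique (u : nat -> C) (l l' : C) (A B r : R) : 0 <= r < 1 ->
  (forall n, Cmod (l - u n) <= A * r ^ n) -> (forall n, Cmod (l' - u n) <= B * r ^ n) ->
  l = l'.
Proof.
intros Hr H1 H2.
assert (Z : Cmod (l - l') <= 0).
{ apply le_epsilon; intros eps He; rewrite Rplus_0_l.
  destruct (pow_small r (A + B) eps Hr He) as [n0 Hn]; specialize (Hn n0 (le_n _)).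
  specialize (H1 n0); specialize (H2 n0).
  replace (l - l')%C with ((l - u n0) + - (l' - u n0))%C by ring.
  eapply Rle_trans; [apply Cmod_triangle|rewrite Cmod_opp]; lra. }
pose proof (Cmod_ge_0 (l - l')).
assert (E : Cmod (l - l') = 0) by lra; apply Cmod_eq_0 in E.
replace l with (l - l' + l')%C by ring; rewrite E; ring.
Qed.

Lemma is_Cderive_sub (f g : C -> C) (w : C) : holomorphic_U f -> holomorphic_U g -> U w ->
  is_Cderive (fun z => f z - g z)%C w (C_derive f w - C_derive g w)%C.
Proof. intros; apply is_Cderive_minus; apply C_derive_U; assumption. Qed.

Lemma C_derive_sub (f g : C -> C) (w : C) : holomorphic_U f -> holomorphic_U g -> U w ->
  C_derive (fun z => f z - g z)%C w = (C_derive f w - C_derive g w)%C.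
Proof. intros; apply is_C_derive_unique, is_Cderive_sub; assumption. Qed.

Lemma holomorphic_sub (f g : C -> C) : holomorphic_U f -> holomorphic_U g ->
  holomorphic_U (fun z => f z - g z)%C.
Proof. intros Hf Hg; eapply holomorphic_U_intro; intros w Hw; apply is_Cderive_sub; auto. Qed.

(** Vanishing at i and the mean value inequality turn geometric convergence in the seminorm into
    pointwise convergence of the functions, with control of increments; the derivatives converge
    pointwise directly. Differentiability of the limit is then a three-epsilon argument. *)
Lemma little_bloch_i_complete (F : (C -> Prop) -> Prop) (HF : boundary_filter F)
  (f : nat -> C -> C) (K r : R) : 0 <= r < 1 ->
  (forall n, little_bloch_i F (f n)) ->
  (forall n, bloch_le (fun z => f (S n) z - f n z)%C (K * r ^ n)) ->
  exists g, little_bloch_i F g /\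
    forall n, bloch_le (fun z => g z - f n z)%C (K / (1 - r) * r ^ n).
Proof.
intros Hr Xf HK.
assert (Of : forall n, holomorphic_U (f n)).
{ intros n; apply (little_bloch_i_holomorphic F), Xf. }
set (g := fun w => Clim_seq (fun n => f n w)).
set (d := fun w => Clim_seq (fun n => C_derive (f n) w)).
assert (f0 : forall n, f n Ci = 0%C) by (intros n; apply (Xf n)).
assert (MV : forall m a b n, 0 < m -> m <= Im a -> m <= Im b ->
  Cmod ((f (S n) b - f (S n) a) - (f n b - f n a)) <= K / m * Cmod (b - a) * r ^ n).
{ intros m a b n Hm Ha Hb.
  pose proof (bloch_mean_value _ _ m a b (holomorphic_sub _ _ (Of (S n)) (Of n)) (HK n) Hm Ha Hb)
    as B; simpl in B.
  replace (f (S n) b - f (S n) a - (f n b - f n a))%C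
    with (f (S n) b - f n b - (f (S n) a - f n a))%C by ring.
  eapply Rle_trans; [exact B|right; field; lra]. }
assert (Rg : forall w, U w -> exists A, forall n, Cmod (g w - f n w) <= A * r ^ n).
{ intros w Hw.
  assert (Hm : 0 < Rmin 1 (Im w)) by (apply Rmin_glb_lt; [lra|exact Hw]).
  exists (K / Rmin 1 (Im w) * Cmod (w - Ci) / (1 - r)).
  apply Clim_seq_geometric; [exact Hr|]; intros n.
  pose proof (MV _ Ci w n Hm (Rmin_l _ _) (Rmin_r _ _)) as B.
  rewrite !f0 in B.
  replace (f (S n) w - f n w)%C with (f (S n) w - 0 - (f n w - 0))%C by ring; exact B. }
assert (Rd : forall w, U w -> forall n, Cmod (d w - C_derive (f n) w) <= K / Im w / (1 - r) * r ^ n).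
{ intros w Hw; unfold U in Hw.
  apply Clim_seq_geometric; [exact Hr|]; intros n.
  specialize (HK n w Hw); rewrite C_derive_sub in HK by auto.
  apply Rmult_le_reg_l with (Im w); [exact Hw|].
  replace (Im w * (K / Im w * r ^ n)) with (K * r ^ n) by (field; lra); exact HK. }
(* The error on an increment is proportional to |b - a|; a bound on g - f n alone could not be
   divided by z - w. *)
assert (Rgg : forall m a b n, 0 < m -> m <= Im a -> m <= Im b ->
  Cmod ((g b - g a) - (f n b - f n a)) <= K / m * Cmod (b - a) / (1 - r) * r ^ n).
{ intros m a b n Hm Ha Hb.
  destruct (Rg a ltac:(unfold U; lra)) as [A1 HA1].
  destruct (Rg b ltac:(unfold U; lra)) as [A2 HA2].
  pose proof (Clim_seq_geometric (fun n => f n b - f n a)%C _ r Hr (fun n => MV m a b n Hm Ha Hb)) as L.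
  rewrite (geometric_limit_unique (fun n => f n b - f n a)%C (g b - g a) (Clim_seq (fun n => f n b - f n a)%C)
    (A2 + A1) (K / m * Cmod (b - a) / (1 - r)) r Hr); [apply L| |exact L].
  intros n'.
  replace (g b - g a - (f n' b - f n' a))%C with ((g b - f n' b) + - (g a - f n' a))%C by ring.
  eapply Rle_trans; [apply Cmod_triangle|rewrite Cmod_opp].
  specialize (HA1 n'); specialize (HA2 n'); lra. }
assert (HK0 : 0 <= K).
{ apply bloch_le_pos with (fun z => f 1%nat z - f 0%nat z)%C.
  replace K with (K * r ^ 0) by (simpl; ring); apply HK. }
assert (Dg : forall w, U w -> is_Cderive g w (d w)).
{ intros w Hw; pose proof Hw as Hw'; unfold U in Hw'.
  apply is_Cderive_eps; intros eps He.
  (* All z with |z - w| < Im w / 2 lie above height m, so one constant serves the whole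
     neighbourhood. *)
  set (m := Im w / 2); assert (Hm : 0 < m) by (unfold m; lra).
  destruct (pow_small r (K / m / (1 - r)) (eps / 3) Hr ltac:(lra)) as [n0 Hn].
  specialize (Hn n0 (le_n _)).
  destruct (pow_small r (K / Im w / (1 - r)) (eps / 3) Hr ltac:(lra)) as [n1 Hn1].
  assert (Hn' : K / Im w / (1 - r) * r ^ n0 <= eps / 3).
  { eapply Rle_trans; [|exact Hn].
    apply Rmult_le_compat_r; [apply pow_le; lra|].
    apply Rmult_le_compat_r; [apply Rlt_le, Rinv_0_lt_compat; lra|].
    apply Rmult_le_compat_l; [exact HK0|].
    apply Rinv_le_contravar; unfold m; lra. }
  destruct (proj1 (is_Cderive_eps _ _ _) (C_derive_U (f n0) w (Of n0) Hw) (eps / 3) ltac:(lra))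
    as [e [E0 E1]].
  exists (Rmin e m); split; [apply Rmin_glb_lt; assumption|]; intros z Hz.
  assert (Z1 := Rlt_le_trans _ _ _ Hz (Rmin_l _ _)).
  assert (Z2 := Rlt_le_trans _ _ _ Hz (Rmin_r _ _)).
  specialize (E1 z Z1).
  assert (Iz : m <= Im z).
  { pose proof (Rabs_Im_le_Cmod (z - w)) as T.
    pose proof (Rabs_def2 _ _ (Rle_lt_trans _ _ _ T Z2)) as [_ T2].
    replace (Im (z - w)%C) with (Im z - Im w) in T2 by (unfold Im; simpl; ring).
    unfold m in *; lra. }
  pose proof (Rgg m w z n0 Hm ltac:(unfold m; lra) Iz) as B1.
  pose proof (Rd w Hw n0) as B2.
  pose proof (Cmod_ge_0 (z - w)) as Pz.
  replace (g z - g w - d w * (z - w))%C with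
    ((g z - g w - (f n0 z - f n0 w)) + ((f n0 z - f n0 w - C_derive (f n0) w * (z - w))
     + - ((d w - C_derive (f n0) w) * (z - w))))%C by ring.
  eapply Rle_trans; [apply Cmod_triangle|].
  eapply Rle_trans; [apply Rplus_le_compat_l, Cmod_triangle|].
  rewrite Cmod_opp, Cmod_mult.
  assert (B1' : K / m * Cmod (z - w) / (1 - r) * r ^ n0 <= eps / 3 * Cmod (z - w)).
  { replace (K / m * Cmod (z - w) / (1 - r) * r ^ n0)
      with (K / m / (1 - r) * r ^ n0 * Cmod (z - w)) by (field; lra).
    apply Rmult_le_compat_r; assumption. }
  assert (B2' : Cmod (d w - C_derive (f n0) w) * Cmod (z - w) <= eps / 3 * Cmod (z - w))
    by (apply Rmult_le_compat_r; lra).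
  lra. }
assert (Og : holomorphic_U g) by (apply (holomorphic_U_intro g d), Dg).
assert (Bg : forall n, bloch_le (fun z => g z - f n z)%C (K / (1 - r) * r ^ n)).
{ intros n w Hw; rewrite C_derive_sub by auto.
  rewrite (is_C_derive_unique g w (d w) (Dg w Hw)).
  unfold U in Hw; pose proof (Rd w Hw n) as B.
  apply Rle_trans with (Im w * (K / Im w / (1 - r) * r ^ n)).
  - apply Rmult_le_compat_l; lra.
  - right; field; lra. }
exists g; split; [|exact Bg].
assert (Split : forall n w A B, U w -> Im w * Cmod (C_derive (f n) w) <= A ->
  K / (1 - r) * r ^ n <= B -> Im w * Cmod (C_derive g w) <= A + B).
{ intros n w A B Hw HA HB.
  pose proof (Bg n w Hw) as B1; rewrite C_derive_sub in B1 by auto.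
  replace (C_derive g w) with (C_derive (f n) w + (C_derive g w - C_derive (f n) w))%C by ring.
  apply Im_Cmod_triangle; [apply Rlt_le, Hw|exact HA|lra]. }
apply little_bloch_i_iff; [exact HF|]; split; [exact Og|split; [|split]].
- destruct (little_bloch_i_bounded F HF _ (Xf 0%nat)) as [M HM].
  exists (M + K / (1 - r) * r ^ 0); intros w Hw; apply (Split 0%nat); [exact Hw|apply HM, Hw|lra].
- intros eps He.
  destruct (pow_small r (K / (1 - r)) (eps / 2) Hr ltac:(lra)) as [n0 Hn].
  pose proof (proj1 (little_bloch_i_iff F HF (f n0)) (Xf n0)) as [_ [_ [L _]]].
  apply (boundary_filter_mono F HF) with (2 := L (eps / 2) ltac:(lra)).
  intros w Hw H; replace eps with (eps / 2 + eps / 2) by field.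
  apply (Split n0); auto.
- destruct (Rg Ci U_Ci) as [A HA].
  apply (geometric_limit_unique (fun n => f n Ci) (g Ci) 0 A 0 r Hr HA).
  intros n; rewrite f0; replace (0 - 0)%C with (RtoC 0) by ring; rewrite Cmod_0; lra.
Qed.

(** Operators are graphs between functions that matter only on U, so compatibility with [eqU] is
    demanded explicitly; the bound is transferred for every real majorant N of the input. *)
Record bounded_operator (F : (C -> Prop) -> Prop) (T : operator) (M : R) : Prop := {
  bop_total : forall h, little_bloch_i F h -> exists f, T h f;
  bop_domain : forall h f, T h f -> little_bloch_i F h;
  bop_range : forall h f, T h f -> little_bloch_i F f;
  bop_ext : forall h h' f f', eqU h h' -> eqU f f' -> T h f -> T h' f';
  bop_lin : forall a b h1 f1 h2 f2, T h1 f1 -> T h2 f2 ->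
    T (fun w => a * h1 w + b * h2 w)%C (fun w => a * f1 w + b * f2 w)%C;
  bop_bound : forall h f N, T h f -> bloch_le h N -> bloch_le f (M * N)
}.

Lemma bop_sub (F : (C -> Prop) -> Prop) (T : operator) (M : R) (HT : bounded_operator F T M)
  (h1 f1 h2 f2 : C -> C) : T h1 f1 -> T h2 f2 ->
  T (fun w => h1 w - h2 w)%C (fun w => f1 w - f2 w)%C.
Proof.
intros H1 H2.
apply (bop_ext _ _ _ HT (fun w => 1 * h1 w + (-1) * h2 w)%C _ (fun w => 1 * f1 w + (-1) * f2 w)%C).
- intros w _; ring.
- intros w _; ring.
- apply (bop_lin _ _ _ HT); assumption.
Qed.

Lemma bloch_le_all_pos (q : C -> C) :
  (forall eps, 0 < eps -> bloch_le q eps) -> bloch_le q 0.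
Proof.
intros H w Hw; apply le_epsilon; intros eps He; rewrite Rplus_0_l; apply H; assumption.
Qed.

Lemma bloch_le_ext (f g : C -> C) (M : R) :
  holomorphic_U f -> eqU f g -> bloch_le f M -> bloch_le g M.
Proof. intros Of E H w Hw; rewrite (C_derive_eqU f g) by assumption; apply H, Hw. Qed.

(** The equation w f - T f = h says that f is a fixed point of f -> (h + T f)/w, a contraction of
    ratio M/|w|; its iterates sum the Neumann series. Uniqueness is the same contraction
    estimate. *)
Lemma bounded_operator_neumann (F : (C -> Prop) -> Prop) (HF : boundary_filter F)
  (T : operator) (M : R) (HT : bounded_operator F T M) (w : C) :
  0 <= M < Cmod w -> resolvent_set (little_bloch_i F) T w.
Proof.
intros HM.
assert (Nw : w <> 0%C) by (apply Cmod_gt_0; lra).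
split.
- intros h Xh.
  (* T is only a relation; choice selects one image, constrained only when f lies in the space. *)
  assert (Tc : forall f, exists g, little_bloch_i F f -> T f g).
  { intros f; destruct (classic (little_bloch_i F f)) as [X|X].
    - destruct (bop_total _ _ _ HT f X) as [g Hg]; exists g; auto.
    - exists f; contradiction. }
  set (t := fun f => proj1_sig (constructive_indefinite_description _ (Tc f))).
  assert (Ht : forall f, little_bloch_i F f -> T f (t f)).
  { intros f; unfold t; apply proj2_sig. }
  set (step := fun f : C -> C => (fun z => / w * h z + / w * t f z)%C).
  set (s := fun n => Nat.iter n step h).
  assert (Xs : forall n, little_bloch_i F (s n)).
  { induction n as [|n IH]; [exact Xh|].
    change (s (S n)) with (step (s n)); apply little_bloch_i_lin; auto.
    apply (bop_range _ _ _ HT (s n)), Ht, IH. }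
  assert (Os : forall n, holomorphic_U (s n)).
  { intros n; apply (little_bloch_i_holomorphic F), Xs. }
  assert (Ots : forall n, holomorphic_U (t (s n))).
  { intros n; apply (little_bloch_i_holomorphic F), (bop_range _ _ _ HT (s n)), Ht, Xs. }
  set (r := M / Cmod w).
  assert (Hr : 0 <= r < 1).
  { unfold r; split.
    - apply Rmult_le_pos; [lra|apply Rlt_le, Rinv_0_lt_compat; lra].
    - apply Rmult_lt_reg_r with (Cmod w); [lra|].
      unfold Rdiv; rewrite Rmult_assoc, Rinv_l; lra. }
  assert (Contr : forall f1 f2 g1 g2 N, T f1 g1 -> T f2 g2 ->
    bloch_le (fun z => f1 z - f2 z)%C N ->
    bloch_le (fun z => (/ w * h z + / w * g1 z) - (/ w * h z + / w * g2 z))%C (r * N)).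
  { intros f1 f2 g1 g2 N T1 T2 HN.
    pose proof (bop_sub _ _ _ HT _ _ _ _ T1 T2) as T3.
    pose proof (little_bloch_i_holomorphic F _ (bop_range _ _ _ HT _ _ T3)) as O3.
    pose proof (bop_bound _ _ _ HT _ _ _ T3 HN) as B.
    apply (bloch_le_ext (fun z => / w * (g1 z - g2 z) + 0 * (g1 z - g2 z))%C).
    - eapply holomorphic_U_intro; intros z Hz; apply is_Cderive_lin; assumption.
    - intros z _; ring.
    - replace (r * N) with (Cmod (/ w) * (M * N) + Cmod 0 * (M * N)).
      + apply bloch_le_lin; assumption.
      + rewrite Cmod_0, Cmod_inv by exact Nw; unfold r; field; lra. }
  destruct (little_bloch_i_bounded F HF _ (Xs 0%nat)) as [M0 HM0].
  destruct (little_bloch_i_bounded F HF _ (Xs 1%nat)) as [M1 HM1].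
  (* A bound on the first increment s 1 - s 0; the contraction multiplies it by r at each step. *)
  set (K := Cmod 1 * M1 + Cmod (-1) * M0).
  assert (HK : forall n, bloch_le (fun z => s (S n) z - s n z)%C (K * r ^ n)).
  { induction n as [|n IH].
    - apply (bloch_le_ext (fun z => 1 * s 1%nat z + (-1) * s 0%nat z)%C).
      + eapply holomorphic_U_intro; intros z Hz; apply is_Cderive_lin; auto.
      + intros z _; ring.
      + rewrite pow_O, Rmult_1_r; apply bloch_le_lin; auto.
    - replace (K * r ^ S n) with (r * (K * r ^ n)) by (simpl; ring).
      exact (Contr _ _ _ _ _ (Ht _ (Xs (S n))) (Ht _ (Xs n)) IH). }
  destruct (little_bloch_i_complete F HF s K r Hr Xs HK) as [f [Xf Hf]].
  exists f, (t f); split; [apply Ht, Xf|].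
  assert (Xtf := bop_range _ _ _ HT _ _ (Ht f Xf)).
  assert (Of := little_bloch_i_holomorphic F _ Xf).
  assert (Xlim : little_bloch_i F (fun z => / w * h z + / w * t f z)%C)
    by (apply little_bloch_i_lin; assumption).
  assert (Olim := little_bloch_i_holomorphic F _ Xlim).
  (* Both f and its image under the contraction lie within K/(1-r) r^(n+1) of the iterate s (n+1),
     which explains the factor 2 below. *)
  assert (B0 : bloch_le (fun z => f z - (/ w * h z + / w * t f z))%C 0).
  { apply bloch_le_all_pos; intros eps He.
    destruct (pow_small r (2 * (K / (1 - r))) eps Hr He) as [n Hn].
    specialize (Hn (S n) ltac:(lia)).
    pose proof (Hf (S n)) as B1.
    assert (B2 : bloch_le (fun z => (/ w * h z + / w * t f z) - s (S n) z)%C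
      (r * (K / (1 - r) * r ^ n))) by exact (Contr _ _ _ _ _ (Ht f Xf) (Ht _ (Xs n)) (Hf n)).
    intros z Hz; specialize (B1 z Hz); specialize (B2 z Hz).
    rewrite (C_derive_sub f (s (S n))) in B1 by auto.
    rewrite (C_derive_sub (fun z => / w * h z + / w * t f z)%C (s (S n))) in B2 by auto.
    rewrite (C_derive_sub f (fun z => / w * h z + / w * t f z)%C) by auto.
    replace (C_derive f z - _)%C with ((C_derive f z - C_derive (s (S n)) z) +
      - (C_derive (fun z => / w * h z + / w * t f z)%C z - C_derive (s (S n)) z))%C by ring.
    eapply Rle_trans; [|exact Hn].
    replace (2 * (K / (1 - r)) * r ^ S n)
      with (K / (1 - r) * r ^ S n + r * (K / (1 - r) * r ^ n)) by (simpl; ring).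
    apply Im_Cmod_triangle; [apply Rlt_le, Hz|exact B1|rewrite Cmod_opp; exact B2]. }
  intros z Hz.
  pose proof (bloch_le_0_constant _ (holomorphic_sub _ _ Of Olim) B0 z Ci Hz U_Ci) as E.
  simpl in E.
  rewrite (proj2 Xf), (proj2 Xh), (proj2 Xtf) in E.
  replace (h z) with (w * (/ w * h z + / w * t f z) - t f z)%C by (field; exact Nw).
  replace (f z) with ((f z - (/ w * h z + / w * t f z)) + (/ w * h z + / w * t f z))%C at 1 by ring.
  rewrite E; ring.
- intros f1 f2 h [g1 [T1 E1]] [g2 [T2 E2]].
  pose proof (bop_sub _ _ _ HT _ _ _ _ T1 T2) as T3.
  assert (X3 := bop_domain _ _ _ HT _ _ T3).
  assert (O3 := little_bloch_i_holomorphic F _ X3).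
  destruct (little_bloch_i_bounded F HF _ X3) as [N1 HN1].
  destruct (bloch_norm_finite _ _ HN1) as [N EN].
  assert (HN : bloch_le (fun z => f1 z - f2 z)%C N) by (apply bloch_norm_le; rewrite EN; apply Rle_refl).
  pose proof (bop_bound _ _ _ HT _ _ _ T3 HN) as B.
  (* The difference d = f1 - f2 satisfies T d = w d, so its exact seminorm N obeys N <= (M/|w|) N
     and vanishes. *)
  assert (B2 : bloch_le (fun z => f1 z - f2 z)%C (M / Cmod w * N)).
  { intros z Hz; specialize (B z Hz).
    assert (D : C_derive (fun z => g1 z - g2 z)%C z = (w * C_derive (fun z => f1 z - f2 z) z)%C).
    { apply is_C_derive_unique, (is_Cderive_ext_U (fun z => w * (f1 z - f2 z))%C); [exact Hz| |].
      - intros x Hx; specialize (E1 x Hx); specialize (E2 x Hx); rewrite E1 in E2.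
        replace (w * (f1 x - f2 x))%C with ((w * f1 x - g1 x) - (w * f2 x - g2 x) + (g1 x - g2 x))%C by ring.
        rewrite E2; ring.
      - apply is_Cderive_scal, C_derive_U; assumption. }
    rewrite D, Cmod_mult in B.
    apply Rmult_le_reg_l with (Cmod w); [lra|].
    replace (Cmod w * (M / Cmod w * N)) with (M * N) by (field; lra); lra. }
  apply bloch_norm_le in B2; rewrite EN in B2; simpl in B2.
  pose proof (bloch_le_pos _ _ HN) as N0.
  assert (NZ : N = 0).
  { apply (Rmult_le_compat_l (Cmod w)) in B2; [|lra].
    replace (Cmod w * (M / Cmod w * N)) with (M * N) in B2 by (field; lra); nra. }
  rewrite NZ in HN; intros z Hz.
  pose proof (bloch_le_0_constant _ O3 HN z Ci Hz U_Ci) as E; simpl in E.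
  rewrite (proj2 (bop_domain _ _ _ HT _ _ T1)), (proj2 (bop_domain _ _ _ HT _ _ T2)) in E.
  replace (f1 z) with ((f1 z - f2 z) + f2 z)%C by ring; rewrite E; ring.
Qed.

(** * The resolvent set off the imaginary axis *)

Lemma generator_scal (F : (C -> Prop) -> Prop) (HF : boundary_filter F) (a : C) (g k : C -> C) :
  generator F g k -> generator F (fun w => a * g w)%C (fun w => a * k w)%C.
Proof.
intros H.
apply (generator_ext F HF (fun w => a * g w + 0 * g w)%C (fun w => a * k w + 0 * k w)%C);
  [intros w _; ring|intros w _; ring|apply generator_lin; assumption].
Qed.

Lemma little_bloch_i_scal (F : (C -> Prop) -> Prop) (HF : boundary_filter F) (a : C) (g : C -> C) :
  little_bloch_i F g -> little_bloch_i F (fun w => a * g w)%C.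
Proof.
intros H; apply (little_bloch_i_ext F HF (fun w => a * g w + 0 * g w)%C);
  [intros w _; ring|apply little_bloch_i_lin; assumption].
Qed.

Lemma scalar_minus_inversion (lam : C) (f h : C -> C) :
  scalar_minus lam (generator to_boundary) f h ->
  scalar_minus (- lam) (generator to_boundary) (inversion f) (fun w => - inversion h w)%C.
Proof.
intros [k [G E]]; exists (fun w => - inversion k w)%C; split; [apply generator_inversion, G|].
intros w Hw; unfold inversion; rewrite (E _ (U_inversion w Hw)); ring.
Qed.

Lemma scalar_minus_domain (F : (C -> Prop) -> Prop) (HF : boundary_filter F)
  (lam : C) (f h : C -> C) :
  scalar_minus lam (generator F) f h -> little_bloch_i F h.
Proof.
intros [k [[Xf [Xk _]] E]].
apply (little_bloch_i_ext F HF (fun w => lam * f w + (-1) * k w)%C).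
- intros w Hw; rewrite (E w Hw); ring.
- apply little_bloch_i_lin; assumption.
Qed.

(** For Re lam < 0 the inversion turns the data (lam, f, h) into -lam, f o inv and - h o inv,
    without changing any seminorm. *)
Lemma resolvent_bound (lam : C) (f h : C -> C) (M : R) :
  Re lam <> 0 -> scalar_minus lam (generator to_boundary) f h -> bloch_le h M ->
  bloch_le f (/ Rabs (Re lam) * M).
Proof.
pose proof to_boundary_boundary_filter as HF.
intros Hl H HM; rewrite Rmult_comm.
destruct (Rtotal_order 0 (Re lam)) as [L|[L|L]]; [|congruence|].
- destruct H as [k [G E]]; rewrite Rabs_pos_eq by lra.
  exact (generator_dissipative _ HF lam f k h M G L E HM).
- pose proof H as [k0 [[Xf _] _]].
  assert (Of := little_bloch_i_holomorphic _ _ Xf).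
  assert (Oh := little_bloch_i_holomorphic _ _ (scalar_minus_domain _ HF _ _ _ H)).
  apply scalar_minus_inversion in H; destruct H as [k [G E]].
  rewrite Rabs_left by exact L; replace (- Re lam) with (Re (- lam)%C) by reflexivity.
  assert (Oi : holomorphic_U (inversion f)).
  { eapply holomorphic_U_intro; intros w Hw; apply is_Cderive_inversion; assumption. }
  assert (Oj : holomorphic_U (inversion h)).
  { eapply holomorphic_U_intro; intros w Hw; apply is_Cderive_inversion; assumption. }
  apply (bloch_le_ext (inversion (inversion f))).
  + eapply holomorphic_U_intro; intros w Hw; apply is_Cderive_inversion; assumption.
  + apply inversion_involutive.
  + apply bloch_le_inversion; [exact Oi|].
    apply (generator_dissipative _ HF _ _ _ (fun w => - inversion h w)%C M G); [simpl; unfold Re in L; lra|exact E|].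
    intros w Hw.
    assert (D : C_derive (fun w => - inversion h w)%C w = (- C_derive (inversion h) w)%C).
    { apply is_C_derive_unique, is_Cderive_opp, C_derive_U; assumption. }
    rewrite D, Cmod_opp; apply (bloch_le_inversion h M Oh HM w Hw).
Qed.

Lemma scalar_minus_lin (F : (C -> Prop) -> Prop) (HF : boundary_filter F)
  (lam a b : C) (f1 h1 f2 h2 : C -> C) :
  scalar_minus lam (generator F) f1 h1 -> scalar_minus lam (generator F) f2 h2 ->
  scalar_minus lam (generator F) (fun w => a * f1 w + b * f2 w)%C (fun w => a * h1 w + b * h2 w)%C.
Proof.
intros [k1 [G1 E1]] [k2 [G2 E2]].
exists (fun w => a * k1 w + b * k2 w)%C; split; [apply generator_lin; assumption|].
intros w Hw; rewrite (E1 w Hw), (E2 w Hw); ring.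
Qed.

Lemma scalar_minus_ext (F : (C -> Prop) -> Prop) (HF : boundary_filter F)
  (lam : C) (f h f' h' : C -> C) : eqU f f' -> eqU h h' ->
  scalar_minus lam (generator F) f h -> scalar_minus lam (generator F) f' h'.
Proof.
intros Ef Eh [k [G E]]; exists k; split.
- apply (generator_ext F HF f k); [exact Ef|intros w _; reflexivity|exact G].
- intros w Hw; rewrite <- (Eh w Hw), <- (Ef w Hw); apply E, Hw.
Qed.

(** Injectivity comes from [resolvent_bound] with a right-hand side of seminorm zero, so only
    surjectivity has to be propagated. *)
Lemma resolvent_set_of_surjective (lam : C) : Re lam <> 0 ->
  (forall h, little_bloch_i to_boundary h ->
    exists f, scalar_minus lam (generator to_boundary) f h) ->
  resolvent_set (little_bloch_i to_boundary) (generator to_boundary) lam.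
Proof.
pose proof to_boundary_boundary_filter as HF.
intros Hl H; split; [exact H|].
intros f1 f2 h H1 H2 w Hw.
pose proof (scalar_minus_lin _ HF lam 1 (-1) _ _ _ _ H1 H2) as H3.
pose proof H3 as [k [[X3 _] _]].
assert (B : bloch_le (fun w => 1 * h w + -1 * h w)%C 0).
{ intros z Hz.
  assert (D : C_derive (fun w => 1 * h w + -1 * h w)%C z = 0%C).
  { apply is_C_derive_unique.
    apply (is_Cderive_ext_U (fun _ => 0%C)); [exact Hz|intros x _; ring|apply is_Cderive_const]. }
  rewrite D, Cmod_0; lra. }
pose proof (resolvent_bound lam _ _ 0 Hl H3 B) as B2.
rewrite Rmult_0_r in B2.
pose proof (bloch_le_0_constant _ (little_bloch_i_holomorphic _ _ X3) B2 w Ci Hw U_Ci) as E.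
cbv beta in E; rewrite (proj2 X3) in E.
replace (f1 w) with ((1 * f1 w + -1 * f2 w) + f2 w)%C by ring; rewrite E; ring.
Qed.

Lemma resolvent_bounded_operator (lam : C) : Re lam <> 0 ->
  resolvent_set (little_bloch_i to_boundary) (generator to_boundary) lam ->
  bounded_operator to_boundary (resolvent lam (generator to_boundary)) (/ Rabs (Re lam)).
Proof.
pose proof to_boundary_boundary_filter as HF.
intros Hl [Hs _]; split.
- exact Hs.
- intros h f; apply scalar_minus_domain, HF.
- intros h f [k [[Xf _] _]]; exact Xf.
- intros h h' f f' Eh Ef; apply scalar_minus_ext; assumption.
- intros a b h1 f1 h2 f2; apply scalar_minus_lin, HF.
- intros h f N; apply resolvent_bound, Hl.
Qed.

(** If f = lam g - Gamma g, so that g is the resolvent applied to f, then w f - g = w ((lam - 1/w) g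
    - Gamma g): the two equations are the same, up to the factor w. *)
Lemma resolvent_set_resolvent_iff (F : (C -> Prop) -> Prop) (HF : boundary_filter F) (lam w : C) :
  resolvent_set (little_bloch_i F) (generator F) lam -> w <> 0%C ->
  resolvent_set (little_bloch_i F) (resolvent lam (generator F)) w <->
  resolvent_set (little_bloch_i F) (generator F) (lam - / w).
Proof.
intros Hlam Nw; split; intros [Hs Hi]; split.
- intros h Xh.
  destruct (Hs _ (little_bloch_i_scal F HF w h Xh)) as [f0 [g [[k [G E1]] E2]]].
  exists g, k; split; [exact G|]; intros z Hz.
  specialize (E1 z Hz); specialize (E2 z Hz); cbv beta in E1, E2; rewrite E1 in E2.
  replace (h z) with (/ w * (w * h z))%C by (field; exact Nw).
  rewrite E2; field; exact Nw.
- intros f1 f2 h [k1 [G1 E1]] [k2 [G2 E2]].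
  assert (R1 : eqU (fun z => lam * f1 z - k1 z)%C (fun z => lam * f2 z - k2 z)%C).
  { apply Hi with (h := fun z => (w * h z)%C).
    - exists f1; split.
      + exists k1; split; [exact G1|intros z _; reflexivity].
      + intros z Hz; rewrite (E1 z Hz); field; exact Nw.
    - exists f2; split.
      + exists k2; split; [exact G2|intros z _; reflexivity].
      + intros z Hz; rewrite (E2 z Hz); field; exact Nw. }
  apply (proj2 Hlam) with (h := fun z => (lam * f1 z - k1 z)%C).
  + exists k1; split; [exact G1|intros z _; reflexivity].
  + exists k2; split; [exact G2|exact R1].
- intros h Xh.
  destruct (Hs _ (little_bloch_i_scal F HF (/ w) h Xh)) as [g [k [G E]]].
  exists (fun z => lam * g z - k z)%C, g; split.
  + exists k; split; [exact G|intros z _; reflexivity].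
  + intros z Hz.
    replace (h z) with (w * (/ w * h z))%C by (field; exact Nw).
    rewrite (E z Hz); field; exact Nw.
- intros f1 f2 h [g1 [[k1 [G1 E1]] E1']] [g2 [[k2 [G2 E2]] E2']].
  assert (Eg : eqU g1 g2).
  { apply Hi with (h := fun z => (/ w * h z)%C).
    - exists k1; split; [exact G1|]; intros z Hz; rewrite (E1' z Hz), (E1 z Hz); field; exact Nw.
    - exists k2; split; [exact G2|]; intros z Hz; rewrite (E2' z Hz), (E2 z Hz); field; exact Nw. }
  intros z Hz; specialize (E1' z Hz); specialize (E2' z Hz).
  replace (f1 z) with (/ w * ((w * f1 z - g1 z) + g1 z))%C by (field; exact Nw).
  cbv beta in E1', E2'; rewrite <- E1', E2', (Eg z Hz); field; exact Nw.
Qed.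

(** For w = 1/(lam - mu) one has lam - 1/w = mu, and Neumann's condition 1/|Re lam| < |w| describes
    the disc about lam that touches the imaginary axis. *)
Lemma resolvent_set_disc (lam mu : C) :
  resolvent_set (little_bloch_i to_boundary) (generator to_boundary) lam ->
  Cmod (lam - mu) < Rabs (Re lam) ->
  resolvent_set (little_bloch_i to_boundary) (generator to_boundary) mu.
Proof.
intros Hlam H.
pose proof to_boundary_boundary_filter as HF.
destruct (classic (lam = mu)) as [<-|N]; [exact Hlam|].
assert (Nd : (lam - mu)%C <> 0%C).
{ intros E; apply N; replace lam with (lam - mu + mu)%C by ring; rewrite E; ring. }
pose proof (proj1 (Cmod_gt_0 _) Nd) as Pd.
assert (Hl : Re lam <> 0) by (intros E; rewrite E, Rabs_R0 in H; lra).
assert (Nw : (/ (lam - mu))%C <> 0%C).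
{ apply Cmod_gt_0; rewrite Cmod_inv by exact Nd; apply Rinv_0_lt_compat, Pd. }
replace mu with (lam - / / (lam - mu))%C.
2: { field; exact Nd. }
apply resolvent_set_resolvent_iff; [exact HF|exact Hlam|exact Nw|].
apply (bounded_operator_neumann _ HF _ _ (resolvent_bounded_operator lam Hl Hlam)).
rewrite Cmod_inv by exact Nd; split.
- apply Rlt_le, Rinv_0_lt_compat; lra.
- apply Rinv_0_lt_contravar; assumption.
Qed.

(** The discs about lam + x of radius Re lam + x exhaust the half plane as x grows, and a step Re
    lam / 2 stays inside the previous disc. *)
Lemma resolvent_set_right_half_plane (lam mu : C) :
  resolvent_set (little_bloch_i to_boundary) (generator to_boundary) lam ->
  0 < Re lam -> 0 < Re mu ->
  resolvent_set (little_bloch_i to_boundary) (generator to_boundary) mu.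
Proof.
intros Hlam Hl Hm.
set (l := fun n : nat => (lam + RtoC (INR n * (Re lam / 2)))%C).
assert (Rl : forall n, Re (l n) = Re lam + INR n * (Re lam / 2)) by (intros n; reflexivity).
assert (Hln : forall n,
  resolvent_set (little_bloch_i to_boundary) (generator to_boundary) (l n)).
{ induction n as [|n IH].
  - replace (l 0%nat) with lam; [exact Hlam|].
    unfold l; simpl; rewrite Rmult_0_l; ring.
  - apply (resolvent_set_disc (l n) _ IH).
    replace (l n - l (S n))%C with (RtoC (- (Re lam / 2))).
    + rewrite Cmod_R, Rabs_Ropp, Rl.
      assert (0 <= INR n * (Re lam / 2)) by (apply Rmult_le_pos; [apply pos_INR|lra]).
      rewrite !Rabs_pos_eq by lra; lra.
    + unfold l; rewrite S_INR; apply injective_projections; simpl; ring. }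
(* Expanded, |l n - mu|^2 < (Re (l n))^2 reads D < 2 Re (l n) Re mu, and Re (l n) exceeds n Re lam /
   2. *)
set (D := Re mu ^ 2 + (Im lam - Im mu) ^ 2).
destruct (INR_unbounded (D / (Re lam * Re mu))) as [n Hn].
apply (resolvent_set_disc (l n) _ (Hln n)).
assert (P : 0 < Re lam * Re mu) by (apply Rmult_lt_0_compat; assumption).
assert (HD : D < INR n * (Re lam * Re mu)).
{ apply (Rmult_lt_compat_r _ _ _ P) in Hn.
  replace (D / (Re lam * Re mu) * (Re lam * Re mu)) with D in Hn by (field; lra); lra. }
assert (0 <= INR n * (Re lam / 2)) by (apply Rmult_le_pos; [apply pos_INR|lra]).
assert (Pn : 0 < Re (l n)) by (rewrite Rl; lra).
rewrite (Rabs_pos_eq (Re (l n))) by lra.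
apply Rsqr_incrst_0; [|apply Cmod_ge_0|lra].
rewrite !Rsqr_pow2, Cmod2_alt.
replace (Re (l n - mu)%C) with (Re (l n) - Re mu) by reflexivity.
replace (Im (l n - mu)%C) with (Im lam - Im mu) by (unfold l, Im; simpl; ring).
rewrite Rl; unfold D in HD; nra.
Qed.

Lemma resolvent_set_opp (lam : C) : Re lam <> 0 ->
  resolvent_set (little_bloch_i to_boundary) (generator to_boundary) lam ->
  resolvent_set (little_bloch_i to_boundary) (generator to_boundary) (- lam).
Proof.
pose proof to_boundary_boundary_filter as HF.
intros Hl [Hs _]; apply resolvent_set_of_surjective.
- simpl; unfold Re in Hl; lra.
- intros h Xh.
  destruct (Hs _ (little_bloch_i_inversion h Xh)) as [f Hf].
  apply scalar_minus_inversion in Hf.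
  exists (fun w => (-1) * inversion f w + 0 * inversion f w)%C.
  apply (scalar_minus_ext _ HF (- lam) _ _ _ h (fun w _ => eq_refl)) with
    (2 := scalar_minus_lin _ HF (- lam) (-1) 0 _ _ _ _ Hf Hf).
  intros w Hw; simpl; rewrite <- (inversion_involutive h w Hw); ring.
Qed.

Lemma resolvent_set_off_imaginary_axis (lam mu : C) :
  resolvent_set (little_bloch_i to_boundary) (generator to_boundary) lam ->
  Re lam <> 0 -> Re mu <> 0 ->
  resolvent_set (little_bloch_i to_boundary) (generator to_boundary) mu.
Proof.
intros Hlam Hl Hm.
assert (Hpos : exists nu, 0 < Re nu /\
  resolvent_set (little_bloch_i to_boundary) (generator to_boundary) nu).
{ destruct (Rlt_dec 0 (Re lam)) as [L|L]; [exists lam; auto|].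
  exists (- lam)%C; split; [simpl; unfold Re in *; lra|apply resolvent_set_opp; assumption]. }
destruct Hpos as [nu [Hn Hnu]].
destruct (Rlt_dec 0 (Re mu)) as [L|L].
- apply (resolvent_set_right_half_plane nu); assumption.
- replace mu with (- - mu)%C by ring.
  assert (0 < Re (- mu)%C) by (simpl; unfold Re in *; lra).
  apply resolvent_set_opp; [lra|].
  apply (resolvent_set_right_half_plane nu); assumption.
Qed.

(** * The imaginary axis, and a function outside the domain *)

(** K Im w handles the approach to the real line and K/|w| the approach to infinity. Boundedness
    uses the first when Im w <= 1 and the second, with |w| >= Im w, otherwise. *)
Lemma little_bloch_of_decay (f d : C -> C) (K : R) :
  (forall w, U w -> is_Cderive f w (d w)) ->
  (forall w, U w -> Im w * Cmod (d w) <= K * Im w /\ Im w * Cmod (d w) <= K / Cmod w) ->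
  little_bloch_i to_boundary (fun z => f z - f Ci)%C.
Proof.
intros Hd HK.
assert (E : forall w, U w -> C_derive (fun z => f z - f Ci)%C w = d w).
{ intros w Hw; apply is_C_derive_unique.
  eapply is_Cderive_eq; [apply is_Cderive_minus; [apply Hd, Hw|apply is_Cderive_const]|ring]. }
assert (K0 : 0 <= K).
{ destruct (HK Ci U_Ci) as [H _]; simpl in H; pose proof (Cmod_ge_0 (d Ci)); lra. }
apply little_bloch_i_iff; [apply to_boundary_boundary_filter|].
split; [|split; [|split]].
- apply (holomorphic_U_intro _ d); intros w Hw.
  eapply is_Cderive_eq; [apply is_Cderive_minus; [apply Hd, Hw|apply is_Cderive_const]|ring].
- exists K; intros w Hw; rewrite E by exact Hw.
  destruct (HK w Hw) as [H1 H2]; unfold U in Hw.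
  destruct (Rle_dec (Im w) 1) as [L|L].
  + apply Rle_trans with (1 := H1); nra.
  + apply Rle_trans with (1 := H2).
    pose proof (Im_le_Cmod w).
    apply Rmult_le_reg_r with (Cmod w); [lra|].
    unfold Rdiv; rewrite Rmult_assoc, Rinv_l by lra; nra.
- intros eps He.
  assert (Hd0 : 0 < eps / (1 + K)) by (apply Rdiv_lt_0_compat; lra).
  assert (KE : K * (eps / (1 + K)) <= eps).
  { apply Rle_trans with ((1 + K) * (eps / (1 + K))); [apply Rmult_le_compat_r; lra|].
    right; field; lra. }
  exists (mkposreal _ Hd0); intros w Hw H; rewrite E by exact Hw; simpl in H.
  destruct (HK w Hw) as [H1 H2].
  destruct H as [H|H].
  + apply Rle_trans with (1 := H1); apply Rle_trans with (2 := KE).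
    apply Rmult_le_compat_l; lra.
  + apply Rle_trans with (1 := H2); apply Rle_trans with (2 := KE).
    apply Rmult_le_compat_l; [exact K0|].
    rewrite <- (Rinv_inv (eps / (1 + K))).
    apply Rinv_le_contravar; [apply Rinv_0_lt_compat, Hd0|lra].
- ring.
Qed.

(** Its pole -i lies outside the closed half plane, and its limits at 0 and at infinity differ. *)
Definition cauchy_kernel (w : C) : C := (/ (w + Ci))%C.

Lemma U_plus_Ci (w : C) : U w -> Cmod w <= Cmod (w + Ci) /\ 1 <= Cmod (w + Ci).
Proof.
unfold U; intros Hw.
split; apply Rsqr_incr_0; try apply Cmod_ge_0; try lra;
  rewrite !Rsqr_pow2, !Cmod2_alt; unfold Re, Im in *; simpl; nra.
Qed.

Lemma plus_Ci_neq_0 (w : C) : U w -> (w + Ci)%C <> 0%C.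
Proof. intros Hw; apply Cmod_gt_0; pose proof (U_plus_Ci w Hw); lra. Qed.

Lemma Cmod_cauchy_kernel (w : C) : U w ->
  Cmod (cauchy_kernel w) <= 1 /\ Cmod (cauchy_kernel w) <= / Cmod w /\
  Cmod w * Cmod (cauchy_kernel w) <= 1.
Proof.
intros Hw; destruct (U_plus_Ci w Hw) as [H1 H2].
pose proof (proj1 (Cmod_gt_0 w) (U_neq_0 w Hw)) as P.
unfold cauchy_kernel; rewrite Cmod_inv by (apply plus_Ci_neq_0, Hw).
split; [|split].
- rewrite <- Rinv_1; apply Rinv_le_contravar; lra.
- apply Rinv_le_contravar; lra.
- apply Rmult_le_reg_r with (Cmod (w + Ci)); [lra|].
  rewrite Rmult_assoc, Rinv_l; lra.
Qed.

Lemma is_Cderive_cauchy_kernel (w : C) : U w ->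
  is_Cderive cauchy_kernel w (- (cauchy_kernel w * cauchy_kernel w))%C.
Proof.
intros Hw; pose proof (plus_Ci_neq_0 w Hw) as N; unfold cauchy_kernel.
eapply is_Cderive_eq; [apply (is_Cderive_comp Cinv (fun z => z + Ci)%C)|].
- apply is_Cderive_inv, N.
- apply is_Cderive_plus; [apply is_Cderive_id|apply is_Cderive_const].
- field; exact N.
Qed.

Lemma decay_square (w : C) : U w ->
  Im w * Cmod (cauchy_kernel w) ^ 2 <= Im w /\
  Im w * Cmod (cauchy_kernel w) ^ 2 <= / Cmod w.
Proof.
intros Hw; destruct (Cmod_cauchy_kernel w Hw) as [H1 [H2 H3]].
pose proof (Cmod_ge_0 (cauchy_kernel w)); pose proof (Im_le_Cmod w); unfold U in Hw.
split; simpl; rewrite Rmult_1_r.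
- rewrite <- (Rmult_1_r (Im w)) at 2; apply Rmult_le_compat_l; [lra|]; nra.
- rewrite <- Rmult_assoc, <- (Rmult_1_l (/ Cmod w)).
  apply Rmult_le_compat; try lra; try nra.
Qed.

Lemma cauchy_kernel_little_bloch :
  little_bloch_i to_boundary (fun z => cauchy_kernel z - cauchy_kernel Ci)%C.
Proof.
apply (little_bloch_of_decay _ _ 1 is_Cderive_cauchy_kernel).
intros w Hw; rewrite Cmod_opp, Cmod_mult.
replace (Cmod (cauchy_kernel w) * Cmod (cauchy_kernel w)) with (Cmod (cauchy_kernel w) ^ 2) by ring.
unfold Rdiv; rewrite !Rmult_1_l; apply decay_square, Hw.
Qed.

Lemma exp_monotone (x y : R) : x <= y -> exp x <= exp y.
Proof.
intros [H| ->]; [apply Rlt_le, exp_increasing, H|apply Rle_refl].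
Qed.

Lemma Cmod_cpow_imaginary (lam w : C) : Re lam = 0 ->
  Cmod (cpow w lam) <= exp (Rabs (Im lam) * PI).
Proof.
intros Hl; unfold cpow; rewrite Cmod_cexp; apply exp_monotone.
unfold clog_U; unfold Re, Im in *; simpl; rewrite Hl.
set (th := acos (fst w / Cmod w)).
assert (B : 0 <= th <= PI) by apply acos_bound.
pose proof (Rle_abs (- snd lam)) as A; rewrite Rabs_Ropp in A.
pose proof (Rabs_pos (snd lam)); nra.
Qed.

(** w^lam solves w f' = lam f and is bounded on U when Re lam = 0. The factor w/(w+i)^2 brings the
    product into the space and leaves, after division by w^(lam+1), the function 1/(w+i)^2 with its
    explicit primitive. *)
Definition resonant (lam w : C) : C :=
  (cpow w lam * (w * (cauchy_kernel w * cauchy_kernel w)))%C.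

Lemma is_Cderive_resonant (lam w : C) : U w ->
  is_Cderive (resonant lam) w (cpow w lam * ((lam + 1) * (cauchy_kernel w * cauchy_kernel w)
    - 2 * (w * cauchy_kernel w) * (cauchy_kernel w * cauchy_kernel w)))%C.
Proof.
intros Hw; unfold resonant.
eapply is_Cderive_eq.
- apply (is_Cderive_mult (fun z => cpow z lam) (fun z => z * (cauchy_kernel z * cauchy_kernel z))%C).
  + apply is_Cderive_cpow, Hw.
  + apply (is_Cderive_mult (fun z => z) (fun z => cauchy_kernel z * cauchy_kernel z)%C).
    * apply is_Cderive_id.
    * apply is_Cderive_mult; apply is_Cderive_cauchy_kernel, Hw.
- field; apply U_neq_0, Hw.
Qed.

Lemma resonant_little_bloch (lam : C) : Re lam = 0 ->
  little_bloch_i to_boundary (fun z => resonant lam z - resonant lam Ci)%C.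
Proof.
intros Hl; set (E := exp (Rabs (Im lam) * PI)).
assert (E0 : 0 < E) by apply exp_pos.
set (K := E * (Cmod (lam + 1) + 2)).
assert (HK : 0 <= K) by (apply Rmult_le_pos; [lra|]; pose proof (Cmod_ge_0 (lam + 1)); lra).
apply (little_bloch_of_decay _ _ K (is_Cderive_resonant lam)).
intros w Hw.
set (u := cauchy_kernel w).
assert (B : Im w * Cmod (cpow w lam * ((lam + 1) * (u * u) - 2 * (w * u) * (u * u)))
  <= K * (Im w * Cmod u ^ 2)).
{ replace ((lam + 1) * (u * u) - 2 * (w * u) * (u * u))%C
    with (((lam + 1) + - (2 * (w * u))) * (u * u))%C by ring.
  rewrite !Cmod_mult.
  replace (K * (Im w * Cmod u ^ 2)) with (Im w * (K * Cmod u ^ 2)) by ring.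
  apply Rmult_le_compat_l; [apply Rlt_le, Hw|].
  replace (Cmod u * Cmod u) with (Cmod u ^ 2) by ring.
  unfold K; rewrite <- Rmult_assoc.
  apply Rmult_le_compat_r; [apply pow2_ge_0|].
  apply Rmult_le_compat; try apply Cmod_ge_0; [apply Cmod_cpow_imaginary, Hl|].
  eapply Rle_trans; [apply Cmod_triangle|].
  rewrite Cmod_opp, !Cmod_mult, Cmod_R, Rabs_pos_eq by lra.
  destruct (Cmod_cauchy_kernel w Hw) as [_ [_ H3]]; fold u in H3; lra. }
destruct (decay_square w Hw) as [D1 D2]; fold u in D1, D2.
split; apply Rle_trans with (1 := B); apply Rmult_le_compat_l; assumption.
Qed.

(** On the imaginary axis |w| = Im w, so |w f'(w)| is the very quantity that tends to 0 at both
    ends. The bound y <= 1/3 serves [cauchy_kernel_axis], where (1 - y)/(1 + y) has to be at least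
    1/2. *)
Lemma axis_derivative_small (f : C -> C) (eps eta : R) :
  little_bloch_i to_boundary f -> 0 < eps -> 0 < eta ->
  exists y : R, 0 < y < eta /\ y <= 1 / 3 /\
    Cmod ((0, y)%R * C_derive f (0, y)%R) <= eps /\
    Cmod ((0, / y)%R * C_derive f (0, / y)%R) <= eps.
Proof.
intros Xf He Hn.
pose proof (proj1 (little_bloch_i_iff _ to_boundary_boundary_filter f) Xf) as [_ [_ [L _]]].
destruct (L eps He) as [d Hd].
pose proof (cond_pos d) as Pd.
assert (Hm : 0 < Rmin d (Rmin eta (1 / 3))) by (repeat apply Rmin_glb_lt; lra).
exists (Rmin d (Rmin eta (1 / 3)) / 2).
pose proof (Rmin_l d (Rmin eta (1 / 3))); pose proof (Rmin_r d (Rmin eta (1 / 3))).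
pose proof (Rmin_l eta (1 / 3)); pose proof (Rmin_r eta (1 / 3)).
set (y := Rmin d (Rmin eta (1 / 3)) / 2) in *.
assert (Hy : 0 < y < d) by (unfold y; lra).
assert (Hy' : 0 < / y) by (apply Rinv_0_lt_compat; lra).
assert (CM : forall t, 0 < t -> Cmod (0, t)%R = t).
{ intros t Ht; replace (0, t)%R with (Ci * RtoC t)%C
    by (apply injective_projections; simpl; ring).
  rewrite Cmod_mult, Cmod_Ci, Cmod_R, Rabs_pos_eq; lra. }
split; [unfold y; lra|split; [unfold y; lra|]].
rewrite !Cmod_mult, !CM by lra.
split.
- apply (Hd (0, y)%R); [unfold U; simpl; lra|left; simpl; lra].
- apply (Hd (0, / y)%R); [unfold U; simpl; lra|right].
  rewrite CM by exact Hy'; apply Rinv_0_lt_contravar; lra.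
Qed.

Lemma cauchy_kernel_axis (y : R) : 0 < y <= 1 / 3 ->
  1 / 2 <= Cmod (cauchy_kernel (0, y)%R - cauchy_kernel (0, / y)%R).
Proof.
intros Hy; unfold cauchy_kernel.
replace (/ ((0, y)%R + Ci) - / ((0, / y)%R + Ci))%C with (- Ci * RtoC ((1 - y) / (1 + y)))%C.
- rewrite Cmod_mult, Cmod_opp, Cmod_Ci, Rmult_1_l, Cmod_R.
  eapply Rle_trans; [|apply Rle_abs].
  apply Rmult_le_reg_r with (1 + y); [lra|].
  unfold Rdiv; rewrite (Rmult_assoc (1 - y)), Rinv_l; lra.
- apply injective_projections; simpl; field; repeat split; nra.
Qed.

(** For lam = 0 the values of 1/(w+i) and of w f'(w) have opposite increments between any two
    points. Between iy and i/y the former changes by at least 1/2, the latter by at most 1/8 +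
    1/8. *)
Lemma zero_not_in_resolvent_set :
  ~ resolvent_set (little_bloch_i to_boundary) (generator to_boundary) 0.
Proof.
intros [Hs _].
destruct (Hs _ cauchy_kernel_little_bloch) as [f [k [G E]]].
destruct (axis_derivative_small f (1 / 8) 1 (proj1 G) ltac:(lra) ltac:(lra))
  as [y [Hy [Hy3 [B1 B2]]]].
pose proof (cauchy_kernel_axis y ltac:(lra)) as B3.
assert (Hy' : 0 < / y) by (apply Rinv_0_lt_compat; lra).
assert (U1 : U (0, y)%R) by (unfold U; simpl; lra).
assert (U2 : U (0, / y)%R) by (unfold U; simpl; lra).
pose proof (E _ U1) as E1; pose proof (E _ U2) as E2; cbv beta in E1, E2.
rewrite (generator_value _ f k _ G U1) in E1; rewrite (generator_value _ f k _ G U2) in E2.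
set (a := ((0, y)%R * C_derive f (0, y)%R)%C) in *.
set (b := ((0, / y)%R * C_derive f (0, / y)%R)%C) in *.
set (u1 := cauchy_kernel (0, y)%R) in *; set (u2 := cauchy_kernel (0, / y)%R) in *.
replace (u1 - u2)%C with (b + - a)%C in B3.
- pose proof (Cmod_triangle b (- a)) as T; rewrite Cmod_opp in T; lra.
- replace (u1 - u2)%C with ((u1 - cauchy_kernel Ci) - (u2 - cauchy_kernel Ci))%C by ring.
  rewrite E1, E2; ring.
Qed.

(* With h = [resonant lam], a solution f of lam f - f' w + c = h satisfies
   (w^{-lam} (lam f + c))' = - lam / (w+i)^2, so that w^{-lam} (lam f + c) - lam / (w+i) is constant;
   since f' w and h tend to 0 at both ends of the imaginary axis but 1/(w+i) has different limits
   there, f is not in the little Bloch space. *)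
Lemma imaginary_axis_not_in_resolvent_set (lam : C) : lam <> 0%C -> Re lam = 0 ->
  ~ resolvent_set (little_bloch_i to_boundary) (generator to_boundary) lam.
Proof.
intros Nl Hl [Hs _].
destruct (Hs _ (resonant_little_bloch lam Hl)) as [f [k [G E]]].
pose proof (little_bloch_i_holomorphic _ _ (proj1 G)) as Of.
set (c := (Ci * C_derive f Ci + resonant lam Ci)%C).
assert (Eq : forall w, U w -> (lam * f w + c = w * C_derive f w + resonant lam w)%C).
{ intros w Hw; pose proof (E w Hw) as E1; cbv beta in E1.
  rewrite (generator_value _ f k w G Hw) in E1.
  replace (resonant lam w) with (resonant lam w - resonant lam Ci + resonant lam Ci)%C by ring.
  rewrite E1; unfold c; ring. }
set (Q := fun w => (cpow w (- lam) * (lam * f w + c) - lam * cauchy_kernel w)%C).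
assert (DQ : forall w, U w -> is_Cderive Q w (RtoC 0)).
{ intros w Hw; unfold Q.
  eapply is_Cderive_eq.
  - apply is_Cderive_minus; [apply (is_Cderive_mult (fun z => cpow z (- lam)) (fun z => lam * f z + c)%C)|].
    + apply is_Cderive_cpow, Hw.
    + apply is_Cderive_plus; [apply is_Cderive_scal, C_derive_U; assumption|apply is_Cderive_const].
    + apply is_Cderive_scal, is_Cderive_cauchy_kernel, Hw.
  - rewrite Eq by exact Hw; unfold resonant.
    assert (I : (cpow w (- lam) * cpow w lam = 1)%C).
    { rewrite <- cpow_plus; unfold cpow; replace ((- lam + lam) * clog_U w)%C with (RtoC 0) by ring.
      apply cexp_0. }
    pose proof (U_neq_0 w Hw) as Nw.
    set (a := cpow w (- lam)) in *; set (b := cpow w lam) in *; set (u := cauchy_kernel w).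
    replace (_ - _)%C with (lam * (u * u) * (1 - a * b))%C by (field; exact Nw).
    rewrite I; ring. }
assert (CQ : forall a b, U a -> U b -> Q a = Q b).
{ apply bloch_le_0_constant; [apply (holomorphic_U_intro _ _ DQ)|].
  intros w Hw; rewrite (is_C_derive_unique Q w _ (DQ w Hw)), Cmod_0; lra. }
set (e := exp (Rabs (Im lam) * PI)).
assert (e1 : 0 < e) by apply exp_pos.
pose proof (proj1 (Cmod_gt_0 lam) Nl) as Pl.
(* Powers w^(lam) and w^(-lam) cost a factor e each. With w f' and h both at most |lam|/(16 e), each
   end contributes at most |lam|/8, against a jump of at least |lam|/2; the further division by e
   makes h that small. *)
assert (H1 : 0 < Cmod lam / (16 * e)) by (apply Rdiv_lt_0_compat; lra).
assert (H2 : 0 < Cmod lam / (16 * e) / e) by (apply Rdiv_lt_0_compat; lra).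
destruct (axis_derivative_small f _ _ (proj1 G) H1 H2) as [y [Hy [Hy3 [B1 B2]]]].
pose proof (cauchy_kernel_axis y ltac:(lra)) as B3.
assert (Hy' : 0 < / y) by (apply Rinv_0_lt_compat; lra).
assert (U1 : U (0, y)%R) by (unfold U; simpl; lra).
assert (U2 : U (0, / y)%R) by (unfold U; simpl; lra).
assert (Bd : forall w, U w -> Cmod (w * C_derive f w) <= Cmod lam / (16 * e) ->
  Cmod w * Cmod (cauchy_kernel w) ^ 2 <= y ->
  Cmod (cpow w (- lam) * (lam * f w + c)) <= Cmod lam / 8).
{ intros w Hw D1 D2; rewrite Eq, Cmod_mult by exact Hw.
  assert (P1 : Cmod (cpow w (- lam)) <= e).
  { unfold e; rewrite <- (Rabs_Ropp (Im lam)).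
    replace (- Im lam) with (Im (- lam)%C) by reflexivity.
    apply Cmod_cpow_imaginary; simpl; unfold Re in Hl; lra. }
  assert (P2 : Cmod (resonant lam w) <= e * y).
  { unfold resonant; rewrite !Cmod_mult.
    apply Rmult_le_compat; try apply Cmod_ge_0.
    - apply Rmult_le_pos; [|apply Rmult_le_pos]; apply Cmod_ge_0.
    - apply Cmod_cpow_imaginary, Hl.
    - simpl in D2; lra. }
  assert (P3 : e * y <= Cmod lam / (16 * e)).
  { replace (Cmod lam / (16 * e)) with (e * (Cmod lam / (16 * e) / e)) by (field; lra).
    apply Rmult_le_compat_l; lra. }
  apply Rle_trans with (e * (Cmod lam / (16 * e) + Cmod lam / (16 * e))).
  - apply Rmult_le_compat; try apply Cmod_ge_0; [exact P1|].
    eapply Rle_trans; [apply Cmod_triangle|]; lra.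
  - right; field; lra. }
assert (CM : forall t, 0 < t -> Cmod (0, t)%R = t).
{ intros t Ht; replace (0, t)%R with (Ci * RtoC t)%C
    by (apply injective_projections; simpl; ring).
  rewrite Cmod_mult, Cmod_Ci, Cmod_R, Rabs_pos_eq; lra. }
assert (Q1 := Bd _ U1 B1).
assert (Q2 := Bd _ U2 B2).
rewrite !CM in Q1, Q2 by lra.
destruct (Cmod_cauchy_kernel _ U1) as [K1 [K2 K3]]; rewrite CM in K2, K3 by lra.
destruct (Cmod_cauchy_kernel _ U2) as [L1 [L2 L3]]; rewrite CM in L2, L3 by lra.
rewrite Rinv_inv in L2.
pose proof (Cmod_ge_0 (cauchy_kernel (0, y)%R)); pose proof (Cmod_ge_0 (cauchy_kernel (0, / y)%R)).
set (c1 := Cmod (cauchy_kernel (0, y)%R)) in *; set (c2 := Cmod (cauchy_kernel (0, / y)%R)) in *.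
assert (S1 : y * c1 ^ 2 <= y).
{ assert (c1 ^ 2 <= 1) by (simpl; nra).
  apply Rle_trans with (y * 1); [apply Rmult_le_compat_l; lra|lra]. }
assert (S2 : / y * c2 ^ 2 <= y).
{ replace (/ y * c2 ^ 2) with ((/ y * c2) * c2) by ring.
  rewrite <- (Rmult_1_l y) at 2; apply Rmult_le_compat; try lra.
  apply Rmult_le_pos; lra. }
specialize (Q1 S1); specialize (Q2 S2).
pose proof (CQ _ _ U1 U2) as EQ; unfold Q in EQ.
set (a1 := (cpow (0, y)%R (- lam) * (lam * f (0, y)%R + c))%C) in *.
set (a2 := (cpow (0, / y)%R (- lam) * (lam * f (0, / y)%R + c))%C) in *.
set (u1 := cauchy_kernel (0, y)%R) in *; set (u2 := cauchy_kernel (0, / y)%R) in *.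
assert (Z : (lam * (u1 - u2) = a1 + - a2)%C).
{ replace a1 with ((a1 - lam * u1) + lam * u1)%C by ring; rewrite EQ; ring. }
apply (f_equal Cmod) in Z; rewrite Cmod_mult in Z.
pose proof (Cmod_triangle a1 (- a2)) as T; rewrite Cmod_opp in T.
assert (Cmod lam * (1 / 2) <= Cmod lam * Cmod (u1 - u2)) by (apply Rmult_le_compat_l; lra).
lra.
Qed.

Lemma resolvent_set_Re_neq_0 (lam : C) :
  resolvent_set (little_bloch_i to_boundary) (generator to_boundary) lam -> Re lam <> 0.
Proof.
intros H E; destruct (classic (lam = 0%C)) as [->|N].
- exact (zero_not_in_resolvent_set H).
- exact (imaginary_axis_not_in_resolvent_set lam N E H).
Qed.

(** The factor 1/(w+i) gives e^{iw} just enough decay at infinity to enter the space, but Gamma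
    multiplies the derivative by w and destroys that decay: the derivative of the image behaves like
    - e^{iw} along horizontal lines. *)
Definition damped_wave (w : C) : C := (cexp (Ci * w) * cauchy_kernel w)%C.

Definition damped_wave' (w : C) : C :=
  (cexp (Ci * w) * (Ci * cauchy_kernel w - cauchy_kernel w * cauchy_kernel w))%C.

Lemma is_Cderive_damped_wave (w : C) : U w -> is_Cderive damped_wave w (damped_wave' w).
Proof.
intros Hw; unfold damped_wave.
eapply is_Cderive_eq; [apply (is_Cderive_mult (fun z => cexp (Ci * z)) cauchy_kernel)|].
- apply is_Cderive_cexp_Ci.
- apply is_Cderive_cauchy_kernel, Hw.
- unfold damped_wave'; ring.
Qed.

Lemma damped_wave_little_bloch :
  little_bloch_i to_boundary (fun z => damped_wave z - damped_wave Ci)%C.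
Proof.
apply (little_bloch_of_decay _ _ 2 is_Cderive_damped_wave).
intros w Hw; unfold damped_wave'.
set (u := cauchy_kernel w).
destruct (Cmod_cauchy_kernel w Hw) as [H1 [H2 H3]]; fold u in H1, H2, H3.
pose proof (Cmod_ge_0 u) as Pu.
pose proof (mul_exp_opp_le_1 (Im w)) as M1.
pose proof (exp_opp_lt_1 _ Hw) as M2; pose proof (exp_pos (- Im w)) as M3.
unfold U in Hw.
assert (B : Im w * Cmod (cexp (Ci * w) * (Ci * u - u * u)) <= (Im w * exp (- Im w)) * (2 * Cmod u)).
{ rewrite Cmod_mult, Cmod_cexp_Ci, Rmult_assoc.
  apply Rmult_le_compat_l; [lra|]; apply Rmult_le_compat_l; [lra|].
  replace (Ci * u - u * u)%C with (Ci * u + - (u * u))%C by ring.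
  eapply Rle_trans; [apply Cmod_triangle|].
  rewrite Cmod_opp, !Cmod_mult, Cmod_Ci; nra. }
assert (M4 : 0 <= Im w * exp (- Im w)) by (apply Rmult_le_pos; lra).
split; apply Rle_trans with (1 := B).
- apply Rle_trans with ((Im w * 1) * (2 * 1)); [|lra].
  apply Rmult_le_compat; try lra; apply Rmult_le_compat_l; lra.
- unfold Rdiv; rewrite <- (Rmult_1_l (2 * / Cmod w)).
  apply Rmult_le_compat; lra.
Qed.

Lemma damped_wave_not_in_domain (k : C -> C) :
  ~ generator to_boundary (fun z => damped_wave z - damped_wave Ci)%C k.
Proof.
intros G.
pose proof (proj1 (proj2 G)) as Xk.
pose proof (little_bloch_i_holomorphic _ _ Xk) as Ok.
assert (E : forall w, U w -> C_derive (fun z => damped_wave z - damped_wave Ci)%C w = damped_wave' w).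
{ intros w Hw; apply is_C_derive_unique.
  eapply is_Cderive_eq.
  - apply is_Cderive_minus; [apply is_Cderive_damped_wave, Hw|apply is_Cderive_const].
  - ring. }
assert (Ek : eqU (fun w => w * damped_wave' w - Ci * damped_wave' Ci)%C k).
{ intros w Hw; rewrite (generator_value _ _ k w G Hw), !E by (auto; apply U_Ci); reflexivity. }
assert (Dk : forall w, U w -> C_derive k w = (cexp (Ci * w) * (- (1 +
  (cauchy_kernel w * cauchy_kernel w + 2 * Ci * (cauchy_kernel w * (cauchy_kernel w * cauchy_kernel w))))))%C).
{ intros w Hw; apply is_C_derive_unique.
  apply (is_Cderive_ext_U _ _ w _ Hw Ek).
  eapply is_Cderive_eq.
  - apply is_Cderive_minus; [|apply is_Cderive_const].
    apply (is_Cderive_mult (fun z => z) damped_wave'); [apply is_Cderive_id|].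
    apply (is_Cderive_mult (fun z => cexp (Ci * z))
      (fun z => Ci * cauchy_kernel z - cauchy_kernel z * cauchy_kernel z)%C).
    + apply is_Cderive_cexp_Ci.
    + apply is_Cderive_minus; [apply is_Cderive_scal|apply is_Cderive_mult];
        apply is_Cderive_cauchy_kernel, Hw.
  - unfold damped_wave'.
    pose proof (plus_Ci_neq_0 w Hw) as N.
    set (u := cauchy_kernel w).
    (* This relation and i^2 = -1 eliminate w, leaving a polynomial in u whose constant term is what
       does not decay. *)
    assert (Eu : (w * u = 1 - Ci * u)%C) by (unfold u, cauchy_kernel; field; exact N).
    assert (I : (Ci * Ci = - (1))%C) by (apply injective_projections; simpl; ring).
    set (e := cexp (Ci * w)).
    replace (_ - _)%C with (e * ((Ci * u - u * u) + ((Ci * Ci - 2 * Ci * u + 2 * (u * u)) * (w * u))))%C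
      by ring.
    rewrite Eu.
    replace ((Ci * u - u * u + (Ci * Ci - 2 * Ci * u + 2 * (u * u)) * (1 - Ci * u)))%C
      with (Ci * u - u * u + (Ci * Ci - 2 * Ci * u + 2 * (u * u) - (Ci * Ci) * (Ci * u)
        + 2 * (Ci * Ci) * (u * u) - 2 * Ci * (u * (u * u))))%C by ring.
    rewrite I; ring. }
pose proof (proj1 (little_bloch_i_iff _ to_boundary_boundary_filter k) Xk) as [_ [_ [L _]]].
pose proof (exp_pos (- (1))) as Pe.
destruct (L (exp (- (1)) / 4) ltac:(lra)) as [d Hd].
pose proof (cond_pos d) as Pd.
pose proof (Rinv_0_lt_compat _ Pd) as Pd'.
(* The term 1/d puts w in the neighbourhood of infinity and the 2 forces |u| <= 1/2, hence |q| <=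
   1/4 + 2/8. At height 1 the quantity is then at least e^{-1}/2, above the e^{-1}/4 allowed. *)
set (w := (2 + / d, 1) : C).
assert (Hw : U w) by (unfold U; simpl; lra).
assert (Cw : 2 + / d <= Cmod w).
{ eapply Rle_trans; [|apply re_le_Cmod]; apply Rle_abs. }
specialize (Hd w Hw ltac:(right; lra)).
rewrite Dk in Hd by exact Hw.
set (u := cauchy_kernel w) in *.
destruct (Cmod_cauchy_kernel w Hw) as [_ [H2 _]]; fold u in H2.
assert (Hu : Cmod u <= / 2).
{ apply Rle_trans with (1 := H2); apply Rinv_le_contravar; lra. }
pose proof (Cmod_ge_0 u) as Pu.
rewrite Cmod_mult, Cmod_cexp_Ci, Cmod_opp in Hd.
change (Im w) with 1 in Hd.
set (q := (u * u + 2 * Ci * (u * (u * u)))%C) in *.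
assert (Bq : Cmod q <= / 2).
{ unfold q; eapply Rle_trans; [apply Cmod_triangle|].
  rewrite !Cmod_mult, Cmod_Ci, Cmod_R, Rabs_pos_eq by lra.
  assert (Cmod u * Cmod u <= / 2 * / 2) by (apply Rmult_le_compat; lra).
  assert (Cmod u * (Cmod u * Cmod u) <= / 2 * (/ 2 * / 2)).
  { apply Rmult_le_compat; try lra; apply Rmult_le_pos; lra. }
  lra. }
pose proof (Cmod_sub_le 1 (- q)) as T.
replace (1 - - q)%C with (1 + q)%C in T by ring.
rewrite Cmod_opp, Cmod_1 in T.
assert (exp (- (1)) * / 2 <= exp (- (1)) * Cmod (1 + q)) by (apply Rmult_le_compat_l; lra).
lra.
Qed.

(** * The integral formulas *)

Lemma exp_opp_dominates_linear (a A D eps : R) : 0 < a -> 0 <= A -> 0 <= D -> 0 < eps ->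
  exists S : R, 0 < S /\ forall s, S <= s -> exp (- (a * s)) * (A + D * s) <= eps.
Proof.
intros Ha HA HD He.
(* With x = a s / 2, A + D s <= K (1 + x), while e^{as} = (e^x)^2 >= x (1 + x); the threshold on s
   is where eps x reaches K. *)
set (K := 1 + A + 2 * D / a).
assert (HK : 1 <= K).
{ unfold K; assert (0 <= 2 * D / a); [|lra].
  apply Rmult_le_pos; [lra|apply Rlt_le, Rinv_0_lt_compat, Ha]. }
exists (2 * K / (a * eps)).
assert (Pa : 0 < a * eps) by (apply Rmult_lt_0_compat; assumption).
assert (PS : 0 < 2 * K / (a * eps)) by (apply Rdiv_lt_0_compat; lra).
split; [exact PS|]; intros s Hs.
set (x := a * s / 2).
assert (Hs0 : 0 < s) by lra.
assert (Hx : 0 < x) by (unfold x; pose proof (Rmult_lt_0_compat _ _ Ha Hs0); lra).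
assert (Kx : K <= eps * x).
{ apply (Rmult_le_compat_l (a * eps / 2)) in Hs; [|lra].
  replace (a * eps / 2 * (2 * K / (a * eps))) with K in Hs by (field; lra).
  unfold x; lra. }
assert (E : exp (a * s) = exp x * exp x).
{ rewrite <- exp_plus; f_equal; unfold x; field. }
pose proof (exp_ineq1 x ltac:(lra)) as B.
assert (L : A + D * s <= K * x + K).
{ replace (K * x + K) with (K + A * x + x + D * s) by (unfold K, x; field; lra).
  assert (0 <= A * x) by (apply Rmult_le_pos; lra).
  assert (0 <= 2 * D / a).
  { apply Rmult_le_pos; [lra|apply Rlt_le, Rinv_0_lt_compat, Ha]. }
  unfold K; lra. }
rewrite exp_Ropp, E.
assert (0 < exp x) by apply exp_pos.
apply Rmult_le_reg_l with (exp x * exp x); [apply Rmult_lt_0_compat; assumption|].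
rewrite <- Rmult_assoc, Rinv_r, Rmult_1_l by nra.
apply Rle_trans with (1 := L).
replace (K * x + K) with (K * (1 + x)) by ring.
apply Rle_trans with ((eps * x) * (1 + x)); [apply Rmult_le_compat_r; lra|].
replace ((eps * x) * (1 + x)) with (x * (1 + x) * eps) by ring.
apply Rmult_le_compat_r; [lra|nra].
Qed.

Lemma locally_Cmod (v : C) (P : C -> Prop) :
  locally v P -> exists eps : R, 0 < eps /\ forall z, Cmod (z - v) < eps -> P z.
Proof.
intros [e He]; exists e; split; [apply cond_pos|].
intros z Hz; apply He, C_NormedModule_mixin_compat1, Hz.
Qed.

(* Everything on the ray z = e^s w is the restriction to real zeta of a function of the complex
   variable zeta, with z = e^zeta w. *)
Lemma is_Cderive_ray (f : C -> C) (w : C) (s : R) : holomorphic_U f -> U w ->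
  is_Cderive (fun z => f (cexp z * w)%C) (RtoC s) (C_derive f (exp s * w) * (exp s * w))%C.
Proof.
intros Of Hw.
apply (is_Cderive_comp f (fun z => cexp z * w)%C).
- rewrite cexp_RtoC; apply C_derive_U; [exact Of|apply U_dilation, Hw].
- rewrite <- cexp_RtoC.
  eapply is_Cderive_eq.
  + apply (is_Cderive_mult cexp (fun _ => w)); [apply is_Cderive_cexp|apply is_Cderive_const].
  + ring.
Qed.

Lemma is_Cderive_cexp_scal (a z : C) :
  is_Cderive (fun z => cexp (a * z)) z (a * cexp (a * z))%C.
Proof.
eapply is_Cderive_eq; [apply (is_Cderive_comp cexp (fun z => a * z)%C)|].
- apply is_Cderive_cexp.
- apply is_Cderive_scal, is_Cderive_id.
- ring.
Qed.

(** The s-derivative of f(e^s w) is z f'(z), and |z|/Im z is constant along the ray; so f grows at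
    most linearly in s, which the factor e^{-lam s} will beat. *)
Lemma bloch_ray_growth (f : C -> C) (N : R) (w : C) (s : R) :
  holomorphic_U f -> bloch_le f N -> U w ->
  Cmod (f (exp s * w)%C - f w) <= N / Im w * Cmod w * Rabs s.
Proof.
intros Of HN Hw.
assert (B : forall t, is_Cderive (fun z => f (cexp z * w)%C) (RtoC t)
    (C_derive f (exp t * w) * (exp t * w))%C /\
  Cmod (C_derive f (exp t * w) * (exp t * w)) <= N / Im w * Cmod w).
{ intros t; split; [apply is_Cderive_ray; assumption|].
  pose proof (bloch_dilation_bound f N t w HN Hw) as H.
  rewrite Cmod_mult, Cmod_dilation; rewrite Cmod_dilation in H.
  unfold U in Hw.
  replace (Cmod (C_derive f (exp t * w)) * (exp t * Cmod w))
    with (exp t * Cmod (C_derive f (exp t * w)) * Cmod w) by ring.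
  apply Rmult_le_compat_r; [apply Cmod_ge_0|].
  apply Rmult_le_reg_l with (Im w); [exact Hw|].
  replace (Im w * (N / Im w)) with N by (field; lra); exact H. }
assert (E0 : f (cexp (RtoC 0) * w)%C = f w) by (rewrite cexp_0, Cmult_1_l; reflexivity).
assert (Es : f (cexp (RtoC s) * w)%C = f (exp s * w)%C) by (rewrite cexp_RtoC; reflexivity).
destruct (Rle_dec 0 s) as [L|L].
- pose proof (Cderive_real_mean_value _ (fun z => C_derive f (exp (Re z) * w) * (exp (Re z) * w))%C
    _ 0 s L (fun t _ => B t)) as M; cbv beta in M.
  rewrite E0, Es in M; rewrite Rabs_pos_eq by exact L; lra.
- pose proof (Cderive_real_mean_value _ (fun z => C_derive f (exp (Re z) * w) * (exp (Re z) * w))%C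
    _ s 0 ltac:(lra) (fun t _ => B t)) as M; cbv beta in M.
  rewrite E0, Es, Cmod_minus_sym in M; rewrite Rabs_left by lra; lra.
Qed.

Definition ray_primitive (lam c : C) (f : C -> C) (w z : C) : C :=
  (- (/ cpow w lam * (cexp (- lam * z) * (f (cexp z * w) + c))))%C.

(** Along the ray z^(-lam-1) dz = w^(-lam) e^{-lam s} ds, which explains the prefactor. As h = lam f
    - z f' + i f'(i), the shift of f by i f'(i)/lam absorbs the constant. *)
Lemma is_RInt_ray (F : (C -> Prop) -> Prop) (lam : C) (f k h : C -> C) (w : C) (a b : R) :
  lam <> 0%C -> generator F f k -> eqU h (fun w => lam * f w - k w)%C ->
  holomorphic_U h -> U w ->
  @is_RInt C_R_NormedModule
    (fun s : R => (/ cpow (exp s * w) (lam + 1) * h (exp s * w)) * (exp s * w))%C a b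
    (ray_primitive lam (Ci * C_derive f Ci / lam) f w b -
     ray_primitive lam (Ci * C_derive f Ci / lam) f w a)%C.
Proof.
intros Nl G Eh Oh Hw.
pose proof (little_bloch_i_holomorphic F _ (proj1 G)) as Of.
set (c := (Ci * C_derive f Ci / lam)%C).
set (g := fun z => (/ cpow w lam * (cexp (- lam * z) * h (cexp z * w)))%C).
apply (is_RInt_ext (fun s : R => g (RtoC s))).
{ intros s _; unfold g.
  pose proof (U_dilation s w Hw) as Us.
  pose proof (cpow_neq_0 w lam) as N1; pose proof (U_neq_0 _ Us) as N2.
  rewrite cpow_plus, cpow_1, cpow_dilation, cexp_RtoC by assumption.
  replace (- lam * s)%C with (- (lam * s))%C by ring.
  rewrite cexp_opp; pose proof (cexp_neq_0 (lam * s)) as N3.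
  set (x := (exp s * w)%C) in *.
  match goal with |- @eq _ ?l ?r => change (@eq C l r) end.
  field; auto. }
apply (@is_RInt_derive C_R_CompleteNormedModule (fun s : R => ray_primitive lam c f w s)
  (fun s : R => g (RtoC s))).
- intros s _.
  apply (is_derive_Cderive_real (ray_primitive lam c f w)).
  unfold ray_primitive.
  eapply is_Cderive_eq.
  + apply is_Cderive_opp, is_Cderive_scal.
    apply (is_Cderive_mult (fun z => cexp (- lam * z)) (fun z => f (cexp z * w) + c)%C).
    * apply is_Cderive_cexp_scal.
    * apply is_Cderive_plus; [apply is_Cderive_ray; assumption|apply is_Cderive_const].
  + unfold g; rewrite cexp_RtoC.
    pose proof (U_dilation s w Hw) as Us.
    rewrite (Eh _ Us), (generator_value F f k _ G Us).
    unfold c; field; split; [apply cpow_neq_0|exact Nl].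
- intros s _.
  apply (@ex_derive_continuous R_AbsRing C_R_NormedModule (fun s : R => g (RtoC s))).
  eexists; apply is_derive_Cderive_real; unfold g.
  apply is_Cderive_scal.
  apply (is_Cderive_mult (fun z => cexp (- lam * z)) (fun z => h (cexp z * w))%C).
  + apply is_Cderive_cexp_scal.
  + apply is_Cderive_ray; assumption.
Qed.

(** The condition 0 < Re lam * s covers both formulas at once: s goes to +infinity or to -infinity
    according to the sign of Re lam. *)
Lemma ray_primitive_small (lam c : C) (f : C -> C) (N : R) (w : C) (eps : R) :
  holomorphic_U f -> bloch_le f N -> U w -> Re lam <> 0 -> 0 < eps ->
  exists S : R, 0 < S /\ forall s : R, 0 < Re lam * s -> S <= Rabs s ->
    Cmod (ray_primitive lam c f w s) <= eps.
Proof.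
intros Of HN Hw Hl He.
pose proof (bloch_le_pos f N HN) as N0.
pose proof (proj1 (Cmod_gt_0 _) (cpow_neq_0 w lam)) as Pc.
set (P := Cmod (cpow w lam)) in *.
assert (Pl : 0 < Rabs (Re lam)) by (apply Rabs_pos_lt, Hl).
assert (PD : 0 <= N / Im w * Cmod w).
{ apply Rmult_le_pos; [|apply Cmod_ge_0].
  apply Rmult_le_pos; [exact N0|apply Rlt_le, Rinv_0_lt_compat, Hw]. }
destruct (exp_opp_dominates_linear (Rabs (Re lam)) (Cmod (f w + c)) _ (eps * P) Pl
  (Cmod_ge_0 _) PD ltac:(apply Rmult_lt_0_compat; assumption)) as [S [S0 HS]].
exists S; split; [exact S0|]; intros s Hs1 Hs2.
specialize (HS (Rabs s) Hs2).
unfold ray_primitive.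
rewrite Cmod_opp, Cmod_mult, Cmod_mult, Cmod_inv, Cmod_cexp, cexp_RtoC by apply cpow_neq_0.
fold P.
replace (Re (- lam * s)%C) with (- (Rabs (Re lam) * Rabs s)).
2: { rewrite <- Rabs_mult, Rabs_pos_eq by lra; unfold Re; simpl; ring. }
apply Rmult_le_reg_l with P; [exact Pc|].
rewrite <- Rmult_assoc, Rinv_r, Rmult_1_l by lra.
rewrite (Rmult_comm P).
eapply Rle_trans; [|exact HS].
apply Rmult_le_compat_l; [apply Rlt_le, exp_pos|].
replace (f (exp s * w)%C + c)%C with ((f w + c) + (f (exp s * w)%C - f w))%C by ring.
eapply Rle_trans; [apply Cmod_triangle|].
apply Rplus_le_compat_l, bloch_ray_growth; assumption.
Qed.

Lemma ray_primitive_0 (lam c : C) (f : C -> C) (w : C) :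
  ray_primitive lam c f w 0 = (- (/ cpow w lam * (f w + c)))%C.
Proof.
unfold ray_primitive; rewrite Cmult_0_r, cexp_0, Cmult_1_l, Cmult_1_l; reflexivity.
Qed.

Lemma resolvent_integral_to_infty (F : (C -> Prop) -> Prop) (HF : boundary_filter F)
  (lam : C) (f h : C -> C) (w : C) :
  0 < Re lam -> scalar_minus lam (generator F) f h -> U w ->
  is_int_to_infty (fun z => / cpow z (lam + 1) * h z)%C w
    (/ cpow w lam * (f w + Ci * C_derive f Ci / lam))%C.
Proof.
intros Hl H Hw.
pose proof (little_bloch_i_holomorphic F _ (scalar_minus_domain F HF _ _ _ H)) as Oh.
destruct H as [k [G Eh]].
pose proof (little_bloch_i_holomorphic F _ (proj1 G)) as Of.
destruct (little_bloch_i_bounded F HF f (proj1 G)) as [N HN].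
assert (Nl : lam <> 0%C) by (intros E; rewrite E in Hl; simpl in Hl; lra).
intros P HP; apply locally_Cmod in HP; destruct HP as [eps [He HP]].
destruct (ray_primitive_small lam (Ci * C_derive f Ci / lam) f N w (eps / 2) Of HN Hw
  ltac:(lra) ltac:(lra)) as [S [S0 HS]].
apply (Filter_prod _ _ _ (fun a => a = 0) (fun b => S < b)).
- reflexivity.
- exists S; auto.
- intros a b -> Hb; eexists; split; [apply (is_RInt_ray F lam f k h); assumption|].
  apply HP; cbn [fst snd]; rewrite ray_primitive_0.
  set (x := ray_primitive lam (Ci * C_derive f Ci / lam) f w b).
  replace (_ - _)%C with x by ring.
  apply Rle_lt_trans with (eps / 2); [|lra].
  apply HS; [apply Rmult_lt_0_compat; lra|rewrite Rabs_pos_eq; lra].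
Qed.

Lemma resolvent_integral_from_0 (F : (C -> Prop) -> Prop) (HF : boundary_filter F)
  (lam : C) (f h : C -> C) (w : C) :
  Re lam < 0 -> scalar_minus lam (generator F) f h -> U w ->
  is_int_from_0 (fun z => / cpow z (lam + 1) * h z)%C w
    (- (/ cpow w lam * (f w + Ci * C_derive f Ci / lam)))%C.
Proof.
intros Hl H Hw.
pose proof (little_bloch_i_holomorphic F _ (scalar_minus_domain F HF _ _ _ H)) as Oh.
destruct H as [k [G Eh]].
pose proof (little_bloch_i_holomorphic F _ (proj1 G)) as Of.
destruct (little_bloch_i_bounded F HF f (proj1 G)) as [N HN].
assert (Nl : lam <> 0%C) by (intros E; rewrite E in Hl; simpl in Hl; lra).
intros P HP; apply locally_Cmod in HP; destruct HP as [eps [He HP]].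
destruct (ray_primitive_small lam (Ci * C_derive f Ci / lam) f N w (eps / 2) Of HN Hw
  ltac:(lra) ltac:(lra)) as [S [S0 HS]].
apply (Filter_prod _ _ _ (fun a => a < - S) (fun b => b = 0)).
- exists (- S); auto.
- reflexivity.
- intros a b Ha ->; eexists; split; [apply (is_RInt_ray F lam f k h); assumption|].
  apply HP; cbn [fst snd]; rewrite ray_primitive_0.
  set (x := ray_primitive lam (Ci * C_derive f Ci / lam) f w a).
  replace (_ - _)%C with (- x)%C by ring.
  rewrite Cmod_opp; apply Rle_lt_trans with (eps / 2); [|lra].
  apply HS; [|rewrite Rabs_left; lra].
  replace (Re lam * a) with (- Re lam * - a) by ring; apply Rmult_lt_0_compat; lra.
Qed.

Lemma normalization_of_shift (f : C -> C) (c : C) : f Ci = 0%C ->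
  normalization_of (fun w => f w + c)%C f.
Proof. intros H w _; rewrite H; ring. Qed.

(** * Spectrum, spectral radius and norm of the resolvent *)

(** The circle passes through 0 and has 1/a as the opposite point; for w <> 0 its equation says Re
    (1/w) = a, so that it is the inverse of a vertical line. *)
Lemma spectral_circle (a : R) (w : C) : a <> 0 ->
  Cmod (w - RtoC (1 / (2 * a)))%C = 1 / (2 * Rabs a) <-> a * Cmod w ^ 2 = Re w.
Proof.
intros Ha.
assert (Pa : 0 < Rabs a) by (apply Rabs_pos_lt, Ha).
assert (E1 : Cmod (w - RtoC (1 / (2 * a))) ^ 2 = Cmod w ^ 2 - Re w / a + (1 / (2 * Rabs a)) ^ 2).
{ rewrite !Cmod2_alt.
  replace ((1 / (2 * Rabs a)) ^ 2) with (1 / (4 * Rabs a ^ 2)) by (field; lra).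
  rewrite pow2_abs; unfold Re, Im; simpl; field; exact Ha. }
split; intros H.
- rewrite H in E1.
  assert (E2 : Cmod w ^ 2 = Re w / a) by lra.
  rewrite E2; field; exact Ha.
- assert (E2 : Cmod w ^ 2 = Re w / a) by (rewrite <- H; field; exact Ha).
  apply Rsqr_inj; [apply Cmod_ge_0| |].
  + apply Rlt_le, Rdiv_lt_0_compat; lra.
  + rewrite !Rsqr_pow2, E1, E2; ring.
Qed.

Lemma Re_minus_inv (lam w : C) : w <> 0%C ->
  Re (lam - / w)%C = 0 <-> Re lam * Cmod w ^ 2 = Re w.
Proof.
intros Nw; pose proof (proj1 (Cmod_gt_0 w) Nw) as P.
assert (P2 : 0 < Cmod w ^ 2) by (apply pow_lt, P).
assert (E : Re (lam - / w)%C = Re lam - Re w / Cmod w ^ 2).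
{ rewrite Cmod2_alt; unfold Re, Im; simpl; unfold Rminus; ring. }
rewrite E; split; intros H.
- assert (E2 : Re lam = Re w / Cmod w ^ 2) by lra.
  rewrite E2; field; lra.
- rewrite <- H; field; lra.
Qed.

Lemma resolvent_spectrum (lam w : C) :
  resolvent_set (little_bloch_i to_boundary) (generator to_boundary) lam ->
  spectrum (little_bloch_i to_boundary) (resolvent lam (generator to_boundary)) w <->
  Cmod (w - RtoC (1 / (2 * Re lam)))%C = 1 / (2 * Rabs (Re lam)).
Proof.
intros Hlam; pose proof to_boundary_boundary_filter as HF.
pose proof (resolvent_set_Re_neq_0 lam Hlam) as Hl.
rewrite spectral_circle by exact Hl.
destruct (classic (w = 0%C)) as [->|Nw].
- rewrite Cmod_0; split; [intros _; simpl; ring|].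
  (* If 0 were in the resolvent set, every element of the space would be, up to sign, in the range
     of the resolvent, which is the domain of the generator. *)
  intros _ [Hs _].
  destruct (Hs _ damped_wave_little_bloch) as [f [g [[k [G _]] E]]].
  apply (damped_wave_not_in_domain (fun w => -1 * k w)%C).
  apply (generator_ext _ HF (fun w => -1 * g w)%C (fun w => -1 * k w)%C);
    [|intros z _; reflexivity|apply generator_scal; assumption].
  intros z Hz; rewrite (E z Hz); ring.
- rewrite <- Re_minus_inv by exact Nw.
  unfold spectrum; rewrite (resolvent_set_resolvent_iff _ HF lam w Hlam Nw).
  split.
  + intros H; apply NNPP; intros N; apply H.
    apply (resolvent_set_off_imaginary_axis lam); assumption.
  + intros H Hr; exact (resolvent_set_Re_neq_0 _ Hr H).
Qed.

(** This is the point of the circle farthest from 0, the image of mu = i Im lam under mu -> 1/(lam -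
    mu). *)
Lemma inv_Re_in_spectrum (lam : C) :
  resolvent_set (little_bloch_i to_boundary) (generator to_boundary) lam ->
  spectrum (little_bloch_i to_boundary) (resolvent lam (generator to_boundary))
    (RtoC (1 / Re lam)) /\ Cmod (RtoC (1 / Re lam)) = 1 / Rabs (Re lam).
Proof.
intros Hlam; pose proof (resolvent_set_Re_neq_0 lam Hlam) as Hl.
split.
- apply resolvent_spectrum; [exact Hlam|].
  apply spectral_circle; [exact Hl|].
  rewrite Cmod_R, pow2_abs; simpl; field; exact Hl.
- rewrite Cmod_R; unfold Rdiv; rewrite Rabs_mult, Rabs_inv, Rabs_R1; reflexivity.
Qed.

Lemma resolvent_spectral_radius (lam : C) :
  resolvent_set (little_bloch_i to_boundary) (generator to_boundary) lam ->
  spectral_radius (little_bloch_i to_boundary) (resolvent lam (generator to_boundary)) =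
    Finite (1 / Rabs (Re lam)).
Proof.
intros Hlam; pose proof (resolvent_set_Re_neq_0 lam Hlam) as Hl.
assert (Pl : 0 < Rabs (Re lam)) by (apply Rabs_pos_lt, Hl).
apply is_lub_Rbar_unique; split.
- intros x [w [Hw ->]]; apply resolvent_spectrum in Hw; [|exact Hlam]; simpl.
  replace w with ((w - RtoC (1 / (2 * Re lam))) + RtoC (1 / (2 * Re lam)))%C by ring.
  eapply Rle_trans; [apply Cmod_triangle|].
  rewrite Hw, Cmod_R; unfold Rdiv.
  rewrite Rabs_mult, Rabs_inv, Rabs_mult, Rabs_R1, (Rabs_pos_eq 2) by lra.
  right; field; lra.
- intros b Hb; apply Hb.
  destruct (inv_Re_in_spectrum lam Hlam) as [H1 H2].
  exists (RtoC (1 / Re lam)); split; [exact H1|symmetry; exact H2].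
Qed.

Lemma bloch_le_scal (a : C) (f : C -> C) (M : R) :
  holomorphic_U f -> bloch_le f M -> bloch_le (fun z => a * f z + 0 * f z)%C (Cmod a * M).
Proof.
intros Of HM; replace (Cmod a * M) with (Cmod a * M + Cmod 0 * M) by (rewrite Cmod_0; ring).
apply bloch_le_lin; assumption.
Qed.

(** For the lower bound, a smaller upper bound b would by homogeneity bound the operator, and
    Neumann's series would expel the spectral point 1/Re lam from the spectrum. *)
Lemma resolvent_op_norm (lam : C) :
  resolvent_set (little_bloch_i to_boundary) (generator to_boundary) lam ->
  op_norm (resolvent lam (generator to_boundary)) = Finite (1 / Rabs (Re lam)).
Proof.
intros Hlam; pose proof to_boundary_boundary_filter as HF.
pose proof (resolvent_set_Re_neq_0 lam Hlam) as Hl.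
assert (Pl : 0 < Rabs (Re lam)) by (apply Rabs_pos_lt, Hl).
pose proof (resolvent_bounded_operator lam Hl Hlam) as HT.
apply is_lub_Rbar_unique; split.
- intros x [h [f [H [H1 Hx]]]].
  apply bloch_norm_le in H1.
  assert (B : Rbar_le (bloch_norm f) (/ Rabs (Re lam) * 1)).
  { apply bloch_norm_le, (bop_bound _ _ _ HT h); assumption. }
  rewrite Hx in B; simpl in B |- *; lra.
- intros b Hb.
  apply Rbar_not_lt_le; intros L.
  (* The image of the zero function shows that the set of norms is not empty and contains a
     nonnegative number. *)
  assert (B0 : Rbar_le 0 b).
  { pose proof (little_bloch_i_scal _ HF 0 _ cauchy_kernel_little_bloch) as X0.
    destruct (bop_total _ _ _ HT _ X0) as [f Hf].
    assert (Z : bloch_le (fun w => 0 * (cauchy_kernel w - cauchy_kernel Ci))%C 1).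
    { intros w Hw.
      assert (D : C_derive (fun w => 0 * (cauchy_kernel w - cauchy_kernel Ci))%C w = 0%C).
      { apply is_C_derive_unique, (is_Cderive_ext_U (fun _ => 0%C)); [exact Hw| |].
        - intros z _; ring.
        - apply is_Cderive_const. }
      rewrite D, Cmod_0; lra. }
    pose proof (bop_bound _ _ _ HT _ _ _ Hf Z) as Bf.
    destruct (bloch_norm_finite _ _ Bf) as [x Hx].
    apply Rbar_le_trans with (Finite x).
    - apply (bloch_le_pos f); apply bloch_norm_le; rewrite Hx; apply Rle_refl.
    - apply Hb; eexists; exists f; split; [exact Hf|split; [|exact Hx]].
      apply (bloch_norm_le _ 1), Z. }
  destruct b as [m| |]; simpl in L, B0; try contradiction.
  assert (HT' : bounded_operator to_boundary (resolvent lam (generator to_boundary)) m).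
  { destruct HT as [T1 T2 T3 T4 T5 T6]; split; auto.
    intros h f N H HN.
    pose proof (bloch_le_pos h N HN) as N0.
    (* Homogeneity divides by N; for N = 0 the bound already known for the resolvent gives 0. *)
    destruct (Req_dec N 0) as [NZ|NZ].
    { specialize (T6 h f N H HN); rewrite NZ, Rmult_0_r in *; exact T6. }
    assert (NC : RtoC N <> 0%C) by (apply RtoC_neq_0, NZ).
    pose proof (little_bloch_i_holomorphic _ _ (T2 h f H)) as Oh.
    pose proof (T5 (/ N)%C 0%C h f h f H H) as H'.
    pose proof (bloch_le_scal (/ N) h N Oh HN) as B1.
    rewrite Cmod_inv, Cmod_R, Rabs_pos_eq, Rinv_l in B1 by assumption.
    pose proof (T6 _ _ _ H' B1) as B2.
    destruct (bloch_norm_finite _ _ B2) as [x Hx].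
    assert (Lx : x <= m).
    { apply (Hb x); eexists; eexists; split; [exact H'|split; [|exact Hx]].
      apply (bloch_norm_le _ 1), B1. }
    pose proof (T3 _ _ H') as X'.
    pose proof (little_bloch_i_holomorphic _ _ X') as O'.
    assert (B3 : bloch_le (fun w => / N * f w + 0 * f w)%C m).
    { apply bloch_le_weaken with x; [|exact Lx].
      apply bloch_norm_le; rewrite Hx; apply Rle_refl. }
    pose proof (bloch_le_scal N _ m O' B3) as B4.
    rewrite Cmod_R, Rabs_pos_eq, Rmult_comm in B4 by exact N0.
    apply (bloch_le_ext _ f _) with (3 := B4).
    - eapply holomorphic_U_intro; intros w Hw; apply is_Cderive_lin; assumption.
    - intros w _; simpl; field; exact NC. }
  destruct (inv_Re_in_spectrum lam Hlam) as [H1 H2].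
  apply H1, (bounded_operator_neumann _ HF _ m HT').
  rewrite H2; split; assumption.
Qed.

Theorem theorem3p5 (F : (C -> Prop) -> Prop)
  (hF : F = im_to_zero \/ F = to_boundary)
  (lam : C) (hlam : resolvent_set (little_bloch_i F) (generator F) lam) :
  (forall h f : C -> C, little_bloch_i F h -> resolvent lam (generator F) h f ->
    (0 < Re lam -> exists g : C -> C,
      (forall w : C, U w -> exists v : C,
        is_int_to_infty (fun z => / cpow z (lam + 1) * h z)%C w v /\
        g w = (cpow w lam * v)%C) /\
      normalization_of g f) /\
    (Re lam < 0 -> exists g : C -> C,
      (forall w : C, U w -> exists v : C,
        is_int_from_0 (fun z => / cpow z (lam + 1) * h z)%C w v /\
        g w = (- cpow w lam * v)%C) /\
      normalization_of g f)) /\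
  Re lam <> 0 /\
  (forall w : C,
    spectrum (little_bloch_i F) (resolvent lam (generator F)) w <->
    Cmod (w - RtoC (1 / (2 * Re lam)))%C = 1 / (2 * Rabs (Re lam))) /\
  spectral_radius (little_bloch_i F) (resolvent lam (generator F)) =
    Finite (1 / Rabs (Re lam)) /\
  op_norm (resolvent lam (generator F)) = Finite (1 / Rabs (Re lam)).
Proof.
destruct hF as [->| ->]; [destruct (im_to_zero_resolvent_set_empty lam hlam)|].
pose proof to_boundary_boundary_filter as HF.
split; [|split; [|split; [|split]]].
- intros h f _ H.
  assert (f0 : f Ci = 0%C) by (destruct H as [k [[[_ f0] _] _]]; exact f0).
  (* The integral formula yields this shift of f, which need not vanish at i; subtracting its value
     there returns f. *)
  split; intros Hl; exists (fun w => f w + Ci * C_derive f Ci / lam)%C;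
    (split; [|apply normalization_of_shift, f0]); intros w Hw.
  + exists (/ cpow w lam * (f w + Ci * C_derive f Ci / lam))%C; split.
    * apply (resolvent_integral_to_infty to_boundary HF); assumption.
    * set (c := (Ci * C_derive f Ci / lam)%C); field; apply cpow_neq_0.
  + exists (- (/ cpow w lam * (f w + Ci * C_derive f Ci / lam)))%C; split.
    * apply (resolvent_integral_from_0 to_boundary HF); assumption.
    * set (c := (Ci * C_derive f Ci / lam)%C); field; apply cpow_neq_0.
- apply resolvent_set_Re_neq_0, hlam.
- intros w; apply resolvent_spectrum, hlam.
- apply resolvent_spectral_radius, hlam.
- apply resolvent_op_norm, hlam.
Qed.
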